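(* Let $\Omega$ be a simple unit $n$-form on $\mathbb{R}^{n+m}$, let $Q$ be the $n$-dimensional subspace of $\mathbb{R}^{n+m}$ dual to $\Omega$, and let $$\Xi=\{P\in G(n,m)\;:\;P\text{ is a graph over }Q\text{ and }|\lambda_i(P)\lambda_j(P)|\le 1\text{ for all }i\ne j\},$$ where $\lambda_1(P),\dots,\lambda_n(P)$ are the singular values of the linear map $L_P:Q\to Q^\perp$ whose graph is $P$. Then $\Xi$ is a convex subset of $G(n,m)$ with respect to the Grassmannian metric.
   Context: $G(n,m)=SO(n+m)/(SO(n)\times SO(m))$ is the Grassmannian of (oriented) $n$-dimensional subspaces of $\mathbb{R}^{n+m}$. Its tangent space at $P$ is identified with $\mathrm{Hom}(P,P^\perp)$, i.e. with $n\times m$ matrices $A=(A_{i\alpha})$ in orthonormal bases of $P$ and $P^\perp$; the Grassmannian metric is the homogeneous Riemannian metric $ds^2=\sum_{i,\alpha}A_{i\alpha}^2$. A subset of $G(n,m)$ is convex if any two of its points can be joined by a minimizing geodesic of $G(n,m)$ contained in the subset. A simple unit $n$-form is $\Omega=a_1^*\wedge\dots\wedge a_n^*$ with $a_1,\dots,a_n$ orthonormal in $\mathbb{R}^{n+m}$; the dual subspace is $Q=\mathrm{span}(a_1,\dots,a_n)$, oriented by $a_1\wedge\dots\wedge a_n$. For $P\in G(n,m)$, $\Omega(P)=\Omega(e_1,\dots,e_n)$ for any oriented orthonormal basis $e_1,\dots,e_n$ of $P$. ''$P$ is a graph over $Q$'' means $P=\{q+L_P(q):q\in Q\}$ for a linear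 map $L_P:Q\to Q^\perp$, with $P$ carrying the orientation transported from $Q$ (equivalently $\Omega(P)>0$). The $\lambda_i(P)$ are the $n$ eigenvalues of $\sqrt{L_P^TL_P}$, listed with multiplicity. *)

(* Defs.v *)
From HB Require Import structures.
From mathcomp Require Import all_boot all_order all_algebra generic_quotient.
From mathcomp Require Import all_classical all_reals all_analysis.

Set Implicit Arguments.
Unset Strict Implicit.
Unset Printing Implicit Defensive.

Import Order.TTheory GRing.Theory Num.Theory.
Import numFieldNormedType.Exports.

Local Open Scope classical_set_scope.
Local Open Scope quotient_scope.
Local Open Scope ring_scope.

(* Vectors of R^(n+m) are row vectors, and a family of n vectors is the matrix
   having them as rows; thus V *m W^T is the matrix of the inner products
   <V_i, W_j>. *)

(* For bases V and W of n-dimensional subspaces: the two subspaces are equal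
   and V and W induce the same orientation of it. *)
Definition same_oriented_span (R : realType) (n N : nat) (V W : 'M[R]_(n, N)) :
  Prop := exists2 g : 'M[R]_n, 0 < \det g & W = g *m V.

Definition orthonormal_frame (R : realType) (n N : nat) : Type :=
  {E : 'M[R]_(n, N) | E *m E^T == 1%:M}.

Section Grassmannian.
Variables (R : realType) (n m : nat).

Definition frame_rel : rel (orthonormal_frame R n (n + m)) :=
  fun e f => `[< same_oriented_span (val e) (val f) >].

Lemma frame_rel_refl : reflexive frame_rel.
Proof.
by move=> e; apply/asboolP; exists 1%:M; rewrite ?det1 ?mul1mx.
Qed.

Lemma frame_rel_sym : symmetric frame_rel.
Proof.
suff H e f : frame_rel e f -> frame_rel f e by move=> e f; apply/idP/idP; apply: H.
move=> /asboolP[g g0 fE]; apply/asboolP; exists (invmx g).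
  by rewrite det_inv invr_gt0.
have gU : g \in unitmx by rewrite unitmxE unitfE gt_eqF.
by rewrite fE mulKmx.
Qed.

Lemma frame_rel_trans : transitive frame_rel.
Proof.
move=> f e h /asboolP[g g0 fE] /asboolP[k k0 hE]; apply/asboolP.
by exists (k *m g); rewrite ?det_mulmx ?mulr_gt0// hE fE mulmxA.
Qed.

Canonical frame_equiv :=
  EquivRel frame_rel frame_rel_refl frame_rel_sym frame_rel_trans.

(* The oriented n-dimensional subspaces of R^(n+m). *)
Definition grassmannian : Type := {eq_quot frame_equiv}.

Definition oriented_span (e : orthonormal_frame R n (n + m)) : grassmannian :=
  \pi_grassmannian e.

(* a_1^* /\ ... /\ a_n^*, as a function of n vectors. *)
Definition simple_form (a : orthonormal_frame R n (n + m))
  (V : 'M[R]_(n, n + m)) : R := \det (V *m (val a)^T).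

Definition simple_unit_form (Omega : 'M[R]_(n, n + m) -> R) : Prop :=
  exists a, Omega = simple_form a.

Definition dual_subspace (Omega : 'M[R]_(n, n + m) -> R) (Q : grassmannian) :
  Prop := exists2 a, Omega = simple_form a & Q = oriented_span a.

(* L is the linear map span(a) -> span(a)^perp sending a_i to the i-th row
   of L; its graph has the basis (a_i + L a_i)_i, which also carries the
   orientation transported from span(a). *)
Definition is_graph_map (a : orthonormal_frame R n (n + m))
    (L : 'M[R]_(n, n + m)) (P : grassmannian) : Prop :=
  L *m (val a)^T = 0 /\ same_oriented_span (val a + L) (val (repr P)).

(* S is the nonnegative symmetric square root of B. *)
Definition is_sqrtmx (S B : 'M[R]_n) : Prop :=
  [/\ S^T = S, forall u : 'rV[R]_n, 0 <= (u *m S *m u^T) 0 0 & S *m S = B].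

(* With rows of L the images of an orthonormal basis, L *m L^T is the matrix
   of the endomorphism "adjoint of L, after L" in that basis. *)
Definition singular_values (L : 'M[R]_(n, n + m)) (lam : 'I_n -> R) : Prop :=
  exists2 S, is_sqrtmx S (L *m L^T) &
    char_poly S = \prod_(i < n) ('X - (lam i)%:P).

Definition Xi (Q : grassmannian) : set grassmannian :=
  [set P | exists a L lam,
    [/\ Q = oriented_span a, is_graph_map a L P, singular_values L lam &
        forall i j, i != j -> `|lam i * lam j| <= 1]].

Definition mx_derive (E : R -> 'M[R]_(n, n + m)) (t : R) : 'M[R]_(n, n + m) :=
  \matrix_(i, j) derive1 (fun s => E s i j) t.

Definition mx_C1 (E : R -> 'M[R]_(n, n + m)) : Prop :=
  forall i j, (forall t, derivable (fun s => E s i j) t 1) /\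
              continuous (derive1 (fun s => E s i j)).

Definition mx_C2 (E : R -> 'M[R]_(n, n + m)) : Prop :=
  mx_C1 E /\ mx_C1 (mx_derive E).

(* Curves in the Grassmannian are parametrized by [0, 1] and handled through
   lifts to frames: frames form a principal bundle over the Grassmannian, which
   is trivial over an interval, so a curve is C^k iff it has a C^k lift.
   Values outside [0, 1] are irrelevant: a C^k function on [0, 1] (one-sided
   derivatives at the end points) extends to a C^k function on the line. *)
Definition is_lift (gam : R -> grassmannian) (E : R -> 'M[R]_(n, n + m)) :
  Prop := forall t, 0 <= t <= 1 -> exists2 e, val e = E t & gam t = oriented_span e.

Definition perp_proj (V : 'M[R]_(n, n + m)) : 'M[R]_(n + m) :=
  1%:M - V^T *m V.

(* The tangent vector at t, an element A of Hom(P, P^perp): its i-th row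
   is A(E_i), the component of E_i' orthogonal to P. *)
Definition velocity (E : R -> 'M[R]_(n, n + m)) (t : R) : 'M[R]_(n, n + m) :=
  mx_derive E t *m perp_proj (E t).

(* The sum of the squares of the coordinates is the same in the canonical basis
   of R^(n+m) as in an orthonormal basis of P^perp, which contains the rows. *)
Definition speed (E : R -> 'M[R]_(n, n + m)) (t : R) : R :=
  Num.sqrt (\sum_i \sum_j velocity E t i j ^+ 2).

(* The length of the curve spanned by E, whatever the lift E. *)
Definition curve_length (E : R -> 'M[R]_(n, n + m)) : R :=
  \int[lebesgue_measure]_(t in `[0, 1]) speed E t.

(* Covariant derivative of the velocity A for the Levi-Civita connection, the
   one induced on Hom(P, P^perp) by the orthogonal projections to P and P^perp:
   (DA)(E_i) = proj_{P^perp} ((A(E_i))') - A (proj_P (E_i')). *)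
Definition acceleration (E : R -> 'M[R]_(n, n + m)) (t : R) :
    'M[R]_(n, n + m) :=
  mx_derive (velocity E) t *m perp_proj (E t)
  - mx_derive E t *m (E t)^T *m velocity E t.

(* Competitors are C^1 and not required to be regular, so piecewise C^1 curves
   are covered: they can be reparametrized to stop at their corners. *)
Definition minimizing_geodesic (gam : R -> grassmannian) : Prop :=
  exists E, [/\ is_lift gam E, mx_C2 E,
    forall t, 0 <= t <= 1 -> acceleration E t = 0 &
    forall del F, is_lift del F -> mx_C1 F ->
      del 0 = gam 0 -> del 1 = gam 1 -> curve_length E <= curve_length F].

Definition geodesically_convex (X : set grassmannian) : Prop :=
  forall P P', X P -> X P' -> exists gam,
    [/\ minimizing_geodesic gam, gam 0 = P, gam 1 = P' &
        forall t, 0 <= t <= 1 -> X (gam t)].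

End Grassmannian.

(* Main.v *)
Require Import Defs.
From mathcomp Require Import all_boot all_order all_algebra perm generic_quotient.
From mathcomp Require Import all_classical all_reals all_analysis.
From mathcomp Require Import ring lra.

Set Implicit Arguments.
Unset Strict Implicit.
Unset Printing Implicit Defensive.

Import Order.TTheory GRing.Theory Num.Theory.
Import numFieldNormedType.Exports.

Local Open Scope classical_set_scope.
Local Open Scope ring_scope.

(* Fix a frame a of Q and describe P by X = E a^T, for a frame E of P: P lies in Xi
   iff det X > 0 and |uX|^2 + |vX|^2 >= 1 for all orthonormal pairs u, v. Along a
   geodesic t |-> cos(t th_i) e_i + sin(t th_i) f_i, the least value of
   |uX|^2 + |vX|^2 obeys a maximum principle: a geodesic which stays in Xi and whose
   ends satisfy the strict inequality satisfies it throughout. Given P and P' in Xi,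
   the graphs of L0 and L1, consider minimizing geodesics from the graph of s L0 to
   the graph of s L1. For s < 1, one which stays in Xi does not reach the cut
   locus, hence is the only one; so staying in Xi is an open and closed condition
   on s in [0, 1), satisfied at s = 0, and a limit s -> 1 gives a geodesic in Xi
   from P to P'.

   Its length is (sum_i th_i^2)^(1/2). No other curve is shorter: measure two frames
   by the l^2 norm of the angles between corresponding vectors, maximized over
   common orthogonal transformations, and minimize over rotations of one frame.
   This is a distance of oriented subspaces which grows along a curve at most at
   the speed of the curve, and which is at least (sum_i th_i^2)^(1/2) for P, P'. *)

(** Orientation shapes the statements. Decompositions use rotations only, so the last singular value
    may be negative; what remains is s_i + s_j >= 0, that is th_i + th_j <= pi, with the cut locus
    at equality. Scaling by s multiplies lam_i lam_j by s^2, which makes the pair inequality strict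
    at the ends for s < 1. Both the maximum principle and the exclusion of the cut locus, where a
    whole circle of geodesics joins the ends, rest on this strictness. It is lost at s = 1, hence
    the passage to a limit in a compact set of geodesic data.

    The maximum principle needs the two least singular values together: the bound for the second
    derivative of a single squared cosine below 1/2 has a positive coefficient, and it is only under
    g_1 + g_2 >= 1 that the two bounds combine to a multiple of the first derivative of the sum. *)

(** * Determinants of small size *)

(** Sylvester's identity. It is applied to 1 plus a matrix of rank two, where it leaves a 2 by 2
    determinant. *)
Lemma det_1DmulC (R : comNzRingType) (n p : nat) (U : 'M[R]_(n, p))
  (V : 'M[R]_(p, n)) : \det (1%:M + U *m V) = \det (1%:M + V *m U).
Proof.
have /(congr1 determinant) : block_mx 1%:M 0 U 1%:M *m
    block_mx 1%:M (- V) 0 (1%:M + U *m V)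
    = block_mx 1%:M (- V) 0 1%:M *m block_mx (1%:M + V *m U) 0 U 1%:M
      :> 'M[R]_(p + n).
  rewrite !mulmx_block ?mul1mx ?mul0mx ?mulmx0 ?mulmx1 ?addr0 ?add0r.
  by rewrite mulNmx mulmxN [- (U *m V) + _]addrC !addrK.
by rewrite !det_mulmx !det_lblock !det_ublock !det1 !mul1r mulr1.
Qed.

Lemma det_mx22 (R : comNzRingType) (A : 'M[R]_2) :
  \det A = A 0 0 * A 1 1 - A 0 1 * A 1 0.
Proof.
rewrite (expand_det_row _ 0) big_ord_recl big_ord1 /cofactor !det_mx11 !mxE /=.
rewrite expr0 mul1r expr1 mulN1r mulrN.
by congr (A _ _ * A _ _ - A _ _ * A _ _); apply/val_inj.
Qed.

(** * Inner products and orthogonal matrices *)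

Section Dot.
Variable R : rcfType.
Implicit Types n m p N : nat.

Definition dot n (u v : 'rV[R]_n) : R := (u *m v^T) 0 0.

Lemma dotE n (u v : 'rV[R]_n) : dot u v = \sum_i u 0 i * v 0 i.
Proof. by rewrite /dot mxE; apply: eq_bigr => i _; rewrite mxE. Qed.

Lemma dotC n (u v : 'rV[R]_n) : dot u v = dot v u.
Proof. by rewrite !dotE; apply: eq_bigr => i _; rewrite mulrC. Qed.

Lemma dotDl n (u v w : 'rV[R]_n) : dot (u + v) w = dot u w + dot v w.
Proof. by rewrite /dot mulmxDl mxE. Qed.

Lemma dotDr n (u v w : 'rV[R]_n) : dot w (u + v) = dot w u + dot w v.
Proof. by rewrite dotC dotDl !(dotC w). Qed.

Lemma dotZl n a (u v : 'rV[R]_n) : dot (a *: u) v = a * dot u v.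
Proof. by rewrite /dot -scalemxAl mxE. Qed.

Lemma dotZr n a (u v : 'rV[R]_n) : dot u (a *: v) = a * dot u v.
Proof. by rewrite dotC dotZl dotC. Qed.

Lemma dotNl n (u v : 'rV[R]_n) : dot (- u) v = - dot u v.
Proof. by rewrite -scaleN1r dotZl mulN1r. Qed.

Lemma dotNr n (u v : 'rV[R]_n) : dot u (- v) = - dot u v.
Proof. by rewrite dotC dotNl dotC. Qed.

Lemma dotBl n (u v w : 'rV[R]_n) : dot (u - v) w = dot u w - dot v w.
Proof. by rewrite dotDl dotNl. Qed.

Lemma dotBr n (u v w : 'rV[R]_n) : dot w (u - v) = dot w u - dot w v.
Proof. by rewrite dotDr dotNr. Qed.

Lemma dot0l n (u : 'rV[R]_n) : dot 0 u = 0.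
Proof. by rewrite /dot mul0mx mxE. Qed.

Lemma dot0r n (u : 'rV[R]_n) : dot u 0 = 0.
Proof. by rewrite dotC dot0l. Qed.

Lemma dot_mulmx n p (u : 'rV[R]_n) (A : 'M[R]_(n, p)) (v : 'rV[R]_p) :
  dot (u *m A) v = dot u (v *m A^T).
Proof. by rewrite /dot trmx_mul trmxK mulmxA. Qed.

Lemma dot_ge0 n (u : 'rV[R]_n) : 0 <= dot u u.
Proof. by rewrite dotE sumr_ge0 // => i _; rewrite -expr2 sqr_ge0. Qed.

Lemma dot_eq0 n (u : 'rV[R]_n) : (dot u u == 0) = (u == 0).
Proof.
apply/idP/eqP => [|->]; last by rewrite dot0l eqxx.
rewrite dotE psumr_eq0; last by move=> i _; rewrite -expr2 sqr_ge0.
move=> /allP u0; apply/rowP => i; rewrite mxE; apply/eqP.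
by have := u0 i; rewrite mem_index_enum mulf_eq0 orbb => /(_ isT).
Qed.

Lemma dot_gt0 n (u : 'rV[R]_n) : (0 < dot u u) = (u != 0).
Proof. by rewrite lt0r dot_eq0 dot_ge0 andbT. Qed.

Lemma dot_sum_row n N (V : 'M[R]_(n, N)) (u : 'rV[R]_N) i :
  (u *m V^T) 0 i = dot u (row i V).
Proof. by rewrite dotE mxE; apply: eq_bigr => j _; rewrite !mxE. Qed.

Lemma mulmx_trE n m N (V : 'M[R]_(n, N)) (W : 'M[R]_(m, N)) i j :
  (V *m W^T) i j = dot (row i V) (row j W).
Proof. by rewrite dotE mxE; apply: eq_bigr => k _; rewrite !mxE. Qed.

Lemma dot_CS n (u v : 'rV[R]_n) : dot u v ^+ 2 <= dot u u * dot v v.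
Proof.
have [->|v0] := eqVneq v 0; first by rewrite !dot0r mulr0 expr0n.
have dv : 0 < dot v v by rewrite dot_gt0.
have := dot_ge0 (dot v v *: u - dot u v *: v).
rewrite !(dotBl, dotBr, dotZl, dotZr) (dotC v u) => h.
have {h} : 0 <= dot v v * (dot u u * dot v v - dot u v ^+ 2).
  by apply: le_trans h _; rewrite le_eqVlt; apply/orP; left; apply/eqP; ring.
by rewrite pmulr_rge0 // subr_ge0.
Qed.

Lemma dot_le n (u v : 'rV[R]_n) : dot u u = 1 -> dot v v = 1 -> -1 <= dot u v <= 1.
Proof.
move=> u1 v1; have := dot_CS u v; rewrite u1 v1 mulr1 => h.
by rewrite -ler_norml -(@ler_pXn2r _ 2) ?nnegrE // expr1n real_normK ?num_real.
Qed.

Definition ortho n N (V : 'M[R]_(n, N)) : Prop := V *m V^T = 1%:M.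

Lemma ortho1 n : ortho (1%:M : 'M[R]_n).
Proof. by rewrite /ortho trmx1 mulmx1. Qed.

Lemma ortho_mul n m N (k : 'M[R]_(m, n)) (V : 'M[R]_(n, N)) :
  ortho k -> ortho V -> ortho (k *m V).
Proof. by move=> ok oV; rewrite /ortho trmx_mul mulmxA -(mulmxA k) oV mulmx1. Qed.

Lemma orthoC n (k : 'M[R]_n) : ortho k -> k^T *m k = 1%:M.
Proof. by move=> /mulmx1C. Qed.

Lemma ortho_tr n (k : 'M[R]_n) : ortho k -> ortho k^T.
Proof. by move=> ok; rewrite /ortho trmxK orthoC. Qed.

Lemma ortho_det2 n (k : 'M[R]_n) : ortho k -> \det k ^+ 2 = 1.
Proof. by move=> /(congr1 determinant); rewrite det_mulmx det_tr det1 expr2. Qed.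

Lemma ortho_det n (k : 'M[R]_n) : ortho k -> \det k = 1 \/ \det k = -1.
Proof.
move=> /ortho_det2/eqP; rewrite -subr_eq0 -[X in _ - X](expr1n _ 2) subr_sqr mulf_eq0 subr_eq0 addr_eq0.
by case/orP => /eqP ->; [left|right].
Qed.

Lemma dot_ortho n N (V : 'M[R]_(n, N)) (u v : 'rV[R]_n) :
  ortho V -> dot (u *m V) (v *m V) = dot u v.
Proof. by move=> oV; rewrite dot_mulmx -mulmxA oV mulmx1. Qed.

Lemma ortho_rowE n N (V : 'M[R]_(n, N)) i j : ortho V ->
  dot (row i V) (row j V) = (i == j)%:R.
Proof. by move=> oV; rewrite -mulmx_trE oV mxE. Qed.

Lemma ortho_row1 n N (V : 'M[R]_(n, N)) i : ortho V ->
  dot (row i V) (row i V) = 1.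
Proof. by move=> oV; rewrite ortho_rowE // eqxx. Qed.

Lemma orthoP n N (V : 'M[R]_(n, N)) :
  (forall i j, dot (row i V) (row j V) = (i == j)%:R) -> ortho V.
Proof. by move=> h; apply/matrixP => i j; rewrite mulmx_trE h mxE. Qed.

Lemma bessel n N (V : 'M[R]_(n, N)) (w : 'rV[R]_N) : ortho V ->
  dot (w *m V^T) (w *m V^T) <= dot w w.
Proof.
move=> oV; have := dot_ge0 (w - w *m V^T *m V).
rewrite !(dotBl, dotBr) dot_ortho // dot_mulmx (dotC w (_ *m V)) dot_mulmx.
by lra.
Qed.

Lemma ortho_entry n N (V : 'M[R]_(n, N)) i j : ortho V -> V i j ^+ 2 <= 1.
Proof.
move=> oV; have := ortho_row1 i oV; rewrite dotE => <-.
rewrite (bigD1 j) //= !mxE -expr2 lerDl sumr_ge0 // => k _.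
by rewrite -expr2 sqr_ge0.
Qed.

Lemma ortho_entry_le n N (V : 'M[R]_(n, N)) i j : ortho V -> -1 <= V i j <= 1.
Proof.
move=> oV; rewrite -ler_norml -(@ler_pXn2r _ 2) ?nnegrE // expr1n.
by rewrite real_normK ?num_real // ortho_entry.
Qed.

Lemma ortho_trmul_le n N (V W : 'M[R]_(n, N)) i :
  ortho V -> ortho W -> -1 <= (V *m W^T) i i <= 1.
Proof.
by move=> oV oW; rewrite mulmx_trE dot_le // ortho_row1.
Qed.

Lemma ortho_diag1 n (k : 'M[R]_n) : ortho k -> (forall i, k i i = 1) -> k = 1%:M.
Proof.
move=> ok k1; apply/matrixP => i j; rewrite mxE.
have [<-|ij] := eqVneq i j; first by rewrite k1.
have := ortho_row1 i ok; rewrite dotE (bigD1 i) //= !mxE k1 mulr1.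
move=> /(canRL (addKr _)); rewrite addNr => /eqP.
rewrite psumr_eq0; last by move=> l _; rewrite -expr2 sqr_ge0.
move=> /allP /(_ j); rewrite mem_index_enum mxE mulf_eq0 orbb eq_sym ij.
by move=> /(_ isT) /eqP.
Qed.

Lemma unit_kernel n (A : 'M[R]_n) : \det A = 0 ->
  exists2 u : 'rV[R]_n, dot u u = 1 & u *m A = 0.
Proof.
move=> /eqP /det0P [v v0 vA].
have dv : 0 < dot v v by rewrite dot_gt0.
exists ((Num.sqrt (dot v v))^-1 *: v); last by rewrite -scalemxAl vA scaler0.
rewrite dotZl dotZr mulrA -expr2 exprVn sqr_sqrtr ?dot_ge0 //.
by rewrite mulVf // gt_eqF.
Qed.

Lemma mxtraceE_ortho n (g : 'M[R]_n) : ortho g -> \tr g <= n%:R.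
Proof.
move=> og; rewrite /mxtrace (le_trans (ler_sum _ (_ : forall i, true -> g i i <= 1))) //.
  by move=> i _; have /andP[] := ortho_entry_le i i og.
by rewrite sumr_const card_ord.
Qed.

(** From g + 1 = (1 + g^T) g, det (g + 1) is its own opposite, so -1 is an eigenvalue. *)
Lemma ortho_reflection_eigen n (g : 'M[R]_n) : ortho g -> \det g = -1 ->
  exists2 x : 'rV[R]_n, dot x x = 1 & x *m g = - x.
Proof.
move=> og dg; have : \det (g + 1%:M) = 0.
  suff h : \det (g + 1%:M) = - \det (g + 1%:M) by lra.
  rewrite -[in LHS](ortho_tr og) trmxK -{1}(mul1mx g) -mulmxDl det_mulmx dg.
  by rewrite -det_tr linearD /= trmxK trmx1 mulrN1 addrC.
case/unit_kernel => x x1 xg; exists x => //.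
by move/eqP: xg; rewrite mulmxDr mulmx1 addr_eq0 => /eqP.
Qed.

Definition householder n (x : 'rV[R]_n) : 'M[R]_n := 1%:M - 2%:R *: (x^T *m x).

Lemma householder_ortho n (x : 'rV[R]_n) : dot x x = 1 -> ortho (householder x).
Proof.
move=> x1; have xx : x *m x^T = 1%:M.
  by apply/matrixP => i j; rewrite !ord1 -/(dot x x) x1 mxE eqxx.
pose y := x^T *m x.
have yy : y *m y = y by rewrite /y mulmxA -(mulmxA x^T) xx mulmx1.
have yt : (householder x)^T = 1%:M - 2%:R *: y.
  by rewrite /householder -/y; apply/matrixP => i j; rewrite !mxE (eq_sym j);
     congr (_ - _ * _); apply: eq_bigr => k _; rewrite !mxE mulrC.
rewrite /ortho yt /householder -/y mulmxBl mul1mx mulmxBr mulmx1.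
rewrite -!scalemxAl -!scalemxAr yy scalerA.
by clearbody y; apply/matrixP => i j; rewrite !mxE; ring.
Qed.

(** Composing with the reflection along an eigenvector for -1 raises the trace by 2, and the result
    is still orthogonal, of trace at most n. *)
Lemma tr_ortho_reflection n (g : 'M[R]_n) : ortho g -> \det g = -1 ->
  \tr g <= n%:R - 2%:R.
Proof.
move=> og dg; have [x x1 xg] := ortho_reflection_eigen og dg.
have := mxtraceE_ortho (ortho_mul (householder_ortho x1) og).
rewrite /householder mulmxBl mul1mx -scalemxAl linearB linearZ /= -mulmxA xg.
rewrite mulmxN linearN /= mxtrace_mulC /mxtrace big_ord1 -/(dot x x) x1.
by rewrite mulrN1 opprK lerBrDr.
Qed.

(** Changing the sign of row i gives determinant -1, and [tr_ortho_reflection] applies. A single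
    diagonal entry of a rotation cannot fall below 1 unless others do. *)
Lemma rot_diag n (g : 'M[R]_n) i : ortho g -> \det g = 1 ->
  1 - g i i <= \sum_(j < n | j != i) (1 - g j j).
Proof.
move=> og dg; pose d : 'rV[R]_n := \row_j (if j == i then -1 else 1).
have dd : \det (diag_mx d) = -1.
  rewrite det_diag (bigD1 i) //= big1 ?mulr1 => [|j ji]; last by rewrite mxE (negbTE ji).
  by rewrite mxE eqxx.
have od : ortho (diag_mx d).
  rewrite /ortho tr_diag_mx; apply/matrixP => p q; rewrite mul_diag_mx !mxE.
  have [->|] := eqVneq p q; rewrite ?eqxx ?mulr0n ?mulr0 // mulr1n.
  by case: ifP; rewrite ?mulrNN ?mulr1.
have := tr_ortho_reflection (ortho_mul od og).
rewrite det_mulmx dd dg mulr1 => /(_ erefl).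
rewrite /mxtrace (bigD1 i) //= mul_diag_mx !mxE eqxx mulN1r.
rewrite (eq_bigr (fun j => g j j)); last first.
  by move=> j ji; rewrite !mxE (negbTE ji) mul1r.
rewrite sumrB (eq_bigl (fun j => j \in predC1 i)) // sumr_const.
have := cardC1 i; rewrite card_ord => ->.
have n0 : (0 < n)%N by exact: leq_ltn_trans (leq0n i) (ltn_ord i).
have -> : n%:R = n.-1%:R + 1 :> R by rewrite -{1}(prednK n0) -natr1.
set S := \sum_(_ | _) _; lra.
Qed.

(** At most one weight is negative. [rot_diag] spreads its defect 1 - g_ii over the other indices,
    whose weights outweigh it. *)
Lemma sum_diag_rot_le n (s : 'I_n -> R) (g : 'M[R]_n) :
  (forall i j, i != j -> 0 <= s i + s j) -> ortho g -> \det g = 1 ->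
  \sum_i s i * g i i <= \sum_i s i.
Proof.
move=> s2 og dg; rewrite -subr_ge0 -sumrB.
have g1 j : 0 <= 1 - g j j.
  by rewrite subr_ge0; have /andP[] := ortho_entry_le j j og.
have [s0|] := pselect (forall i, 0 <= s i).
  by apply: sumr_ge0 => i _; rewrite -[X in X - _]mulr1 -mulrBr mulr_ge0.
move=> /existsNP [i /negP]; rewrite -ltNge => si.
rewrite (bigD1 i) //=.
have : - s i * (1 - g i i) <= \sum_(j < n | j != i) (s j - s j * g j j).
  apply: le_trans (_ : - s i * \sum_(j < n | j != i) (1 - g j j) <= _).
    by rewrite ler_pM2l ?oppr_gt0 // rot_diag.
  rewrite mulr_sumr ler_sum // => j ji.
  rewrite -[X in _ <= X - _]mulr1 -mulrBr ler_wpM2r //.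
  by have := s2 _ _ ji; lra.
set S := \sum_(_ | _) _; lra.
Qed.

(** Equality case of [sum_diag_rot_le] for strict pair sums, the source of uniqueness of geodesics
    off the cut locus. *)
Lemma sum_diag_rot_eq n (s : 'I_n -> R) (g : 'M[R]_n) :
  (forall i j, i != j -> 0 < s i + s j) -> ortho g -> \det g = 1 ->
  \sum_i s i <= \sum_i s i * g i i -> g = 1%:M.
Proof.
move=> s2 og dg le_s; apply: ortho_diag1 => //.
have g1 j : 0 <= 1 - g j j.
  by rewrite subr_ge0; have /andP[] := ortho_entry_le j j og.
have E : \sum_i s i * (1 - g i i) <= 0.
  under eq_bigr do rewrite mulrBr mulr1.
  by rewrite sumrB subr_le0.
have [s0|] := pselect (forall i, 0 < s i).
  move=> i; have : \sum_i s i * (1 - g i i) == 0.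
    by rewrite eq_le E sumr_ge0 // => j _; rewrite mulr_ge0 // ltW.
  rewrite psumr_eq0; last by move=> j _; rewrite mulr_ge0 // ltW.
  move=> /allP /(_ i); rewrite mem_index_enum => /(_ isT) /=.
  by rewrite mulf_eq0 gt_eqF //= subr_eq0 => /eqP.
move=> /existsNP [i /negP]; rewrite -leNgt => si.
(* With s_i <= 0, [rot_diag] turns the defect at i into weights s_i + s_j > 0 on the other defects,
   which must then vanish. *)
have z j : j != i -> g j j = 1.
  have : \sum_(j < n | j != i) (s i + s j) * (1 - g j j) <= 0.
    under eq_bigr do rewrite mulrDl.
    rewrite big_split /= -mulr_sumr.
    have : s i * \sum_(j < n | j != i) (1 - g j j) <= s i * (1 - g i i).
      by rewrite ler_wnM2l // rot_diag.
    move: E; rewrite (bigD1 i) //=.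
    by set A := \sum_(_ | _) _; set B := \sum_(_ | _) _; lra.
  move=> E2; have : \sum_(j < n | j != i) (s i + s j) * (1 - g j j) == 0.
    rewrite eq_le E2 sumr_ge0 // => k ki.
    by rewrite mulr_ge0 // addrC ltW // s2.
  rewrite psumr_eq0; last by move=> k ki; rewrite mulr_ge0 // addrC ltW // s2.
  move=> /allP /(_ j); rewrite mem_index_enum => /(_ isT) /= + ji.
  have ij : i != j by rewrite eq_sym.
  by rewrite ji /= mulf_eq0 (gt_eqF (s2 _ _ ij)) /= subr_eq0 => /eqP.
move=> j; have [->|] := eqVneq j i; last exact: z.
have := rot_diag i og dg; rewrite big1 => [|k /z ->]; last by rewrite subrr.
by have := g1 i; lra.
Qed.

End Dot.

(** * Continuity and compactness for matrices *)

Section ContOps.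
Variables (T : topologicalType) (R : realType).
Implicit Types f g : T -> R.

Lemma contM f g : continuous f -> continuous g -> continuous (fun x => f x * g x).
Proof. by move=> cf cg x; apply: continuousM; [exact: cf|exact: cg]. Qed.

Lemma contD f g : continuous f -> continuous g -> continuous (fun x => f x + g x).
Proof. by move=> cf cg x; apply: continuousD; [exact: cf|exact: cg]. Qed.

Lemma contB f g : continuous f -> continuous g -> continuous (fun x => f x - g x).
Proof. by move=> cf cg x; apply: continuousB; [exact: cf|exact: cg]. Qed.

Lemma cont_cst (a : R) : continuous (fun _ : T => a).
Proof. exact: cst_continuous. Qed.

End ContOps.

Lemma cont_sum (T : topologicalType) (R : realType) (I : Type) (r : seq I)
  (P : pred I) (f : I -> T -> R) :
  (forall i, continuous (f i)) -> continuous (fun x => \sum_(i <- r | P i) f i x).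
Proof.
move=> cf; elim: r => [|i r ih].
  by under eq_fun do rewrite big_nil; apply: cst_continuous.
under eq_fun do rewrite big_cons.
case: (P i) => // x; apply: continuousD; [exact: cf | exact: ih].
Qed.

Lemma cont_prod (T : topologicalType) (R : realType) (I : Type) (r : seq I)
  (P : pred I) (f : I -> T -> R) :
  (forall i, continuous (f i)) -> continuous (fun x => \prod_(i <- r | P i) f i x).
Proof.
move=> cf; elim: r => [|i r ih].
  by under eq_fun do rewrite big_nil; apply: cst_continuous.
under eq_fun do rewrite big_cons.
case: (P i) => // x; apply: continuousM; [exact: cf | exact: ih].
Qed.

Section ContMx.
Variables (T : topologicalType) (R : realType).

Definition mxcont m n (F : T -> 'M[R]_(m, n)) :=
  forall i j, continuous (fun x => F x i j).

Lemma mxcont_cst m n (A : 'M[R]_(m, n)) : mxcont (fun=> A).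
Proof. by move=> i j; apply: cst_continuous. Qed.

Lemma mxcont_mul m n p (F : T -> 'M[R]_(m, n)) (G : T -> 'M[R]_(n, p)) :
  mxcont F -> mxcont G -> mxcont (fun x => F x *m G x).
Proof.
move=> cF cG i j; under eq_fun do rewrite mxE.
by apply: cont_sum => k x; apply: continuousM; [exact: cF|exact: cG].
Qed.

Lemma mxcont_tr m n (F : T -> 'M[R]_(m, n)) : mxcont F -> mxcont (fun x => (F x)^T).
Proof. by move=> cF i j; under eq_fun do rewrite mxE; apply: cF. Qed.

Lemma mxcontD m n (F G : T -> 'M[R]_(m, n)) :
  mxcont F -> mxcont G -> mxcont (fun x => F x + G x).
Proof.
move=> cF cG i j; under eq_fun do rewrite mxE.
by move=> x; apply: continuousD; [exact: cF|exact: cG].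
Qed.

Lemma mxcontZ m n (f : T -> R) (F : T -> 'M[R]_(m, n)) :
  continuous f -> mxcont F -> mxcont (fun x => f x *: F x).
Proof.
move=> cf cF i j; under eq_fun do rewrite mxE.
by move=> x; apply: (@continuousM _ _ f (fun x => F x i j)); [exact: cf|exact: cF].
Qed.

Lemma mxcont_det n (F : T -> 'M[R]_n) : mxcont F -> continuous (fun x => \det (F x)).
Proof.
move=> cF; pose D (s : {perm 'I_n}) x : R := (-1) ^+ s * \prod_i F x i (s i).
rewrite (_ : (fun x => _) = (fun x => \sum_s D s x)) //.
apply: cont_sum => s; apply: contM; first exact: cont_cst.
by apply: cont_prod => i; apply: cF.
Qed.

Lemma mxcont_dot n (F G : T -> 'rV[R]_n) : mxcont F -> mxcont G ->
  continuous (fun x => dot (F x) (G x)).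
Proof. by move=> cF cG; apply: mxcont_mul => //; apply: mxcont_tr. Qed.

Lemma closed_lef (f g : T -> R) : continuous f -> continuous g ->
  closed [set x | f x <= g x].
Proof.
move=> cf cg; rewrite (_ : [set x | _] = (fun x => g x - f x) @^-1` [set y | 0 <= y]).
  apply: preimage_closed; last exact: closed_ge.
  by move=> x _; apply: continuousB; [exact: cg|exact: cf].
by apply/seteqP; split => x /=; rewrite subr_ge0.
Qed.

Lemma closed_eqf (f g : T -> R) : continuous f -> continuous g ->
  closed [set x | f x = g x].
Proof.
move=> cf cg; rewrite (_ : [set x | _] = [set x | f x <= g x] `&` [set x | g x <= f x]).
  by apply: closedI; apply: closed_lef.
by apply/seteqP; split => x /=; [move=> ->|case=> a b; apply/eqP; rewrite eq_le a b].
Qed.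

Lemma closed_eqmx m n (F G : T -> 'M[R]_(m, n)) : mxcont F -> mxcont G ->
  closed [set x | F x = G x].
Proof.
move=> cF cG; rewrite (_ : [set x | _] =
    \bigcap_(i in setT) \bigcap_(j in setT) [set x | F x i j = G x i j]).
  by apply: closed_bigI => i _; apply: closed_bigI => j _; apply: closed_eqf.
apply/seteqP; split => x /=; first by move=> h i _ j _; rewrite /= h.
by move=> h; apply/matrixP => i j; exact: h.
Qed.

Lemma closed_forall (I : Type) (P : I -> T -> Prop) :
  (forall i, closed [set x | P i x]) -> closed [set x | forall i, P i x].
Proof.
move=> cP; rewrite (_ : [set x | _] = \bigcap_(i in setT) [set x | P i x]).
  by apply: closed_bigI => i _.
by apply/seteqP; split => x /= h i; [move=> _|]; apply: h.
Qed.

Lemma closed_imp (Q : Prop) (P : T -> Prop) :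
  closed [set x | P x] -> closed [set x | Q -> P x].
Proof.
move=> cP; have [q|nq] := pselect Q.
  rewrite (_ : [set x | _] = [set x | P x]) //.
  by apply/seteqP; split => x /= h; [apply: h|move=> _].
rewrite (_ : [set x | _] = setT); first exact: closedT.
by apply/seteqP; split => x //= _ /nq.
Qed.

Lemma closed_and (P Q : T -> Prop) :
  closed [set x | P x] -> closed [set x | Q x] -> closed [set x | P x /\ Q x].
Proof. by move=> cP cQ; apply: closedI. Qed.

End ContMx.

Lemma compact_proj_closed (R : realType) (T : topologicalType) (K : set T)
  (f : T -> R) (Z : set T) : compact K -> closed Z -> continuous f ->
  closed (f @` (K `&` Z)).
Proof.
move=> cK cZ cf; apply: compact_closed; first exact: norm_hausdorff.
apply: continuous_compact; first exact: continuous_subspaceT.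
by apply: compact_closedI.
Qed.

Lemma vec_mx_continuous (R : realType) m n :
  continuous (@vec_mx R m n : 'rV[R]_(m * n) -> 'M[R]_(m, n)).
Proof.
move=> v A [P hP sPA].
suff h : \forall w \near v, forall i j, P i j (vec_mx w i j).
  by apply: (@filterS _ _ (nbhs_filter v)) h => w h; exact: sPA.
apply: (@filter_forall _ _ (fun i w => forall j, P i j (vec_mx w i j)) _ (nbhs_filter v)) => i.
apply: (@filter_forall _ _ (fun j w => P i j (vec_mx w i j)) _ (nbhs_filter v)) => j.
have := @coord_continuous R 1 (m * n) 0 (mxvec_index i j) v (P i j).
have := hP i j; rewrite mxE => Pv /(_ Pv).
by apply: (@filterS _ _ (nbhs_filter v)) => w; rewrite /= mxE.
Qed.

Lemma mx_compact (R : realType) m n (b : R) :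
  compact [set A : 'M[R]_(m, n) | forall i j, - b <= A i j <= b].
Proof.
rewrite (_ : [set A | _] = vec_mx @` [set v : 'rV[R]_(m * n) |
    forall k, [set` `[- b, b]] (v ord0 k)]).
  apply: continuous_compact.
    by apply: continuous_subspaceT; apply: vec_mx_continuous.
  by apply: (@rV_compact R _ (fun=> [set` `[- b, b]])) => k; apply: segment_compact.
apply/seteqP; split => A /=.
  move=> hA; exists (mxvec A); last by rewrite mxvecK.
  by move=> k; case/mxvec_indexP: k => i j; rewrite mxvecE in_itv /=.
by case=> v hv <- i j; rewrite mxE; have := hv (mxvec_index i j); rewrite in_itv.
Qed.

Lemma mxcont_id (R : realType) m n : mxcont (fun A : 'M[R]_(m, n) => A).
Proof. by move=> i j; apply: coord_continuous. Qed.

Lemma mxcont_comp (R : realType) (S T : topologicalType) m n (f : S -> T)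
  (F : T -> 'M[R]_(m, n)) : continuous f -> mxcont F -> mxcont (F \o f).
Proof. by move=> cf cF i j x; apply: (@continuous_comp _ _ _ f (fun y => F y i j)); [exact: cf|exact: cF]. Qed.

Lemma mxcont_of (R : realType) (T : topologicalType) m n (F : T -> 'M[R]_(m, n)) :
  continuous F -> mxcont F.
Proof.
by move=> cF; apply: (mxcont_comp cF (@mxcont_id R m n)).
Qed.

(** * Signed singular value decomposition *)

Section PlaneRotation.
Variable R : rcfType.

Definition rotation n (k : 'M[R]_n) : Prop := ortho k /\ \det k = 1.

Lemma rotation1 n : rotation (1%:M : 'M[R]_n).
Proof. by split; [exact: ortho1|exact: det1]. Qed.

Lemma rotation_mul n (k l : 'M[R]_n) : rotation k -> rotation l -> rotation (k *m l).
Proof.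
by move=> [ok dk] [ol dl]; split; [exact: ortho_mul|rewrite det_mulmx dk dl mulr1].
Qed.

Lemma rotation_tr n (k : 'M[R]_n) : rotation k -> rotation k^T.
Proof. by move=> [ok dk]; split; [exact: ortho_tr|rewrite det_tr]. Qed.

Lemma dot_delta n (i j : 'I_n) :
  dot (delta_mx 0 i) (delta_mx 0 j) = (i == j)%:R :> R.
Proof. by rewrite -!row1 ortho_rowE //; exact: ortho1. Qed.

Variable n : nat.
Implicit Types i j p q : 'I_n.

Definition plane_rot i j (c s : R) : 'M[R]_n :=
  \matrix_p (if p == i then c *: delta_mx 0 i + s *: delta_mx 0 j
             else if p == j then - s *: delta_mx 0 i + c *: delta_mx 0 j
             else delta_mx 0 p).

Lemma plane_rotE i j c s N (A : 'M[R]_(n, N)) p (q : 'I_N) :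
  (plane_rot i j c s *m A) p q =
  if p == i then c * A i q + s * A j q
  else if p == j then - s * A i q + c * A j q else A p q.
Proof.
have -> : (plane_rot i j c s *m A) p q = (row p (plane_rot i j c s *m A)) 0 q.
  by rewrite [RHS]mxE.
rewrite row_mul rowK; case: ifP => _; last case: ifP => _.
- by rewrite mulmxDl -!scalemxAl -!rowE !mxE.
- by rewrite mulmxDl -!scalemxAl -!rowE !mxE.
- by rewrite -rowE mxE.
Qed.

Lemma plane_rot_ortho i j c s : i != j -> c ^+ 2 + s ^+ 2 = 1 ->
  ortho (plane_rot i j c s).
Proof.
move=> ij cs; apply: orthoP => p q; rewrite !rowK.
have ji := ij; rewrite eq_sym in ji.
have D := (dotDl, dotDr, dotZl, dotZr, dotNl, dotNr, dot_delta).
have [?|pi] := eqVneq p i; [subst p|have [?|pj] := eqVneq p j; [subst p|]];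
  (have [?|qi] := eqVneq q i; [subst q|have [?|qj] := eqVneq q j; [subst q|]]);
  rewrite ?eqxx ?(eq_sym i q) ?(eq_sym j q) ?(negbTE ij) ?(negbTE ji) ?(negbTE pi) ?(negbTE pj)
    ?(negbTE qi) ?(negbTE qj) !D ?eqxx ?(eq_sym i q) ?(eq_sym j q)
    ?(negbTE ij) ?(negbTE ji) ?(negbTE pi) ?(negbTE pj) ?(negbTE qi) ?(negbTE qj) /=
    ?mulr0 ?mulr1 ?addr0 ?add0r //; try ring;
  by rewrite -[RHS]cs; ring.
Qed.

Lemma det_plane_rot i j c s : i != j -> \det (plane_rot i j c s) = c ^+ 2 + s ^+ 2.
Proof.
move=> ij; have ji := ij; rewrite eq_sym in ji.
pose U : 'M[R]_(n, 2) := \matrix_(p, l) (p == (if l == 0 then i else j))%:R.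
pose V : 'M[R]_(2, n) := \matrix_l (if l == 0
  then (c - 1) *: delta_mx 0 i + s *: delta_mx 0 j
  else - s *: delta_mx 0 i + (c - 1) *: delta_mx 0 j).
have -> : plane_rot i j c s = 1%:M + U *m V.
  apply/matrixP => p q; rewrite !mxE big_ord_recl big_ord1 !mxE /= ?eqxx /=.
  have [?|pi] := eqVneq p i; [subst p|have [?|pj] := eqVneq p j; [subst p|]];
    rewrite ?eqxx ?(negbTE ij) ?(negbTE ji) ?(negbTE pi) ?(negbTE pj) !mxE ?eqxx
      ?(eq_sym i q) ?(eq_sym j q) ?(eq_sym q p) /=; ring.
have e (l l' : 'I_2) : (V *m U) l l' = V l (if l' == 0 then i else j).
  rewrite mxE (bigD1 (if l' == 0 then i else j)) //= !mxE eqxx mulr1 big1 ?addr0 //.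
  by move=> p pn; rewrite !mxE (negbTE pn) mulr0.
have f l l' : (1%:M + V *m U) l l' = (l == l')%:R + V l (if l' == 0 then i else j).
  by rewrite mxE e [1%:M _ _]mxE.
rewrite det_1DmulC det_mx22 !f !mxE /= ?mxE ?eqxx (negbTE ij) (negbTE ji) /=.
ring.
Qed.

Lemma plane_rot_rotation i j c s : i != j -> c ^+ 2 + s ^+ 2 = 1 ->
  rotation (plane_rot i j c s).
Proof.
by move=> ij cs; split; [exact: plane_rot_ortho|rewrite det_plane_rot].
Qed.

Lemma plane_rot_tr i j c s : i != j ->
  (plane_rot i j c s)^T = plane_rot i j c (- s).
Proof.
move=> ij; have ji := ij; rewrite eq_sym in ji.
apply/matrixP => p q; rewrite !mxE.
have [?|pi] := eqVneq p i; [subst p|have [?|pj] := eqVneq p j; [subst p|]];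
  (have [?|qi] := eqVneq q i; [subst q|have [?|qj] := eqVneq q j; [subst q|]]);
  rewrite ?eqxx ?(negbTE ij) ?(negbTE ji) ?(negbTE pi) ?(negbTE pj)
    ?(negbTE qi) ?(negbTE qj) !mxE ?eqxx ?(eq_sym i q) ?(eq_sym j q) ?(eq_sym i p) ?(eq_sym j p) ?(eq_sym q p) ?(negbTE ij) ?(negbTE ji)
    ?(negbTE pi) ?(negbTE pj) ?(negbTE qi) ?(negbTE qj) /= //; ring.
Qed.

(** The maximum of c a + s b on the unit circle is (a^2 + b^2)^(1/2), reached in the direction of
    (a, b); it exceeds a unless b = 0. *)
Lemma circle_max (a b : R) :
  (forall c s, c ^+ 2 + s ^+ 2 = 1 -> c * a + s * b <= a) -> b = 0.
Proof.
move=> h; apply/eqP/negPn/negP => b0.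
have ab : 0 < a ^+ 2 + b ^+ 2.
  by rewrite ltr_wpDl ?sqr_ge0 // lt0r sqrf_eq0 b0 sqr_ge0.
pose r := Num.sqrt (a ^+ 2 + b ^+ 2).
have r0 : 0 < r by rewrite sqrtr_gt0.
have rr : r ^+ 2 = a ^+ 2 + b ^+ 2 by rewrite sqr_sqrtr // ltW.
have := h (a / r) (b / r); rewrite !expr_div_n -mulrDl -rr divff ?sqrf_eq0 ?gt_eqF //.
move=> /(_ erefl); rewrite mulrAC (mulrAC b) -mulrDl -!expr2 -rr expr2 -mulrA divff ?gt_eqF //.
rewrite mulr1 => ra.
have a0 : 0 <= a := le_trans (ltW r0) ra.
have : r ^+ 2 <= a ^+ 2 by rewrite ler_pXn2r // ?nnegrE // ltW.
rewrite rr -{2}(addr0 (a ^+ 2)) lerD2l => b2.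
by move: b0; rewrite -sqrf_eq0 eq_le b2 sqr_ge0.
Qed.

(* von Neumann's trace argument: a maximiser of the weighted trace over pairs of
   rotations is diagonal because the weights are distinct. *)
Lemma weighted_trace_max (w : 'I_n -> R) (B : 'M[R]_n) :
  (forall i, 0 < w i) -> (forall i j, (i < j)%N -> w j < w i) ->
  (forall r r', rotation r -> rotation r' ->
     \sum_i w i * (r *m B *m r'^T) i i <= \sum_i w i * B i i) ->
  [/\ forall i j, i != j -> B i j = 0, forall i j, (i < j)%N -> B j j <= B i i
    & forall i j, i != j -> 0 <= B i i + B j j].
Proof.
move=> w0 wd hB.
have split_sum (A : 'M[R]_n) i j : i != j ->
    (forall p, p != i -> p != j -> A p p = B p p) ->
    \sum_p w p * A p p <= \sum_p w p * B p p ->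
    w i * A i i + w j * A j j <= w i * B i i + w j * B j j.
  move=> ij hA; have e (F : 'I_n -> R) :
      \sum_p F p = F i + F j + \sum_(p | (p != i) && (p != j)) F p.
    by rewrite (bigD1 i) //= (bigD1 j) ?addrA //= eq_sym.
  rewrite !e; have -> : \sum_(p | (p != i) && (p != j)) w p * A p p =
      \sum_(p | (p != i) && (p != j)) w p * B p p.
    by apply: eq_bigr => p /andP[pi pj]; rewrite hA.
  by rewrite lerD2r.
(* Variation of the left factor alone, in the plane of i and j. The identity is a maximum, so
   [circle_max] kills the coefficient of s. *)
have L i j c s : i != j -> c ^+ 2 + s ^+ 2 = 1 ->
    c * (w i * B i i + w j * B j j) + s * (w i * B j i - w j * B i j)
    <= w i * B i i + w j * B j j.
  move=> ij cs; have := hB _ _ (plane_rot_rotation ij cs) (@rotation1 n).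
  move/(split_sum _ i j ij) => h; apply: le_trans (h _).
    rewrite trmx1 mulmx1 2!plane_rotE !eqxx (eq_sym j) (negbTE ij).
    by rewrite le_eqVlt; apply/orP; left; apply/eqP; ring.
  by move=> p pi pj; rewrite trmx1 mulmx1 plane_rotE (negbTE pi) (negbTE pj).
have mt r (A : 'M[R]_n) p q : (A *m r^T) p q = (r *m A^T) q p.
  by rewrite -[A in LHS]trmxK -trmx_mul mxE.
have L' i j c s : i != j -> c ^+ 2 + s ^+ 2 = 1 ->
    c * (w i * B i i + w j * B j j) + s * (w i * B i j - w j * B j i)
    <= w i * B i i + w j * B j j.
  move=> ij cs; have := hB _ _ (@rotation1 n) (plane_rot_rotation ij cs).
  move/(split_sum _ i j ij) => h; apply: le_trans (h _).
    rewrite mul1mx !(mt (plane_rot _ _ _ _)) 2!plane_rotE !eqxx (eq_sym j) (negbTE ij) !mxE.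
    by rewrite le_eqVlt; apply/orP; left; apply/eqP; ring.
  by move=> p pi pj; rewrite mul1mx (mt (plane_rot _ _ _ _)) plane_rotE (negbTE pi) (negbTE pj) mxE.
(* The two variations give w_i B_ji = w_j B_ij and w_i B_ij = w_j B_ji, hence (w_i^2 - w_j^2) B_ij =
   0. *)
have off i j : (i < j)%N -> B i j = 0 /\ B j i = 0.
  move=> ltij; have ij : i != j by rewrite neq_ltn ltij.
  have /eqP := circle_max (fun c s => @L i j c s ij).
  have /eqP := circle_max (fun c s => @L' i j c s ij).
  rewrite !subr_eq0 => /eqP e1 /eqP e2.
  have wp : 0 < w i - w j by rewrite subr_gt0 wd.
  have wn : 0 < w i + w j by rewrite addr_gt0.
  have : (w i - w j) * (w i + w j) * B i j = 0.
    have -> : (w i - w j) * (w i + w j) * B i j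
      = w i * (w i * B i j) - w j * (w j * B i j) by ring.
    by rewrite e1 -e2; ring.
  move/eqP; rewrite !mulf_eq0 (gt_eqF wp) (gt_eqF wn) /= => /eqP b0.
  split=> //; move/eqP: e2; rewrite b0 mulr0 mulf_eq0 (gt_eqF (w0 i)) /=.
  by move/eqP.
(* Quarter turns on both sides exchange the diagonal entries at i and j: they keep their signs if s
   s' = 1, and both change sign if s s' = -1. *)
have D c s s' i j : i != j -> c ^+ 2 + s ^+ 2 = 1 -> c ^+ 2 + s' ^+ 2 = 1 -> c = 0 ->
    w i * (s * s' * B j j) + w j * (s * s' * B i i) <= w i * B i i + w j * B j j.
  move=> ij cs cs' c0.
  have := hB _ _ (plane_rot_rotation ij cs) (plane_rot_rotation ij cs').
  move/(split_sum _ i j ij) => h; apply: le_trans (h _).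
    rewrite -!mulmxA 2!plane_rotE !eqxx (eq_sym j) (negbTE ij).
    rewrite !(mt (plane_rot _ _ _ _)) 4!plane_rotE !eqxx (eq_sym j) (negbTE ij) !mxE c0.
    by rewrite le_eqVlt; apply/orP; left; apply/eqP; ring.
  move=> p pi pj; rewrite -mulmxA plane_rotE (negbTE pi) (negbTE pj) (mt (plane_rot _ _ _ _)) plane_rotE.
  by rewrite (negbTE pi) (negbTE pj) mxE.
split.
- by move=> i j; rewrite neq_ltn => /orP[] /off [].
- move=> i j ltij; have ij : i != j by rewrite neq_ltn ltij.
  have := D 0 1 1 i j ij; rewrite expr0n expr1n add0r => /(_ erefl erefl erefl).
  rewrite !mul1r => h; have wp : 0 < w i - w j by rewrite subr_gt0 wd.
  rewrite -subr_ge0 -(pmulr_rge0 _ wp); lra.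
- move=> i j ij.
  have := D 0 1 (-1) i j ij; rewrite expr0n expr1n sqrrN expr1n add0r.
  move=> /(_ erefl erefl erefl).
  rewrite !mul1r !mulN1r => h; have wp : 0 < w i + w j by rewrite addr_gt0.
  rewrite -(pmulr_rge0 _ wp); lra.
Qed.

End PlaneRotation.

Lemma closed_rotation (R : realType) (T : topologicalType) n (F : T -> 'M[R]_n) :
  mxcont F -> closed [set x | rotation (F x)].
Proof.
move=> cF; apply: closed_and.
  by apply: closed_eqmx; [apply: mxcont_mul => //; apply: mxcont_tr|apply: mxcont_cst].
by apply: closed_eqf; [apply: mxcont_det|apply: cont_cst].
Qed.

(** With rotations only, the sign of det C cannot be absorbed: order and pair sums leave at most the
    last entry negative, and not larger than the others in absolute value. The weighted trace
    attains its maximum because rotations form a compact set. *)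
Lemma svd (R : realType) n (C : 'M[R]_n) : exists k k' s,
  [/\ rotation k, rotation k', k *m C *m k'^T = diag_mx s,
      forall i j : 'I_n, (i < j)%N -> s 0 j <= s 0 i
    & forall i j, i != j -> 0 <= s 0 i + s 0 j].
Proof.
pose w (i : 'I_n) : R := (n - i)%:R.
pose T := ('M[R]_n * 'M[R]_n)%type.
pose box := [set A : 'M[R]_n | forall i j, -1 <= A i j <= 1].
pose Z := [set x : T | rotation x.1 /\ rotation x.2].
have c1 : mxcont (fun x : T => x.1) by apply: mxcont_of => x; exact: cvg_fst.
have c2 : mxcont (fun x : T => x.2) by apply: mxcont_of => x; exact: cvg_snd.
pose f (x : T) := \sum_i w i * (x.1 *m C *m x.2^T) i i.
have cf : continuous f.
  apply: cont_sum => i; apply: contM; first exact: cont_cst.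
  by apply: mxcont_mul; [apply: mxcont_mul => //; apply: mxcont_cst|apply: mxcont_tr].
have cZ : closed Z by apply: closed_and; apply: closed_rotation.
have cK : compact ((box `*` box) `&` Z).
  by apply: compact_closedI => //; apply: compact_setX; apply: mx_compact.
have inK x : Z x -> ((box `*` box) `&` Z) x.
  by move=> [rk rk']; split=> //; split=> i j; apply: ortho_entry_le; [case: rk|case: rk'].
have [|[k k']] := @compact_EVT_max _ R f _ _ cK (continuous_subspaceT cf).
  by exists (1%:M, 1%:M); apply: inK; split; apply: rotation1.
rewrite inE => -[_ [/= rk rk']] hmax.
have [||r r' hr hr'|h1 h2 h3] := @weighted_trace_max R n w (k *m C *m k'^T).
- by move=> i; rewrite ltr0n subn_gt0.
- by move=> i j ij; rewrite ltr_nat ltn_sub2l.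
- have hz : Z (r *m k, r' *m k') by case: rk => ? ?; split; apply: rotation_mul.
  have := hmax _ (mem_set (inK _ hz)).
  by rewrite /f /= trmx_mul !mulmxA.
exists k, k', (\row_i (k *m C *m k'^T) i i); split=> //.
- apply/matrixP => i j; rewrite [RHS]mxE [X in X *+ _]mxE.
  by have [<-|ij] := eqVneq i j; rewrite ?mulr1n // h1.
- by move=> i j ij; rewrite [X in X <= _]mxE [X in _ <= X]mxE; apply: h2.
- by move=> i j ij; rewrite [X in X + _]mxE [X in _ + X]mxE; apply: h3.
Qed.

(** * The pair condition *)

Section Pairs.
Variable R : realType.

Definition orthopair n (u v : 'rV[R]_n) : Prop :=
  [/\ dot u u = 1, dot v v = 1 & dot u v = 0].

Definition sqn n (u : 'rV[R]_n) : R := dot u u.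

(* For frames E of P and a of Q and X := E a^T, the singular values c_i of X are
   the cosines of the principal angles and the lam_i their tangents, so that
   lam_i lam_j <= 1 reads c_i^2 + c_j^2 >= 1: P lies in Xi iff det X > 0 and
   pairs_ge1 X. *)
Definition pairs_ge1 n m (X : 'M[R]_(n, m)) : Prop := forall u v, orthopair u v ->
  1 <= sqn (u *m X) + sqn (v *m X).

Definition pairs_gt1 n m (X : 'M[R]_(n, m)) : Prop := forall u v, orthopair u v ->
  1 < sqn (u *m X) + sqn (v *m X).

Definition cgood n (X : 'M[R]_n) : Prop := 0 <= \det X /\ pairs_ge1 X.

Definition sgood n (X : 'M[R]_n) : Prop := 0 < \det X /\ pairs_gt1 X.

Lemma sgoodW n (X : 'M[R]_n) : sgood X -> cgood X.
Proof. by move=> [d p]; split=> [|u v uv]; rewrite ltW // p. Qed.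

Lemma orthopair_mul n m (k : 'M[R]_(n, m)) u v : ortho k -> orthopair u v ->
  orthopair (u *m k) (v *m k).
Proof. by move=> ok [uu vv uv]; split; rewrite dot_ortho. Qed.

Lemma orthopair_row n N (k : 'M[R]_(n, N)) i j : ortho k -> i != j ->
  orthopair (row i k) (row j k).
Proof. by move=> ok ij; split; rewrite ?ortho_row1 // ortho_rowE // (negbTE ij). Qed.

Lemma pairs_ge1_mull n m p (k : 'M[R]_(n, m)) (X : 'M[R]_(m, p)) : ortho k ->
  pairs_ge1 X -> pairs_ge1 (k *m X).
Proof.
by move=> ok pX u v uv; rewrite !mulmxA; apply/pX/orthopair_mul.
Qed.

Lemma pairs_gt1_mull n m p (k : 'M[R]_(n, m)) (X : 'M[R]_(m, p)) : ortho k ->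
  pairs_gt1 X -> pairs_gt1 (k *m X).
Proof.
by move=> ok pX u v uv; rewrite !mulmxA; apply/pX/orthopair_mul.
Qed.

Lemma sgood_rot n (k X : 'M[R]_n) : rotation k -> sgood X -> sgood (k *m X).
Proof.
by move=> [ok dk] [dX pX]; split; [rewrite det_mulmx dk mul1r|exact: pairs_gt1_mull].
Qed.

Lemma orthopair_weight n (u v : 'rV[R]_n) i : orthopair u v ->
  u 0 i ^+ 2 + v 0 i ^+ 2 <= 1.
Proof.
move=> [uu vv uv]; pose a := u 0 i; pose b := v 0 i.
have := dot_ge0 (delta_mx 0 i - a *: u - b *: v).
have du (w : 'rV[R]_n) : dot (delta_mx 0 i) w = w 0 i.
  by rewrite /dot -rowE !mxE.
have dd : dot (delta_mx 0 i) (delta_mx 0 i) = 1 :> R by rewrite du mxE !eqxx.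
have ua : dot u (delta_mx 0 i) = a by rewrite dotC du.
have vb : dot v (delta_mx 0 i) = b by rewrite dotC du.
have vu : dot v u = 0 by rewrite dotC.
rewrite !(dotBl, dotBr, dotZl, dotZr) dd ua vb !du uu vv uv vu -/a -/b; lra.
Qed.

(** For w_i = u_i^2 + v_i^2 with u, v an orthonormal pair, the sum is the trace of diag(a) on the
    plane of u and v; as in Ky Fan's principle, it is controlled by the two least entries of a. *)
Lemma weighted_pair_sum n (a w : 'I_n -> R) :
  (forall i, 0 <= w i <= 1) -> \sum_i w i = 2%:R ->
  ((forall i j, i != j -> 1 <= a i + a j) -> 1 <= \sum_i a i * w i) /\
  ((forall i j, i != j -> 1 < a i + a j) -> 1 < \sum_i a i * w i).
Proof.
move=> w01 w2.
case: (pselect (exists i : 'I_n, True)) => [[i1 _]|]; last first.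
  move=> no; move: w2; rewrite big1; last by move=> i; case: no; exists i.
  lra.
have [i0 a0] : exists i0, forall i, a i0 <= a i.
  by exists [arg min_(i < i1) a i]%O; case: arg_minP => // i _ h j; exact: h.
(* Only the least entry can be small, and the others are compared with 1 - a_i0. The first two terms
   then exceed 1 by (1 - 2 a_i0) (1 - w_i0). *)
have S : \sum_i a i * w i =
    a i0 * w i0 + (1 - a i0) * (2%:R - w i0) +
    \sum_(i | i != i0) (a i - (1 - a i0)) * w i.
  rewrite (bigD1 i0) //= -addrA; congr (_ + _).
  under [in RHS]eq_bigr do rewrite mulrBl.
  have w2' : \sum_(i | i != i0) w i = 2%:R - w i0.
    by rewrite -w2 [in RHS](bigD1 i0) //= addrAC subrr add0r.
  by rewrite sumrB -mulr_sumr w2' addrC subrK.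
have /andP[w00 w01'] := w01 i0.
have [ah|ah] := leP (a i0) 2^-1.
  have base : 1 <= a i0 * w i0 + (1 - a i0) * (2%:R - w i0) by nra.
  split=> h; rewrite S.
    rewrite -[X in X <= _]addr0 lerD // sumr_ge0 // => i ii.
    by rewrite mulr_ge0 //; [have := h _ _ ii; lra|have /andP[] := w01 i].
  rewrite -[X in X < _]addr0 ler_ltD //.
  have nn i : i != i0 -> 0 <= (a i - (1 - a i0)) * w i.
    move=> ii; rewrite mulr_ge0 //; last by have /andP[] := w01 i.
    by have := h _ _ ii; lra.
  rewrite lt0r sumr_ge0 // andbT; apply/eqP => /eqP; rewrite psumr_eq0 // => /allP z.
  move: w2; rewrite (bigD1 i0) //= big1; first by lra.
  move=> i ii; have := z i; rewrite mem_index_enum ii /= => /(_ isT).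
  rewrite mulf_eq0 => /orP[|/eqP //]; have := h _ _ ii; move=> + /eqP; lra.
have big : 1 < \sum_i a i * w i.
  apply: lt_le_trans (_ : a i0 * 2%:R <= _); first by lra.
  rewrite -w2 mulr_sumr ler_sum // => i _; rewrite ler_wpM2r //.
  by have /andP[] := w01 i.
by split=> // _; apply: ltW.
Qed.

Lemma sqn_diag n (c u : 'rV[R]_n) : sqn (u *m diag_mx c) = \sum_i c 0 i ^+ 2 * u 0 i ^+ 2.
Proof.
rewrite /sqn dotE; apply: eq_bigr => i _.
by rewrite mul_mx_diag mxE; ring.
Qed.

Lemma sqn_ortho n N (V : 'M[R]_(n, N)) u : ortho V -> sqn (u *m V) = sqn u.
Proof. exact: dot_ortho. Qed.

Lemma pairs_diag n (c : 'rV[R]_n) :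
  ((forall i j, i != j -> 1 <= c 0 i ^+ 2 + c 0 j ^+ 2) -> pairs_ge1 (diag_mx c)) /\
  ((forall i j, i != j -> 1 < c 0 i ^+ 2 + c 0 j ^+ 2) -> pairs_gt1 (diag_mx c)).
Proof.
have key (u v : 'rV[R]_n) : orthopair u v ->
  (forall i, 0 <= u 0 i ^+ 2 + v 0 i ^+ 2 <= 1) /\
  \sum_i (u 0 i ^+ 2 + v 0 i ^+ 2) = 2%:R.
  move=> uv; split; first by move=> i; rewrite orthopair_weight // addr_ge0 ?sqr_ge0.
  case: uv; rewrite !dotE => u1 v1 _; rewrite big_split /=.
  by under eq_bigr do rewrite expr2; under [X in _ + X]eq_bigr do rewrite expr2;
     rewrite u1 v1.
split=> h u v uv; have [w01 w2] := key _ _ uv.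
  have [/(_ h) + _] := @weighted_pair_sum _ (fun i => c 0 i ^+ 2) _ w01 w2.
  by rewrite !sqn_diag -big_split /=; under eq_bigr do rewrite mulrDr.
have [_ /(_ h)] := @weighted_pair_sum _ (fun i => c 0 i ^+ 2) _ w01 w2.
by rewrite !sqn_diag -big_split /=; under eq_bigr do rewrite mulrDr.
Qed.

Lemma pairs_ge1_mulr n m p (X : 'M[R]_(n, m)) (k : 'M[R]_(m, p)) : ortho k ->
  pairs_ge1 X -> pairs_ge1 (X *m k).
Proof. by move=> ok pX u v uv; rewrite !mulmxA (sqn_ortho (u *m X) ok) (sqn_ortho (v *m X) ok) pX. Qed.

Lemma pairs_gt1_mulr n m p (X : 'M[R]_(n, m)) (k : 'M[R]_(m, p)) : ortho k ->
  pairs_gt1 X -> pairs_gt1 (X *m k).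
Proof. by move=> ok pX u v uv; rewrite !mulmxA (sqn_ortho (u *m X) ok) (sqn_ortho (v *m X) ok) pX. Qed.

Lemma sqn_row_diag n (c : 'rV[R]_n) i : sqn (row i (1%:M : 'M[R]_n) *m diag_mx c) = c 0 i ^+ 2.
Proof.
rewrite sqn_diag (bigD1 i) //= !mxE eqxx expr1n mulr1 big1 ?addr0 // => j ji.
by rewrite !mxE eq_sym (negbTE ji) expr0n mulr0.
Qed.

Lemma diag_pairs_ge1 n (c : 'rV[R]_n) : pairs_ge1 (diag_mx c) ->
  forall i j, i != j -> 1 <= c 0 i ^+ 2 + c 0 j ^+ 2.
Proof.
move=> h i j ij; have := h _ _ (orthopair_row (@ortho1 R n) ij).
by rewrite !sqn_row_diag.
Qed.

Lemma svd_eq n (X k k' : 'M[R]_n) c : ortho k -> ortho k' ->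
  k *m X *m k'^T = diag_mx c -> X = k^T *m diag_mx c *m k'.
Proof.
move=> ok ok' <-; rewrite !mulmxA (orthoC ok) mul1mx -mulmxA (orthoC ok') mulmx1 //.
Qed.

(** A square matrix and its transpose have the same singular values. *)
Lemma pairs_gt1_tr n (X : 'M[R]_n) : pairs_gt1 X -> pairs_gt1 X^T.
Proof.
have [k [k' [c [[ok _] [ok' _] E _ _]]]] := svd X.
move=> pX; have pc : pairs_gt1 (diag_mx c).
  by rewrite -E; apply: pairs_gt1_mulr; [exact: ortho_tr|exact: pairs_gt1_mull].
rewrite (svd_eq ok ok' E) !trmx_mul trmxK tr_diag_mx.
apply: pairs_gt1_mull; first exact: ortho_tr.
exact: pairs_gt1_mulr.
Qed.

End Pairs.

(** * Geodesics *)

Lemma bessel_eq (R : rcfType) n N (V : 'M[R]_(n, N)) (w : 'rV[R]_N) : ortho V ->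
  dot w w <= dot (w *m V^T) (w *m V^T) -> w = w *m V^T *m V.
Proof.
move=> oV h; apply/eqP; rewrite -subr_eq0 -dot_eq0 eq_le dot_ge0 andbT.
rewrite !(dotBl, dotBr) dot_ortho // dot_mulmx (dotC w (_ *m V)) dot_mulmx.
lra.
Qed.

Section Geodesic.
Variables (R : realType) (n N : nat).
Implicit Types (e f a : 'M[R]_(n, N)) (th : 'rV[R]_n).

(* Horizontal frame along a geodesic of the Grassmannian: row i moves in the
   plane of e_i and f_i with angular speed th_i. A row f_i may vanish when
   th_i = 0, so that no condition on the codimension is needed. *)
Definition geo_data e f th : Prop :=
  [/\ ortho e, e *m f^T = 0,
      forall i j, i != j -> dot (row i f) (row j f) = 0
    & forall i, th 0 i * (dot (row i f) (row i f) - 1) = 0].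

Definition cosd th (t : R) : 'M[R]_n := diag_mx (\row_i cos (t * th 0 i)).
Definition sind th (t : R) : 'M[R]_n := diag_mx (\row_i sin (t * th 0 i)).

Definition curve e f th t := cosd th t *m e + sind th t *m f.
(** The derivative of [curve] without its factor [diag_mx th]. *)
Definition normal e f th t := cosd th t *m f - sind th t *m e.

Lemma cosdE th t m (A : 'M[R]_(n, m)) i j : (cosd th t *m A) i j = cos (t * th 0 i) * A i j.
Proof. by rewrite mul_diag_mx !mxE. Qed.

Lemma sindE th t m (A : 'M[R]_(n, m)) i j : (sind th t *m A) i j = sin (t * th 0 i) * A i j.
Proof. by rewrite mul_diag_mx !mxE. Qed.

Lemma curveE e f th t i j :
  curve e f th t i j = cos (t * th 0 i) * e i j + sin (t * th 0 i) * f i j.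
Proof. by rewrite /curve /cosd /sind !mul_diag_mx !mxE. Qed.

Lemma normalE e f th t i j :
  normal e f th t i j = cos (t * th 0 i) * f i j - sin (t * th 0 i) * e i j.
Proof. by rewrite /normal /cosd /sind !mul_diag_mx !mxE. Qed.

Lemma row_curve e f th t i :
  row i (curve e f th t) = cos (t * th 0 i) *: row i e + sin (t * th 0 i) *: row i f.
Proof. by apply/rowP => j; rewrite mxE curveE !mxE. Qed.

Lemma row_normal e f th t i :
  row i (normal e f th t) = cos (t * th 0 i) *: row i f - sin (t * th 0 i) *: row i e.
Proof. by apply/rowP => j; rewrite mxE normalE !mxE. Qed.

Lemma curve0 e f th : curve e f th 0 = e.
Proof. by apply/matrixP => i j; rewrite curveE mul0r cos0 sin0 mul1r mul0r addr0. Qed.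

Lemma curve_shift e f th t s :
  curve e f th (t + s) = cosd th s *m curve e f th t + sind th s *m normal e f th t.
Proof.
apply/matrixP => i j; rewrite curveE mxE cosdE sindE curveE normalE mulrDl cosD sinD.
ring.
Qed.

Lemma cosdN th t : cosd th (- t) = cosd th t.
Proof. by congr diag_mx; apply/rowP => i; rewrite !mxE mulNr cosN. Qed.

Lemma sindN th t : sind th (- t) = - sind th t.
Proof. by rewrite -raddfN; congr diag_mx; apply/rowP => i; rewrite !mxE mulNr sinN. Qed.

Section Data.
Variables (e f : 'M[R]_(n, N)) (th : 'rV[R]_n).
Hypothesis g : geo_data e f th.

Lemma geo_sin t i :
  sin (t * th 0 i) * dot (row i f) (row i f) = sin (t * th 0 i).
Proof.
have [_ _ _ /(_ i)/eqP] := g; rewrite mulf_eq0 => /orP[/eqP ->|].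
  by rewrite mulr0 sin0 mul0r.
by rewrite subr_eq0 => /eqP ->; rewrite mulr1.
Qed.

Lemma geo_ef i j : dot (row i e) (row j f) = 0.
Proof. by have [_ ef _ _] := g; rewrite -mulmx_trE ef mxE. Qed.

Lemma curve_dot t i j : dot (row i (curve e f th t)) (row j (curve e f th t)) = (i == j)%:R.
Proof.
have [oe _ ff _] := g; rewrite !row_curve !(dotDl, dotDr, dotZl, dotZr).
rewrite (dotC (row i f)) !geo_ef (ortho_rowE _ _ oe).
have [<-|ij] := eqVneq i j; last by rewrite ff //=; ring.
by rewrite geo_sin /= -[RHS](cos2Dsin2 (t * th 0 i)); ring.
Qed.

Lemma curve_ortho t : ortho (curve e f th t).
Proof. by apply: orthoP => i j; apply: curve_dot. Qed.

Lemma normal_perp t i j : dot (row i (normal e f th t)) (row j (curve e f th t)) = 0.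
Proof.
have [oe _ ff _] := g; rewrite row_curve row_normal.
rewrite !(dotDl, dotDr, dotZl, dotZr, dotNl) (dotC (row i f) (row j e)) !geo_ef (ortho_rowE _ _ oe).
have [<-|ij] := eqVneq i j; last by rewrite ff //=; ring.
by rewrite geo_sin /=; ring.
Qed.

Lemma normalmx_perp t : normal e f th t *m (curve e f th t)^T = 0.
Proof. by apply/matrixP => i j; rewrite mulmx_trE normal_perp mxE. Qed.

Lemma thnormal_dot t i j :
  dot (row i (normal e f th t)) (row j (normal e f th t)) * (th 0 i * th 0 j) =
  (i == j)%:R * th 0 i ^+ 2.
Proof.
have [oe _ ff thf] := g; rewrite !row_normal !(dotDl, dotDr, dotZl, dotZr, dotNl, dotNr).
rewrite (dotC (row i f) (row j e)) !geo_ef (ortho_rowE _ _ oe).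
have [<-|ij] := eqVneq i j; last by rewrite ff //=; ring.
have /eqP := thf i; rewrite mulf_eq0 => /orP[/eqP ->|].
  by rewrite /=; ring.
rewrite subr_eq0 => /eqP ->; rewrite /= mul1r.
rewrite -[RHS]mul1r -[X in _ = X * _](cos2Dsin2 (t * th 0 i)); ring.
Qed.

(* If the pairing with Q degenerates at t0, the pair condition makes it an isometry
   off a line of Q, and reflecting Q in that line reverses the time around t0. *)
Lemma det_reflect a t0 : ortho a -> \det (curve e f th t0 *m a^T) = 0 ->
  pairs_ge1 (curve e f th t0 *m a^T) ->
  forall s, \det (curve e f th (t0 - s) *m a^T) = - \det (curve e f th (t0 + s) *m a^T).
Proof.
move=> oa; set F := curve e f th t0; set X := F *m a^T => dX pX.
have oF : ortho F by apply: curve_ortho.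
have [k [k' [c [[ok dk] [ok' dk'] E _ _]]]] := svd X.
have pc : pairs_ge1 (diag_mx c).
  by rewrite -E; apply: pairs_ge1_mulr; [exact: ortho_tr|exact: pairs_ge1_mull].
have [i0 ci0] : exists i0, c 0 i0 = 0.
  have : \det (diag_mx c) = 0 by rewrite -E !det_mulmx dX mulr0 mul0r.
  by rewrite det_diag => /eqP /prodf_eq0[i _ /eqP ci]; exists i.
pose d : 'rV[R]_n := \row_i (if i == i0 then -1 else 1).
(* H changes the sign of the singular vector of Q with c_i0 = 0 and fixes the others. *)
pose H := k'^T *m diag_mx d *m k'.
have dH : \det H = -1.
  rewrite !det_mulmx det_tr dk' mul1r mulr1 det_diag (bigD1 i0) //= mxE eqxx big1 ?mulr1 //.
  by move=> i ii; rewrite mxE (negbTE ii).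
have XH : X *m H = X.
  rewrite /H (svd_eq ok ok' E) !mulmxA -!(mulmxA _ k') (ok' : k' *m k'^T = _) mulmx1.
  congr (_ *m _); rewrite -!mulmxA; congr (_ *m _); rewrite mulmx_diag; congr diag_mx.
  by apply/rowP => i; rewrite !mxE; case: eqP => [->|]; rewrite ?ci0 ?mul0r ?mulr1.
set Y := normal e f th t0 *m a^T.
have YH : Y *m H = - Y.
  suff Yk : Y *m k'^T *m diag_mx d = - (Y *m k'^T).
    by rewrite /H !mulmxA Yk mulNmx -mulmxA (orthoC ok') mulmx1.
  apply/matrixP => l j; rewrite mul_mx_diag [LHS]mxE [RHS]mxE [d _ _]mxE.
  have [_|ji] := eqVneq j i0; first by rewrite mulrN1.
  suff -> : (Y *m k'^T) l j = 0 by rewrite mul0r oppr0.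
  (* For j != i0, c_i0 = 0 and the pair condition give c_j^2 >= 1: the projection of q to the plane
     of F is no shorter than q, so q lies in that plane and is orthogonal to the normal rows. *)
  pose q := row j k' *m a.
  have -> : (Y *m k'^T) l j = dot (row l (normal e f th t0)) q.
    by rewrite /q dotC dot_mulmx dotC mulmx_trE; congr (dot _ _); rewrite row_mul.
  have q1 : dot q q = 1 by rewrite /q dot_ortho // ortho_row1.
  have qF : 1 <= dot (q *m F^T) (q *m F^T).
    have -> : q *m F^T = row j (diag_mx c *m k).
      rewrite /q -mulmxA -row_mul; congr (row j _).
      have Xk : X *m k'^T = k^T *m diag_mx c.
        by rewrite (svd_eq ok ok' E) -mulmxA (ok' : k' *m k'^T = _) mulmx1.
      have -> : a *m F^T = X^T by rewrite /X trmx_mul trmxK.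
      by rewrite -[k']trmxK -trmx_mul Xk trmx_mul trmxK tr_diag_mx.
    rewrite row_mul dot_ortho // row_diag_mx dotZl dotZr dot_delta eqxx mulr1 -expr2.
    by have := diag_pairs_ge1 pc ji; rewrite ci0 expr0n addr0.
  rewrite -q1 in qF; rewrite (bessel_eq oF qF) dotC dot_mulmx.
  by rewrite -(row_mul l) normalmx_perp linear0 dot0r.
(* The pairing at t0 + s is a cosine part in X plus a sine part in Y; H fixes X and negates Y, which
   amounts to replacing s by - s. *)
move=> s; have E1 : curve e f th (t0 + s) *m a^T = cosd th s *m X + sind th s *m Y.
  by rewrite curve_shift mulmxDl -!mulmxA.
have -> : curve e f th (t0 - s) *m a^T = (cosd th s *m X + sind th s *m Y) *m H.
  rewrite [RHS]mulmxDl -(mulmxA _ X) -(mulmxA _ Y) XH YH mulmxN.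
  by rewrite curve_shift cosdN sindN !mulmxDl !mulNmx -!mulmxA.
by rewrite E1 det_mulmx dH mulrN1.
Qed.

(** If the determinant vanished at t, reflecting time around t would take the nearer end to 2t or 2t
    - 1, still in [0, 1], where the determinant would be negative. *)
Lemma curve_det_gt0 a : ortho a ->
  (forall t, 0 <= t <= 1 -> cgood (curve e f th t *m a^T)) ->
  0 < \det (curve e f th 0 *m a^T) -> 0 < \det (curve e f th 1 *m a^T) ->
  forall t, 0 <= t <= 1 -> 0 < \det (curve e f th t *m a^T).
Proof.
move=> oa cg d0 d1 t t01; have [dt pt] := cg t t01.
rewrite lt0r dt andbT; apply/eqP => d_eq0.
have refl := det_reflect oa d_eq0 pt.
case/andP: t01 => t0 t1; have [th2|th2] := leP t 2^-1.
  have := refl t; rewrite subrr => e1.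
  have [|+ _] := cg (t + t); first by apply/andP; split; lra.
  by rewrite leNgt => /negP; apply; move: d0; rewrite e1 oppr_gt0.
have := refl (1 - t); rewrite opprB (_ : t + (1 - t) = 1) => [e1|]; last by ring.
have [|+ _] := cg (t + (t - 1)); first by apply/andP; split; lra.
by rewrite leNgt => /negP; apply; rewrite e1 oppr_lt0.
Qed.

(** Coefficient in the bound for the second derivative of a squared cosine x. It decreases on (0, 1)
    and is odd around 1/2, so for two values of sum at least 1 a positive coefficient of the smaller
    is offset by a negative one of the larger. *)
Definition hgap (x : R) : R := x^-1 - (1 - x)^-1.

(* Normal component of the acceleration of |u X|^2; y' + A/(1-g) uX is the test
   vector for Cauchy-Schwarz that makes the bound sharp. *)
Lemma normal_form_le a (F : 'M[R]_(n, N)) (u : 'rV[R]_n) (gu go c : R) (w : 'rV[R]_N) :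
  ortho a -> ortho F -> dot u u = 1 -> 0 < gu -> gu <= 1 -> 1 - go <= gu ->
  (gu < 1 -> hgap gu <= c) ->
  u *m (F *m a^T) *m (F *m a^T)^T = gu *: u ->
  (forall b, dot b (u *m (F *m a^T)) = 0 ->
     go * dot b b <= dot (b *m (F *m a^T)^T) (b *m (F *m a^T)^T)) ->
  w *m F^T = 0 ->
  dot (w *m a^T) (w *m a^T) - gu * dot w w
    <= c * dot (u *m (F *m a^T)) (w *m a^T) ^+ 2.
Proof.
move=> oa oF u1 g0 g1 go1 hc; set X := F *m a^T => uG bG wF.
set y := w *m a^T; set q := u *m X; set A := dot q y.
have qq : dot q q = gu by rewrite /q dot_mulmx uG dotZr u1 mulr1.
(* Cauchy-Schwarz for w and b a; as w is normal to F, b a may be replaced by its part normal to F,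
   of squared length |b|^2 - |b X^T|^2. *)
have cs (b : 'rV[R]_n) : dot y b ^+ 2 <= dot w w * (dot b b - dot (b *m X^T) (b *m X^T)).
  have -> : dot y b = dot w (b *m a - b *m X^T *m F).
    have -> : dot w (b *m a - b *m X^T *m F) = dot w (b *m a).
      by rewrite dotBr (dotC w (b *m X^T *m F)) dot_mulmx wF dot0r subr0.
    by rewrite dot_mulmx trmxK.
  have -> : dot b b - dot (b *m X^T) (b *m X^T) =
     dot (b *m a - b *m X^T *m F) (b *m a - b *m X^T *m F).
    have e1 : dot (b *m a) (b *m X^T *m F) = dot (b *m X^T) (b *m X^T).
      rewrite dotC dot_mulmx; congr (dot _ _).
      by rewrite -mulmxA; congr (_ *m _); rewrite /X trmx_mul trmxK.
    by rewrite !(dotBl, dotBr) (dot_ortho _ _ oa) (dot_ortho _ _ oF) (dotC (b *m X^T *m F)) e1; lra.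
  exact: dot_CS.
(* The coefficient has a pole at gu = 1, but there [cs] with b = q forces A = 0, and Bessel's
   inequality suffices. *)
have [gu1|gu1] := eqVneq gu 1.
  have A0 : A = 0.
    have := cs q; rewrite uG qq gu1 scale1r u1 subrr mulr0 dotC -/A => h.
    by apply/eqP; rewrite -sqrf_eq0 eq_le h sqr_ge0.
  have := bessel w oa; rewrite -/y A0 gu1 expr0n mulr0 mul1r; lra.
have gl1 : gu < 1 by rewrite lt_neqAle gu1.
have g1' : 0 < 1 - gu by rewrite subr_gt0.
pose y' := y - (A / gu) *: q.
have y'q : dot y' q = 0.
  by rewrite /y' dotBl dotZl qq (dotC y) -/A divfK ?subrr // gt_eqF.
have yE : y = y' + (A / gu) *: q by rewrite subrK.
clearbody y'; pose ta := A / (1 - gu); pose b := y' + ta *: q.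
have qy' : dot q y' = 0 by rewrite dotC.
have yb : dot y b = dot y' y' + ta * A.
  rewrite yE /b !(dotDl, dotDr, dotZl, dotZr) qy' y'q qq; field.
  by rewrite gt_eqF.
have yy : dot y y = dot y' y' + A ^+ 2 / gu.
  rewrite {1 2}yE !(dotDl, dotDr, dotZl, dotZr) qy' y'q qq; field.
  by rewrite gt_eqF.
have bb : dot b b = dot y' y' + ta ^+ 2 * gu.
  by rewrite /b !(dotDl, dotDr, dotZl, dotZr) qy' y'q qq; ring.
have bX : dot (b *m X^T) (b *m X^T) = dot (y' *m X^T) (y' *m X^T) + ta ^+ 2 * gu ^+ 2.
  rewrite /b mulmxDl -scalemxAl uG !(dotDl, dotDr, dotZl, dotZr) u1.
  have yu : dot (y' *m X^T) u = 0 by rewrite dot_mulmx trmxK.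
  by rewrite (dotC u (y' *m X^T)) yu; ring.
have := cs b; rewrite yb bb bX; have := bG _ y'q => hb.
set P := dot y' y' in hb yb yy *; set W := dot w w.
have P0 : 0 <= P by apply: dot_ge0.
have W0 : 0 <= W by apply: dot_ge0.
have taA : ta * A = A ^+ 2 / (1 - gu) by rewrite /ta; ring.
have tag : ta ^+ 2 * gu - ta ^+ 2 * gu ^+ 2 = gu * (ta * A).
  by rewrite /ta; field; rewrite gt_eqF.
have taA0 : 0 <= ta * A by rewrite taA divr_ge0 ?sqr_ge0 // ltW.
move=> h; have h2 : (P + ta * A) ^+ 2 <= W * (gu * (P + ta * A)).
  apply: le_trans h _; rewrite ler_wpM2l //.
  have : (1 - go) * P <= gu * P by rewrite ler_wpM2r.
  move: hb tag; set B := dot (y' *m _) _; lra.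
(* One factor of (P + ta A)^2 <= gu W (P + ta A) is cancelled. With |y|^2 = P + A^2/gu and ta A =
   A^2/(1 - gu) this is the claim. *)
have h3 : P + ta * A <= gu * W.
  have [z|nz] := eqVneq (P + ta * A) 0; first by rewrite z mulr_ge0 // ltW.
  have pos : 0 < P + ta * A by rewrite lt0r nz addr_ge0.
  by rewrite -(ler_pM2r pos) -expr2 (le_trans h2) // mulrA (mulrC W).
apply: le_trans (ler_wpM2r (sqr_ge0 A) (hc gl1)).
rewrite yy /hgap; move: h3; rewrite taA.
have -> : (gu^-1 - (1 - gu)^-1) * A ^+ 2 = A ^+ 2 / gu - A ^+ 2 / (1 - gu) by ring.
lra.
Qed.

End Data.
End Geodesic.

(** * Derivatives in one variable and along a geodesic *)

Section Calculus.
Variable R : realType.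
Implicit Types (f g : R -> R) (x : R).

Lemma der_eq f x df df' : is_derive x 1 f df -> df = df' -> is_derive x 1 f df'.
Proof. by move=> h <-. Qed.

Lemma derM f g x df dg : is_derive x 1 f df -> is_derive x 1 g dg ->
  is_derive x 1 (fun t => f t * g t) (df * g x + f x * dg).
Proof.
move=> hf hg; apply: (@is_derive_eq _ _ _ (f * g)).
by rewrite -![_ *: _]/(_ * _); ring.
Qed.

Lemma derD f g x df dg : is_derive x 1 f df -> is_derive x 1 g dg ->
  is_derive x 1 (fun t => f t + g t) (df + dg).
Proof. by move=> hf hg; apply: (@is_deriveD _ _ _ f g). Qed.

Lemma derB f g x df dg : is_derive x 1 f df -> is_derive x 1 g dg ->
  is_derive x 1 (fun t => f t - g t) (df - dg).
Proof. by move=> hf hg; apply: (@is_deriveB _ _ _ f g). Qed.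

Lemma der_cst (a x : R) : is_derive x 1 (fun=> a) 0.
Proof. exact: is_derive_cst. Qed.

Lemma derZ f x df a : is_derive x 1 f df -> is_derive x 1 (fun t => a * f t) (a * df).
Proof.
move=> hf; apply: (der_eq (derM (der_cst a x) hf)); ring.
Qed.

Lemma der_sum (I : Type) (r : seq I) (f df : I -> R -> R) x :
  (forall i, is_derive x 1 (f i) (df i x)) ->
  is_derive x 1 (fun t => \sum_(i <- r) f i t) (\sum_(i <- r) df i x).
Proof.
move=> h; elim: r => [|i r ih].
  by rewrite big_nil; under eq_fun do rewrite big_nil; apply: der_cst.
by rewrite big_cons; under eq_fun do rewrite big_cons; apply: derD.
Qed.

Lemma der_linear x a : is_derive x 1 (fun t => t * a) a.
Proof.
by apply: (der_eq (derM (is_derive_id x 1) (der_cst a x))); rewrite mul1r mulr0 addr0.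
Qed.

Lemma der_cos x a : is_derive x 1 (fun t => cos (t * a)) (- (a * sin (x * a))).
Proof.
have := der_linear x a => h.
apply: (der_eq (@is_derive1_comp R cos ( *%R^~ a) x _ _ _ h)).
by rewrite mulrC mulrN.
Qed.

Lemma der_sin x a : is_derive x 1 (fun t => sin (t * a)) (a * cos (x * a)).
Proof.
have := der_linear x a => h.
apply: (der_eq (@is_derive1_comp R sin ( *%R^~ a) x _ _ _ h)).
by rewrite mulrC.
Qed.

Lemma der_exp x a : is_derive x 1 (fun t => expR (t * a)) (a * expR (x * a)).
Proof.
have := der_linear x a => h.
apply: (der_eq (@is_derive1_comp R expR ( *%R^~ a) x _ _ _ h)).
by rewrite mulrC.
Qed.

Lemma is_derive_continuous f x df : is_derive x 1 f df -> {for x, continuous f}.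
Proof.
move=> [h _]; apply: differentiable_continuous.
exact/derivable1_diffP.
Qed.

(** Were ddf negative, df would be negative just after t0, and by the mean value theorem f would
    drop below its minimum. *)
Lemma second_derivative_min f (df : R -> R) (ddf t0 a b : R) : a < t0 < b ->
  (forall t : R, is_derive t 1 f (df t)) -> is_derive t0 1 df ddf ->
  (forall t, a < t < b -> f t0 <= f t) -> df t0 = 0 /\ 0 <= ddf.
Proof.
move=> /andP[at0 t0b] hf hdf hmin.
have t0ab : t0 \in `]a, b[ by rewrite in_itv /= at0 t0b.
have d0 : df t0 = 0.
  have h : is_derive t0 1 f 0.
    have ab : a <= b by apply: ltW; exact: lt_trans t0b.
    apply: (derive1_at_min ab _ t0ab).
      by move=> t _; have [] := hf t.
    by move=> t; rewrite in_itv /= => /hmin.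
  by have [_ e1] := hf t0; have [_ e2] := h; rewrite -e1 -e2.
split=> //; rewrite leNgt; apply/negP => neg.
have [ddfb e] := hdf.
have cv : h^-1 *: (df (h + t0) - df t0) @[h --> 0^'] --> ddf.
  rewrite -e /derive; move: ddfb; rewrite /derivable.
  by under eq_fun do rewrite [_%:A]mulr1.
have [r r0 hr] : exists2 r, 0 < r & forall h, 0 < h < r -> df (h + t0) < 0.
  have : \forall h \near 0^', h^-1 *: (df (h + t0) - df t0) < 0.
    by apply: (cvgr_lt _ cv); exact: neg.
  rewrite near_withinE => -[r /= r0 hr]; exists r => // h /andP[h0 hr'].
  have := hr h; rewrite /= sub0r normrN gtr0_norm // => /(_ hr').
  rewrite gt_eqF // => /(_ isT); rewrite d0 subr0 -[_ *: _]/(_ * _).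
  by rewrite pmulr_rlt0 // invr_gt0.
pose h := Num.min (r / 2) ((b - t0) / 2).
have h0 : 0 < h by rewrite lt_min !divr_gt0 // subr_gt0.
have hr2 : h < r by rewrite gt_min; apply/orP; left; lra.
have hb : t0 + h < b.
  have : h < b - t0 by rewrite gt_min; apply/orP; right; lra.
  lra.
have lth : t0 < t0 + h by rewrite ltrDl.
have cf : {within `[t0, t0 + h], continuous f}.
  by apply: continuous_subspaceT => x; apply: (is_derive_continuous (hf x)).
have [c] := MVT lth (fun x _ => hf x) cf.
rewrite in_itv /= => /andP[c1 c2] ec.
have : df c < 0.
  by have := hr (c - t0); rewrite subrK; apply; apply/andP; split; lra.
have := hmin (t0 + h); rewrite hb andbT => /(_ _).
move=> hm; have {}hm : f t0 <= f (t0 + h) by apply: hm; lra.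
rewrite ltNge => /negP; apply.
have : 0 <= df c * h by move: ec; rewrite [t0 + h - t0]addrAC subrr add0r => <-; rewrite subr_ge0.
by rewrite pmulr_lge0.
Qed.

End Calculus.

Lemma cont_of_derive (R : realType) (f df : R -> R) :
  (forall t : R, is_derive t 1 f (df t)) -> continuous f.
Proof. by move=> h t; apply: (is_derive_continuous (h t)). Qed.

Section CurveDerivatives.
Variables (R : realType) (n N : nat).
Implicit Types (th : 'rV[R]_n).

Lemma curve_mul m (e f : 'M[R]_(n, N)) th t (A : 'M[R]_(N, m)) :
  curve e f th t *m A = curve (e *m A) (f *m A) th t.
Proof. by rewrite /curve mulmxDl !mulmxA. Qed.

Lemma normal_mul m (e f : 'M[R]_(n, N)) th t (A : 'M[R]_(N, m)) :
  normal e f th t *m A = normal (e *m A) (f *m A) th t.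
Proof. by rewrite /normal mulmxBl !mulmxA. Qed.

Lemma der_curve (e f : 'M[R]_(n, N)) th (u : 'rV[R]_n) j (t : R) :
  is_derive t 1 (fun t => (u *m curve e f th t) 0 j)
    ((u *m diag_mx th *m normal e f th t) 0 j).
Proof.
have -> : (fun t => (u *m curve e f th t) 0 j) = (fun t => \sum_(i <- index_enum 'I_n)
    u 0 i * (cos (t * th 0 i) * e i j + sin (t * th 0 i) * f i j)).
  by apply/funext => s; rewrite mxE; apply: eq_bigr => i _; rewrite curveE.
rewrite mxE; have -> : \sum_i (u *m diag_mx th) 0 i * normal e f th t i j =
    \sum_(i <- index_enum 'I_n) u 0 i * ((- (th 0 i * sin (t * th 0 i))) * e i j
       + (th 0 i * cos (t * th 0 i)) * f i j).
  by apply: eq_bigr => i _; rewrite mul_mx_diag mxE normalE; ring.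
apply: (@der_sum R _ _ (fun i t => u 0 i * (cos (t * th 0 i) * e i j + sin (t * th 0 i) * f i j))
  (fun i t => u 0 i * (- (th 0 i * sin (t * th 0 i)) * e i j + th 0 i * cos (t * th 0 i) * f i j))).
move=> i; apply: derZ; apply: derD.
  by apply: (der_eq (derM (der_cos _ _) (der_cst _ _))); rewrite mulr0 addr0.
by apply: (der_eq (derM (der_sin _ _) (der_cst _ _))); rewrite mulr0 addr0.
Qed.

Lemma der_normal (e f : 'M[R]_(n, N)) th (u : 'rV[R]_n) j (t : R) :
  is_derive t 1 (fun t => (u *m normal e f th t) 0 j)
    (- (u *m diag_mx th *m curve e f th t) 0 j).
Proof.
have -> : (fun t => (u *m normal e f th t) 0 j) = (fun t => (u *m curve f (- e) th t) 0 j).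
  by apply/funext => s; rewrite /normal /curve mulmxN.
apply: (der_eq (der_curve _ _ _ _ _ _)).
have -> : normal f (- e) th t = - curve e f th t.
  by rewrite /normal /curve mulmxN opprD.
by rewrite mulmxN mxE.
Qed.

End CurveDerivatives.

Section PairDerivatives.
Variables (R : realType) (n N : nat).
Variables (a e f : 'M[R]_(n, N)) (th : 'rV[R]_n).
Let X t := curve e f th t *m a^T.
Let Y t := normal e f th t *m a^T.

Lemma der_sqn_curve (u : 'rV[R]_n) (t : R) :
  is_derive t 1 (fun t => sqn (u *m X t)) (2%:R * dot (u *m X t) (u *m diag_mx th *m Y t)).
Proof.
have -> : (fun t => sqn (u *m X t)) = (fun t => \sum_(j <- index_enum 'I_n)
    (u *m X t) 0 j * (u *m X t) 0 j).
  by apply/funext => s; rewrite /sqn dotE.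
have -> : 2%:R * dot (u *m X t) (u *m diag_mx th *m Y t) =
    \sum_(j <- index_enum 'I_n) ((u *m diag_mx th *m Y t) 0 j * (u *m X t) 0 j +
       (u *m X t) 0 j * (u *m diag_mx th *m Y t) 0 j).
  by rewrite dotE mulr_sumr; apply: eq_bigr => j _; ring.
apply: (@der_sum R _ _ (fun j t => (u *m X t) 0 j * (u *m X t) 0 j)
  (fun j t => (u *m diag_mx th *m Y t) 0 j * (u *m X t) 0 j +
       (u *m X t) 0 j * (u *m diag_mx th *m Y t) 0 j)) => j.
have h : is_derive t 1 (fun t => (u *m X t) 0 j) ((u *m diag_mx th *m Y t) 0 j).
  rewrite /X /Y normal_mul.
  have -> : (fun t => (u *m (curve e f th t *m a^T)) 0 j) =
     (fun t => (u *m curve (e *m a^T) (f *m a^T) th t) 0 j).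
    by apply/funext => s; rewrite curve_mul.
  exact: der_curve.
exact: derM.
Qed.

Lemma der2_sqn_curve (u : 'rV[R]_n) (t : R) :
  is_derive t 1 (fun t => 2%:R * dot (u *m X t) (u *m diag_mx th *m Y t))
   (2%:R * (sqn (u *m diag_mx th *m Y t)
            - dot (u *m X t) (u *m diag_mx th *m diag_mx th *m X t))).
Proof.
apply: derZ; have -> : (fun t => dot (u *m X t) (u *m diag_mx th *m Y t)) =
   (fun t => \sum_(j <- index_enum 'I_n) (u *m X t) 0 j * (u *m diag_mx th *m Y t) 0 j).
  by apply/funext => s; rewrite dotE.
have -> : sqn (u *m diag_mx th *m Y t)
            - dot (u *m X t) (u *m diag_mx th *m diag_mx th *m X t) =
   \sum_(j <- index_enum 'I_n) ((u *m diag_mx th *m Y t) 0 j * (u *m diag_mx th *m Y t) 0 j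
     + (u *m X t) 0 j * - (u *m diag_mx th *m diag_mx th *m X t) 0 j).
  by rewrite /sqn !dotE -sumrB; apply: eq_bigr => j _; rewrite mulrN.
apply: (@der_sum R _ _ (fun j t => (u *m X t) 0 j * (u *m diag_mx th *m Y t) 0 j)
  (fun j t => (u *m diag_mx th *m Y t) 0 j * (u *m diag_mx th *m Y t) 0 j
     + (u *m X t) 0 j * - (u *m diag_mx th *m diag_mx th *m X t) 0 j)) => j.
apply: derM.
  rewrite /X /Y normal_mul.
  have -> : (fun t => (u *m (curve e f th t *m a^T)) 0 j) =
     (fun t => (u *m curve (e *m a^T) (f *m a^T) th t) 0 j).
    by apply/funext => s; rewrite curve_mul.
  exact: der_curve.
rewrite /X /Y curve_mul.
have -> : (fun t => (u *m diag_mx th *m (normal e f th t *m a^T)) 0 j) =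
   (fun t => (u *m diag_mx th *m normal (e *m a^T) (f *m a^T) th t) 0 j).
  by apply/funext => s; rewrite normal_mul.
exact: der_normal.
Qed.

Lemma mxcont_curve : mxcont (fun t => curve e f th t).
Proof.
move=> i j; have h (t : R) := der_curve e f th (delta_mx 0 i) j t.
have := cont_of_derive h.
by under eq_fun do rewrite -rowE mxE.
Qed.

Hypothesis g : geo_data e f th.
Hypothesis oa : ortho a.

(** The rows of [diag_mx th *m normal e f th t] are orthogonal with norms |th_i|, also where a row
    of [f] vanishes. *)
Lemma sqn_diag_normal (u : 'rV[R]_n) t :
  sqn (u *m diag_mx th *m normal e f th t) = dot u (u *m diag_mx th *m diag_mx th).
Proof.
have -> : sqn (u *m diag_mx th *m normal e f th t) =
   dot u (u *m (diag_mx th *m (normal e f th t *m (normal e f th t)^T) *m diag_mx th)).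
  rewrite /sqn -mulmxA dot_mulmx !trmx_mul tr_diag_mx !mulmxA //.
congr (dot _ _); rewrite -[RHS]mulmxA; congr (u *m _).
apply/matrixP => i j; rewrite mul_mx_diag [LHS]mxE mul_diag_mx [X in X * _]mxE.
rewrite mulmx_trE mul_diag_mx !mxE.
have := thnormal_dot g t i j; have [->|ij] := eqVneq i j.
  by rewrite mul1r mulr1n expr2 => <-; ring.
by rewrite mul0r mulr0n mulr0 => h; rewrite -[RHS]h; ring.
Qed.

(** The left side is half the second derivative of |u X|^2. As u is an eigenvector, its second term
    is gu |w|^2 for the velocity w of u times the frame, and [normal_form_le] applies to w. *)
Lemma pairs_second_derivative t (u : 'rV[R]_n) (gu go c : R) :
  dot u u = 1 -> 0 < gu -> gu <= 1 -> 1 - go <= gu -> (gu < 1 -> hgap gu <= c) ->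
  u *m X t *m (X t)^T = gu *: u ->
  (forall b, dot b (u *m X t) = 0 -> go * dot b b <= sqn (b *m (X t)^T)) ->
  sqn (u *m diag_mx th *m Y t) - dot (u *m X t) (u *m diag_mx th *m diag_mx th *m X t)
  <= c * dot (u *m X t) (u *m diag_mx th *m Y t) ^+ 2.
Proof.
move=> u1 g0 g1 go1 hc uG bG.
have oF : ortho (curve e f th t) by apply: curve_ortho.
pose w := u *m diag_mx th *m normal e f th t.
have wF : w *m (curve e f th t)^T = 0 by rewrite /w -mulmxA normalmx_perp ?mulmx0.
have := normal_form_le oa oF u1 g0 g1 go1 hc uG bG wF.
have -> : w *m a^T = u *m diag_mx th *m Y t by rewrite /w -!mulmxA.
suff -> : dot (u *m X t) (u *m diag_mx th *m diag_mx th *m X t) = gu * dot w w by [].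
rewrite -[dot w w]/(sqn w) sqn_diag_normal [LHS]dotC dot_mulmx uG dotZr.
by rewrite dotC.
Qed.

Lemma sqn_curve_le1 (u : 'rV[R]_n) t : dot u u = 1 -> sqn (u *m X t) <= 1.
Proof.
move=> u1; rewrite /X mulmxA -u1 -(dot_ortho u u (curve_ortho g t)).
exact: bessel.
Qed.

Lemma dot_curve_normal_le (u : 'rV[R]_n) t : dot u u = 1 ->
  `|dot (u *m X t) (u *m diag_mx th *m Y t)| <= 1 + sqn th.
Proof.
move=> u1; rewrite -(@ler_pXn2r _ 2) ?nnegrE //; last by rewrite addr_ge0 ?dot_ge0.
rewrite real_normK ?num_real //; apply: le_trans (dot_CS _ _) _.
have h1 := sqn_curve_le1 t u1.
have h2 : sqn (u *m diag_mx th *m Y t) <= sqn th.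
  rewrite /Y mulmxA; apply: le_trans (bessel _ oa) _.
  rewrite -[dot _ _]/(sqn _) sqn_diag_normal /sqn !dotE ler_sum // => i _.
  rewrite !mul_mx_diag !mxE mulrA (mulrA (u 0 i)) -[u 0 i * u 0 i]expr2 -mulrA.
  rewrite -[X in _ <= X]mul1r ler_wpM2r ?sqr_ge0 // -?expr2 ?sqr_ge0 //.
  rewrite -u1 dotE (bigD1 i) //= -expr2 lerDl sumr_ge0 // => l _.
  by rewrite -expr2 sqr_ge0.
apply: le_trans (_ : 1 * sqn th <= _).
  by apply: ler_pM => //; apply: dot_ge0.
have := dot_ge0 th; rewrite -/(sqn th) mul1r; nra.
Qed.

End PairDerivatives.

(** * The maximum principle *)

Lemma compact_argmin (R : realType) (T : topologicalType) (K Z : set T) (f : T -> R) :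
  compact K -> closed Z -> continuous f -> (K `&` Z) !=set0 ->
  exists2 c, (K `&` Z) c & forall x, (K `&` Z) x -> f c <= f x.
Proof.
move=> cK cZ cf ne.
have [c] := compact_EVT_min ne (compact_closedI cK cZ) (continuous_subspaceT cf).
by rewrite inE => cc h; exists c => // x hx; apply: h; rewrite inE.
Qed.

Lemma closed_orthopair (R : realType) (T : topologicalType) n (u v : T -> 'rV[R]_n) :
  mxcont u -> mxcont v -> closed [set x | orthopair (u x) (v x)].
Proof.
move=> cu cv; rewrite (_ : [set x | _] = [set x | dot (u x) (u x) = 1] `&`
   ([set x | dot (v x) (v x) = 1] `&` [set x | dot (u x) (v x) = 0])).
  by apply: closedI; [|apply: closedI]; apply: closed_eqf;
    [exact: mxcont_dot|exact: cont_cst|exact: mxcont_dot|exact: cont_cst|exact: mxcont_dot|exact: cont_cst].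
by apply/seteqP; split => x /=; [case=> ? ? ?; split|case=> ? [? ?]; split].
Qed.

Lemma unit_box (R : realType) n (u : 'rV[R]_n) : dot u u = 1 ->
  forall i j, -1 <= u i j <= 1.
Proof.
move=> u1 i j; apply: ortho_entry_le; apply/matrixP => p q.
by rewrite !ord1 -/(dot u u) u1 mxE eqxx.
Qed.

(** For g1 <= 1/2 and c = hgap g1, g1 + g2 >= 1 gives hgap g2 <= - c, so T1 + T2 <= c (A1^2 - A2^2),
    which has the factor A1 + A2. The bound c0 on g1 keeps c below 1/c0. *)
Lemma hgap_bound (R : realType) (g1 g2 c0 B A1 A2 T1 T2 : R) :
  0 < c0 -> c0 <= g1 -> g1 <= g2 -> g2 <= 1 -> 1 <= g1 + g2 ->
  `|A1| <= B -> `|A2| <= B ->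
  (forall c, (g1 < 1 -> hgap g1 <= c) -> T1 <= c * A1 ^+ 2) ->
  (forall c, (g2 < 1 -> hgap g2 <= c) -> T2 <= c * A2 ^+ 2) ->
  T1 + T2 <= 2%:R * B / c0 * `|A1 + A2|.
Proof.
move=> c00 g1c g12 g2l gs A1B A2B h1 h2.
have B0 : 0 <= B := le_trans (normr_ge0 _) A1B.
have R0 : 0 <= 2%:R * B / c0 * `|A1 + A2|.
  by rewrite mulr_ge0 // divr_ge0 ?mulr_ge0 // ltW.
have gap0 (x : R) : 2^-1 < x -> x < 1 -> hgap x <= 0.
  move=> x2 x1; have x0 : 0 < x by lra.
  by rewrite /hgap subr_le0 lef_pV2 ?posrE; lra.
have [gh|gh] := ltP 2^-1 g1.
  apply: le_trans R0; have := h1 0 (gap0 _ gh); have := h2 0 (gap0 _ (lt_le_trans gh g12)).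
  by rewrite !mul0r; lra.
have g10 : 0 < g1 by lra.
set c := hgap g1.
have c_ge0 : 0 <= c by rewrite /c /hgap subr_ge0 lef_pV2 ?posrE; lra.
have c_le : c <= c0^-1.
  rewrite /c /hgap lerBlDr; apply: ler_wpDr; first by rewrite invr_ge0; lra.
  by rewrite lef_pV2 ?posrE.
have := h1 c (fun _ => lexx _).
have /h2 : g2 < 1 -> hgap g2 <= - c.
  move=> g2l1; rewrite /c /hgap opprB.
  have e1 : (1 - g2)^-1 >= g1^-1 by rewrite lef_pV2 ?posrE; lra.
  have e2 : (1 - g1)^-1 >= g2^-1 by rewrite lef_pV2 ?posrE; lra.
  lra.
move=> {}h2 {}h1; apply: le_trans (lerD h1 h2) _.
have -> : c * A1 ^+ 2 + - c * A2 ^+ 2 = c * ((A1 - A2) * (A1 + A2)) by ring.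
apply: le_trans (ler_norm _) _; rewrite normrM (ger0_norm c_ge0) normrM mulrA.
apply: ler_wpM2r => //; rewrite mulrC; apply: ler_pM => //.
apply: le_trans (ler_normB _ _) _; lra.
Qed.

Section MaxPrinciple.
Variables (R : realType) (n N : nat) (a e f : 'M[R]_(n, N)) (th : 'rV[R]_n).
Hypothesis g : geo_data e f th.
Hypothesis oa : ortho a.
Let X t := curve e f th t *m a^T.

(** Left singular vectors for the two least singular values minimize the sum, by Ky Fan's argument.
    The given pair certifies that the dimension is at least 2. *)
Lemma lowest_pair (Z : 'M[R]_n) (u0 v0 : 'rV[R]_n) : orthopair u0 v0 ->
  0 < \det Z -> exists u v g1 g2,
  [/\ orthopair u v, 0 < g1 <= g2,
      u *m Z *m Z^T = g1 *: u /\ v *m Z *m Z^T = g2 *: v,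
      (forall b, dot b (u *m Z) = 0 -> g2 * dot b b <= sqn (b *m Z^T)) /\
      (forall b, dot b (v *m Z) = 0 -> g1 * dot b b <= sqn (b *m Z^T))
    & forall u' v', orthopair u' v' ->
        sqn (u *m Z) + sqn (v *m Z) <= sqn (u' *m Z) + sqn (v' *m Z)].
Proof.
move=> uv0 dZ; have [k [k' [c [[ok dk] [ok' dk'] E _ _]]]] := svd Z.
have ZE := svd_eq ok ok' E.
have dc : 0 < \det (diag_mx c) by rewrite -E !det_mulmx det_tr dk dk' mul1r mulr1.
have c0 i : c 0 i != 0.
  apply: contraTneq dc => ci; rewrite det_diag (bigD1 i) //= ci mul0r ltxx //.
pose w i := u0 0 i ^+ 2 + v0 0 i ^+ 2.
have w2 : \sum_i w i = 2%:R.
  case: uv0; rewrite !dotE => u1 v1 _; rewrite big_split /=.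
  by under eq_bigr do rewrite expr2; under [X in _ + X]eq_bigr do rewrite expr2;
     rewrite u1 v1.
have [i1 _] : exists i : 'I_n, True.
  apply: contrapT => no; move: w2; rewrite big1; first by lra.
  by move=> i; case: no; exists i.
have [i hi] : exists i, forall l, c 0 i ^+ 2 <= c 0 l ^+ 2.
  by exists [arg min_(i < i1) c 0 i ^+ 2]%O; case: arg_minP => // i _ h l; exact: h.
have [j1 ij1] : exists j, j != i.
  apply: contrapT => no; move: w2; rewrite (bigD1 i) //= big1; last first.
    by move=> l li; case: no; exists l.
  by have := orthopair_weight i uv0; rewrite /w; lra.
have [j ji hj] : exists2 j, j != i & forall l, l != i -> c 0 j ^+ 2 <= c 0 l ^+ 2.
  exists [arg min_(j < j1 | j != i) c 0 j ^+ 2]%O; case: arg_minP => // l li h //.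
have ij : i != j by rewrite eq_sym.
have rowZ l : row l k *m Z = c 0 l *: row l k'.
  rewrite ZE !mulmxA -row_mul (ok : k *m k^T = _) row1 -rowE row_diag_mx.
  by rewrite -scalemxAl -rowE.
have ZT : Z^T = k'^T *m diag_mx c *m k by rewrite ZE !trmx_mul trmxK tr_diag_mx mulmxA.
have rowZT l : row l k' *m Z^T = c 0 l *: row l k.
  rewrite ZT !mulmxA -row_mul (ok' : k' *m k'^T = _) row1 -rowE row_diag_mx.
  by rewrite -scalemxAl -rowE.
have sqZ l : sqn (row l k *m Z) = c 0 l ^+ 2.
  by rewrite rowZ /sqn dotZl dotZr ortho_row1 // mulr1 expr2.
have eig l : row l k *m Z *m Z^T = c 0 l ^+ 2 *: row l k.
  by rewrite rowZ -scalemxAl rowZT scalerA expr2.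
have low (p q : 'I_n) (gq : R) b : (forall l, l != p -> gq <= c 0 l ^+ 2) ->
    dot b (row p k *m Z) = 0 -> gq * dot b b <= sqn (b *m Z^T).
  move=> hp; rewrite rowZ dotZr => /eqP; rewrite mulf_eq0 (negbTE (c0 p)) /= => /eqP bp.
  rewrite ZT !mulmxA sqn_ortho // sqn_diag.
  rewrite -(dot_ortho b b (ortho_tr ok')) dotE mulr_sumr ler_sum // => l _.
  rewrite -expr2; have [->|lp] := eqVneq l p.
    by rewrite dot_sum_row bp expr0n !mulr0.
  by rewrite ler_wpM2r ?sqr_ge0 // hp.
exists (row i k), (row j k), (c 0 i ^+ 2), (c 0 j ^+ 2); split.
- exact: orthopair_row.
- by rewrite hi andbT lt0r sqrf_eq0 c0 sqr_ge0.
- by split; apply: eig.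
- split=> b; [apply: (low i j) => l|apply: (low j i) => l]; last by [].
  exact: hj.
- move=> u' v' uv'; rewrite !sqZ ZE !mulmxA !(sqn_ortho _ ok') !sqn_diag -big_split /=.
  have := orthopair_mul (ortho_tr ok) uv'; move: (u' *m k^T) (v' *m k^T) => p q pq.
  have := orthopair_weight i pq.
  have pq2 : \sum_l (p 0 l ^+ 2 + q 0 l ^+ 2) = 2%:R.
    case: pq; rewrite !dotE => u1 v1 _; rewrite big_split /=.
    by under eq_bigr do rewrite expr2; under [X in _ + X]eq_bigr do rewrite expr2;
      rewrite u1 v1.
  have pq2' : \sum_(l | l != i) (p 0 l ^+ 2 + q 0 l ^+ 2) = 2%:R - (p 0 i ^+ 2 + q 0 i ^+ 2).
    by rewrite -pq2 [in RHS](bigD1 i) //= addrAC subrr add0r.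
  have -> : \sum_l (c 0 l ^+ 2 * p 0 l ^+ 2 + c 0 l ^+ 2 * q 0 l ^+ 2) =
     c 0 i ^+ 2 * (p 0 i ^+ 2 + q 0 i ^+ 2) +
     \sum_(l | l != i) c 0 l ^+ 2 * (p 0 l ^+ 2 + q 0 l ^+ 2).
    by under eq_bigr do rewrite -mulrDr; rewrite (bigD1 i).
  have : c 0 j ^+ 2 * (2%:R - (p 0 i ^+ 2 + q 0 i ^+ 2)) <=
     \sum_(l | l != i) c 0 l ^+ 2 * (p 0 l ^+ 2 + q 0 l ^+ 2).
    rewrite -pq2' mulr_sumr ler_sum // => l li.
    by rewrite ler_wpM2r ?hj // addr_ge0 // sqr_ge0.
  have := hi j; set S := \sum_(_ | _) _; nra.
Qed.

(* With sigma the minimum of |uX|^2 + |vX|^2 - 1 over orthonormal pairs,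
   sigma'' <= C |sigma'| in the barrier sense, so sigma stays above a small
   exponential. *)
Lemma pairs_max_principle :
  (forall t, 0 <= t <= 1 -> cgood (X t)) -> sgood (X 0) -> sgood (X 1) ->
  forall t, 0 <= t <= 1 -> sgood (X t).
Proof.
move=> cg [d0 p0] [d1 p1].
have dX := curve_det_gt0 g oa cg d0 d1.
move=> t0 t01; split; first exact: dX.
move=> u0 v0 uv0; rewrite ltNge; apply/negP => touch.
have t0_gt0 : 0 < t0.
  case/andP: t01; rewrite le_eqVlt => /orP[/eqP z|//] _.
  by move: touch; rewrite -z leNgt p0.
have t0_lt1 : t0 < 1.
  case/andP: t01 => _; rewrite le_eqVlt => /orP[/eqP z|//].
  by move: touch; rewrite z leNgt p1.
have cX : mxcont X.
  by apply: mxcont_mul; [apply: mxcont_curve|apply: mxcont_cst].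
pose box := [set A : 'rV[R]_n | forall i j, -1 <= A i j <= 1].
have cbox : compact box by apply: mx_compact.
have [c2 c20 hc2] : exists2 c2, 0 < c2 & forall t u, 0 <= t <= 1 -> dot u u = 1 ->
    c2 <= sqn (u *m X t).
  pose T := (R * 'rV[R]_n)%type.
  have k1 : continuous (fun x : T => x.1) by move=> x; apply: cvg_fst.
  have k2 : mxcont (fun x : T => x.2) by apply: mxcont_of => x; apply: cvg_snd.
  have kux : mxcont (fun x : T => x.2 *m X x.1).
    by apply: mxcont_mul => //; apply: (mxcont_comp k1 cX).
  have [] := @compact_argmin R T (`[0, 1] `*` box) [set x | dot x.2 x.2 = 1]
     (fun x => sqn (x.2 *m X x.1)).
  - by apply: compact_setX => //; apply: segment_compact.
  - by apply: closed_eqf; [apply: mxcont_dot|apply: cont_cst].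
  - exact: mxcont_dot.
  - exists (0, u0); case: uv0 => uu _ _; split=> //=; split=> /=.
      by rewrite in_itv /= lexx ler01.
    exact: unit_box.
  move=> [t u] [[/= t_in _] uu] hmin; rewrite in_itv /= in t_in.
  exists (sqn (u *m X t)).
    rewrite dot_gt0; apply/negP => /eqP uX.
    have Xu : X t \in unitmx by rewrite unitmxE unitfE gt_eqF // dX.
    have z := mulmxK Xu u; rewrite uX mul0mx in z.
    by move: uu; rewrite -z /= dot0l => /eqP; rewrite eq_sym oner_eq0.
  move=> t' u' t'01 u'1; apply: (hmin (t', u')); split=> //=; split=> /=.
    by rewrite in_itv.
  exact: unit_box.
have k1 : mxcont (fun x : 'rV[R]_n * 'rV[R]_n => x.1) by apply: mxcont_of => x; apply: cvg_fst.
have k2 : mxcont (fun x : 'rV[R]_n * 'rV[R]_n => x.2) by apply: mxcont_of => x; apply: cvg_snd.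
have [m1 m10 hm1] : exists2 m1, 0 < m1 & forall u v, orthopair u v ->
    1 + m1 <= sqn (u *m X 1) + sqn (v *m X 1).
  pose T := ('rV[R]_n * 'rV[R]_n)%type.
  have [] := @compact_argmin R T (box `*` box) [set x | orthopair x.1 x.2]
     (fun x => sqn (x.1 *m X 1) + sqn (x.2 *m X 1)).
  - exact: compact_setX.
  - exact: closed_orthopair.
  - by apply: contD; apply: mxcont_dot; apply: mxcont_mul => //; apply: mxcont_cst.
  - by exists (u0, v0); split=> //; split; case: uv0 => ? ? _; apply: unit_box.
  move=> [u v] [_ /= uv] hmin; exists (sqn (u *m X 1) + sqn (v *m X 1) - 1).
    by rewrite subr_gt0 p1.
  move=> u' v' uv'; rewrite addrC subrK; apply: (hmin (u', v')); split=> //.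
  by split; case: uv' => ? ? _; apply: unit_box.
pose B := 1 + sqn th.
have B0 : 0 < B by rewrite /B ltr_wpDr ?dot_ge0.
(* One more than the constant of [hgap_bound], which makes the final comparison strict. *)
pose K := 2%:R * B / c2 + 1.
have K0 : 0 < K by rewrite /K addr_gt0 // divr_gt0 // mulr_gt0.
pose ep := m1 / expR K.
have ep0 : 0 < ep by rewrite divr_gt0 // expR_gt0.
(* A barrier with w'' = K w': it vanishes at the supposed failure time t0, is negative at 0 and, by
   the choice of [ep], below the margin m1 at 1. Hence a minimum of the sum minus w with value at
   most 1 is interior in time. *)
pose w t := ep * (expR (t * K) - expR (t0 * K)).
have cw : continuous w.
  apply: contM; first exact: cont_cst.
  apply: contB; last exact: cont_cst.
  by apply: cont_of_derive => t; apply: der_exp.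
pose T := (R * ('rV[R]_n * 'rV[R]_n))%type.
pose Phi (x : T) := sqn (x.2.1 *m X x.1) + sqn (x.2.2 *m X x.1) - w x.1.
have f1 : continuous (fun x : T => x.1) by move=> x; apply: cvg_fst.
have f2 : continuous (fun x : T => x.2) by move=> x; apply: cvg_snd.
have f21 : mxcont (fun x : T => x.2.1) by apply: (mxcont_comp f2 k1).
have f22 : mxcont (fun x : T => x.2.2) by apply: (mxcont_comp f2 k2).
have fX : mxcont (fun x : T => X x.1) by apply: (mxcont_comp f1 cX).
have in01 t (u v : 'rV[R]_n) : 0 <= t <= 1 -> orthopair u v ->
    ((`[0, 1] `*` (box `*` box)) `&` [set x : T | orthopair x.2.1 x.2.2]) (t, (u, v)).
  move=> t_in uv; split=> //; split; rewrite /= ?in_itv //=.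
  by case: uv => ? ? _; split; apply: unit_box.
have [] := @compact_argmin R T (`[0, 1] `*` (box `*` box)) [set x | orthopair x.2.1 x.2.2] Phi.
- by apply: compact_setX; [apply: segment_compact|apply: compact_setX].
- exact: closed_orthopair.
- apply: contB; last by move=> x; apply: (@continuous_comp _ _ _ (fun x : T => x.1) w); [exact: f1|exact: cw].
  by apply: contD; apply: mxcont_dot; apply: mxcont_mul.
- by exists (t0, (u0, v0)); apply: in01.
move=> [t2 [u1 v1]] [[/= t2_in _] uv1] hmin; rewrite in_itv /= in t2_in.
(* At the minimizing time the pair may be replaced by singular vectors. Frozen in time, they give a
   smooth function whose difference with w is least at t2. *)
have [u [v [g1 [g2 [uv /andP[g10 g12] [uG vG] [uB vB] hlow]]]]] := lowest_pair uv1 (dX t2 t2_in).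
have min2 t u' v' : 0 <= t <= 1 -> orthopair u' v' ->
   sqn (u *m X t2) + sqn (v *m X t2) - w t2 <= sqn (u' *m X t) + sqn (v' *m X t) - w t.
  move=> ht huv; apply: le_trans (hmin (t, (u', v')) (in01 _ _ _ ht huv)).
  by rewrite /Phi /= lerD2r; apply: hlow.
have neg : sqn (u *m X t2) + sqn (v *m X t2) - w t2 <= 1.
  have := min2 t0 u0 v0 t01 uv0; rewrite {2}/w subrr mulr0 subr0.
  by move=> h; apply: le_trans h touch.
have w0 : w 0 < 0.
  by rewrite /w pmulr_rlt0 // subr_lt0 ltr_expR mul0r mulr_gt0.
have w1 : w 1 < m1.
  rewrite /w mul1r mulrBr /ep divfK; last by rewrite gt_eqF // expR_gt0.
  by rewrite ltrBlDr ltrDl mulr_gt0 // expR_gt0.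
have t2_gt0 : 0 < t2.
  case/andP: t2_in; rewrite le_eqVlt => /orP[/eqP z|//] _.
  by move: neg; rewrite -z; have := p0 _ _ uv; move: w0; clear; lra.
have t2_lt1 : t2 < 1.
  case/andP: t2_in => _; rewrite le_eqVlt => /orP[/eqP z|//].
  by move: neg; rewrite z; have := hm1 _ _ uv; move: w1; clear; lra.
pose Y t := normal e f th t *m a^T.
pose S t := sqn (u *m X t) + sqn (v *m X t) - w t.
pose A1 t := dot (u *m X t) (u *m diag_mx th *m Y t).
pose A2 t := dot (v *m X t) (v *m diag_mx th *m Y t).
pose T1 := sqn (u *m diag_mx th *m Y t2) - dot (u *m X t2) (u *m diag_mx th *m diag_mx th *m X t2).
pose T2 := sqn (v *m diag_mx th *m Y t2) - dot (v *m X t2) (v *m diag_mx th *m diag_mx th *m X t2).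
pose E t := expR (t * K).
have [|t|||] := @second_derivative_min R S
   (fun t => 2%:R * A1 t + 2%:R * A2 t - ep * (K * E t))
   (2%:R * T1 + 2%:R * T2 - ep * (K * (K * E t2))) t2 0 1.
- by rewrite t2_gt0.
- apply: derB; first by apply: derD; apply: der_sqn_curve.
  apply: derZ; apply: (der_eq (derB (der_exp t K) (der_cst (expR (t0 * K)) t))).
  by rewrite subr0.
- apply: derB; first by apply: derD; apply: der2_sqn_curve.
  by apply: derZ; apply: derZ; apply: der_exp.
- by move=> t /andP[t_0 t_1]; apply: min2 => //; rewrite !ltW.
move=> e1 e2.
have [uu vv _] := uv.
have cg2 := cg t2 t2_in.
have su : sqn (u *m X t2) = g1 by rewrite /sqn dot_mulmx uG dotZr uu mulr1.
have sv : sqn (v *m X t2) = g2 by rewrite /sqn dot_mulmx vG dotZr vv mulr1.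
have gs : 1 <= g1 + g2 by rewrite -su -sv; apply: (cg2.2).
have g2le : g2 <= 1 by rewrite -sv; apply: sqn_curve_le1.
have g1le : g1 <= 1 by exact: le_trans g2le.
have g1c : c2 <= g1 by rewrite -su; apply: hc2.
have := @hgap_bound R g1 g2 c2 B (A1 t2) (A2 t2) T1 T2 c20 g1c g12 g2le gs
   (dot_curve_normal_le g oa t2 uu) (dot_curve_normal_le g oa t2 vv) _ _.
have gs1 : 1 - g2 <= g1 by rewrite lerBlDr.
have gs2 : 1 - g1 <= g2 by rewrite lerBlDr addrC.
have g20 : 0 < g2 by exact: lt_le_trans g12.
have h1 c : (g1 < 1 -> hgap g1 <= c) -> T1 <= c * A1 t2 ^+ 2.
  by move=> hc; apply: (pairs_second_derivative g oa uu g10 g1le gs1 hc uG uB).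
have h2 c : (g2 < 1 -> hgap g2 <= c) -> T2 <= c * A2 t2 ^+ 2.
  move=> hc; apply: (pairs_second_derivative g oa vv g20 g2le gs2 hc vG vB).
move=> /(_ h1 h2).
(* The first order condition reads A1 + A2 = K W / 2 and the second 2 (T1 + T2) >= K^2 W, while
   [hgap_bound] gives 2 (T1 + T2) <= (K - 1) K W. *)
set W := ep * E t2.
have W0 : 0 < W by rewrite mulr_gt0 // expR_gt0.
have -> : A1 t2 + A2 t2 = 2^-1 * (K * W).
  have -> : K * W = ep * (K * E t2) by rewrite /W; ring.
  by move: e1; clear; lra.
rewrite ger0_norm; last by rewrite mulr_ge0 // mulr_ge0 // ltW.
move=> hT; have : K ^+ 2 * W <= 2%:R * (2%:R * B / c2 * (2^-1 * (K * W))).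
  apply: le_trans (_ : 2%:R * (T1 + T2) <= _); last by rewrite ler_pM2l.
  have -> : K ^+ 2 * W = ep * (K * (K * E t2)) by rewrite /W; ring.
  by move: e2; clear; lra.
have -> : 2%:R * (2%:R * B / c2 * (2^-1 * (K * W))) = (2%:R * B / c2) * (K * W) by field; rewrite gt_eqF.
have KW0 : 0 < K * W by rewrite mulr_gt0.
by rewrite expr2 -mulrA (ler_pM2r KW0) /K gerDl ler10.
Qed.

End MaxPrinciple.

(** * The cut locus *)

Lemma det_two_rows (R : comNzRingType) n (K : 'M[R]_n) i j : i != j ->
  (forall p, p != i -> p != j -> row p K = delta_mx 0 p) ->
  \det K = K i i * K j j - K i j * K j i.
Proof.
move=> ij hK; have ji := ij; rewrite eq_sym in ji.
pose U : 'M[R]_(n, 2) := \matrix_(p, l) (p == (if l == 0 then i else j))%:R.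
pose V : 'M[R]_(2, n) := \matrix_l (if l == 0 then row i K - delta_mx 0 i
                                    else row j K - delta_mx 0 j).
have -> : K = 1%:M + U *m V.
  apply/matrixP => p q; rewrite !mxE big_ord_recl big_ord1 !mxE /= ?eqxx /=.
  have [?|pi] := eqVneq p i; [subst p|have [?|pj] := eqVneq p j; [subst p|]];
    rewrite ?eqxx ?(negbTE ij) ?(negbTE ji) ?mxE ?eqxx ?(eq_sym i q) ?(eq_sym j q) /=;
    try ring.
  by have /rowP/(_ q) := hK p pi pj; rewrite !mxE eqxx eq_sym /= => ->; ring.
have e (l l' : 'I_2) : (V *m U) l l' = V l (if l' == 0 then i else j).
  rewrite mxE (bigD1 (if l' == 0 then i else j)) //= !mxE eqxx mulr1 big1 ?addr0 //.
  by move=> p pn; rewrite !mxE (negbTE pn) mulr0.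
have f l l' : (1%:M + V *m U) l l' = (l == l')%:R + V l (if l' == 0 then i else j).
  by rewrite mxE e [1%:M _ _]mxE.
have h p q : (1%:M + U *m V) p q = (p == q)%:R + (p == i)%:R * V 0 q + (p == j)%:R * V 1 q.
  by rewrite !mxE big_ord_recl big_ord1 !mxE /= addrA.
rewrite det_1DmulC det_mx22 !f !h !eqxx (negbTE ij) (negbTE ji) /=; ring.
Qed.

(** * Replacing two vectors of a frame by normal ones *)

Section Minor.
Variable R : realType.

Lemma psd2 (a b c : R) :
  (forall x y, 0 <= a * x ^+ 2 + 2%:R * c * (x * y) + b * y ^+ 2) ->
  [/\ 0 <= a, 0 <= b & c ^+ 2 <= a * b].
Proof.
move=> h; have a0 : 0 <= a by have := h 1 0; lra.
have b0 : 0 <= b by have := h 0 1; lra.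
split=> //; have [az|an] := eqVneq a 0.
  have [->|cn] := eqVneq c 0; first by rewrite expr0n mulr_ge0.
  (* With a = 0 and c != 0 the form takes the value -1 at this vector. *)
  have := h (- (b + 1) / (2%:R * c)) 1; rewrite az mul0r add0r expr1n !mulr1.
  have -> : 2%:R * c * (- (b + 1) / (2%:R * c)) = - (b + 1) by field.
  lra.
have ap : 0 < a by rewrite lt0r an.
have := h (- c) a; have -> : a * (- c) ^+ 2 + 2%:R * c * (- c * a) + b * a ^+ 2
  = a * (a * b - c ^+ 2) by ring.
by rewrite pmulr_rge0 // subr_ge0.
Qed.

(** The determinant is monotone on positive semidefinite 2 by 2 matrices: the mixed term 2 r c is at
    most p b + q a by the arithmetic-geometric inequality. *)
Lemma psd_det_add (p q r a b c : R) : 0 <= p -> 0 <= q -> r ^+ 2 <= p * q ->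
  0 <= a -> 0 <= b -> c ^+ 2 <= a * b ->
  p * q - r ^+ 2 <= (p + a) * (q + b) - (r + c) ^+ 2.
Proof.
move=> p0 q0 pq a0 b0 ab.
have pb0 : 0 <= p * b by rewrite mulr_ge0.
have qa0 : 0 <= q * a by rewrite mulr_ge0.
have h : (2%:R * (r * c)) ^+ 2 <= (p * b + q * a) ^+ 2.
  have h1 : r ^+ 2 * c ^+ 2 <= (p * q) * (a * b).
    by apply: ler_pM; rewrite ?sqr_ge0.
  have := sqr_ge0 (p * b - q * a); rewrite !exprMn; nra.
have : 2%:R * (r * c) <= p * b + q * a.
  have [neg|pos] := leP (2%:R * (r * c)) 0; first by apply: le_trans neg _; rewrite addr_ge0.
  by rewrite -(@ler_pXn2r _ 2) ?nnegrE // ?addr_ge0 // ltW.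
have -> : (p + a) * (q + b) - (r + c) ^+ 2 =
  p * q - r ^+ 2 + (p * b + q * a - 2%:R * (r * c)) + (a * b - c ^+ 2) by ring.
lra.
Qed.

Lemma normalize n (u : 'rV[R]_n) : u != 0 ->
  exists2 v, dot v v = 1 & u = Num.sqrt (dot u u) *: v.
Proof.
rewrite -dot_gt0 => u0; have s0 : Num.sqrt (dot u u) != 0 by rewrite gt_eqF // sqrtr_gt0.
exists ((Num.sqrt (dot u u))^-1 *: u); last by rewrite scalerA divff // scale1r.
by rewrite dotZl dotZr mulrA -expr2 exprVn sqr_sqrtr ?ltW // mulVf // gt_eqF.
Qed.

(* The pair condition for a basis p, q of a plane, not orthonormal: the trace of
   the form on the plane is the trace of (Gram matrix)^-1 times its matrix. *)
Lemma pairs_gt1_basis n m (M : 'M[R]_(n, m)) (p q : 'rV[R]_n) :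
  pairs_gt1 M -> dot (p *m M) (p *m M) = 1 -> dot (q *m M) (q *m M) = 1 ->
  dot (p *m M) (q *m M) = 0 ->
  dot p p * dot q q - dot p q ^+ 2 < dot p p + dot q q.
Proof.
move=> pM pp qq pq; set al := dot p p; set be := dot q q; set ga := dot p q.
have pn0 : p != 0 by apply: contra_eq_neq pp => ->; rewrite mul0mx dot0l eq_sym oner_eq0.
have al0 : 0 < al by rewrite dot_gt0.
pose q' := q - (ga / al) *: p.
have qM' : sqn (q' *m M) = 1 + (ga / al) ^+ 2.
  rewrite /sqn /q' mulmxBl -scalemxAl !(dotBl, dotBr, dotZl, dotZr) pp qq pq (dotC (q *m M)) pq.
  ring.
have q'0 : q' != 0.
  apply: contra_eq_neq qM' => ->; rewrite /sqn mul0mx dot0l eq_sym gt_eqF //.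
  by have := sqr_ge0 (ga / al); lra.
have de : dot q' q' = (al * be - ga ^+ 2) / al.
  rewrite /q' !(dotBl, dotBr, dotZl, dotZr) (dotC q p) -/al -/be -/ga; field.
  by rewrite gt_eqF.
have de0 : 0 < dot q' q' by rewrite dot_gt0.
have pq' : dot p q' = 0.
  by rewrite /q' dotBr dotZr -/al -/ga divfK ?subrr // gt_eqF.
have [u u1 pu] := normalize pn0; have [v v1 qv] := normalize q'0.
have sp : Num.sqrt (dot p p) != 0 by rewrite gt_eqF // sqrtr_gt0.
have sq : Num.sqrt (dot q' q') != 0 by rewrite gt_eqF // sqrtr_gt0.
have sp2 : Num.sqrt (dot p p) ^+ 2 = al by rewrite sqr_sqrtr // ltW.
have sq2 : Num.sqrt (dot q' q') ^+ 2 = dot q' q' by rewrite sqr_sqrtr // ltW.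
move: (Num.sqrt _) (Num.sqrt _) pu qv sp sq sp2 sq2 => a b pu qv a0 b0 a2 b2.
have uv : dot u v = 0.
  move: pq'; rewrite pu qv dotZl dotZr => /eqP.
  by rewrite !mulf_eq0 (negbTE a0) (negbTE b0) /= => /eqP.
have := pM u v (And3 u1 v1 uv).
have -> : sqn (u *m M) = al^-1.
  move: pp; rewrite pu -!scalemxAl dotZl dotZr mulrA -expr2 a2 => h.
  by apply: (@mulfI _ al); rewrite ?gt_eqF // h divff // gt_eqF.
have -> : sqn (v *m M) = (1 + (ga / al) ^+ 2) / dot q' q'.
  rewrite -qM' -b2 qv -scalemxAl /sqn dotZl dotZr mulrA -expr2.
  by rewrite mulrAC divff ?mul1r // sqrf_eq0.
set d := dot q' q' in de de0 *.
have D0 : 0 < al * be - ga ^+ 2 by move: de0; rewrite de pmulr_lgt0 // invr_gt0.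
have -> : al^-1 + (1 + (ga / al) ^+ 2) / d = (al + be) / (al * be - ga ^+ 2).
  rewrite de; field.
  by rewrite !gt_eqF.
by rewrite ltr_pdivlMr // mul1r.
Qed.

Lemma bessel2 n N (F : 'M[R]_(n, N)) (x y q : 'rV[R]_N) : ortho F ->
  x *m F^T = 0 -> y *m F^T = 0 -> orthopair x y ->
  sqn (q *m F^T) + dot q x ^+ 2 + dot q y ^+ 2 <= dot q q.
Proof.
move=> oF xF yF [xx yy xy].
pose r := q - q *m F^T *m F.
have pF (z : 'rV[R]_N) : z *m F^T = 0 -> dot (q *m F^T *m F) z = 0.
  by move=> zF; rewrite dot_mulmx zF dot0r.
have rx : dot r x = dot q x by rewrite dotBl pF // subr0.
have ry : dot r y = dot q y by rewrite dotBl pF // subr0.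
have rr : dot r r = dot q q - sqn (q *m F^T).
  rewrite /r !(dotBl, dotBr) dot_ortho // (dotC q (_ *m F)) dot_mulmx /sqn; ring.
have := dot_ge0 (r - dot q x *: x - dot q y *: y).
have yx : dot y x = 0 by rewrite dotC.
have xr : dot x r = dot q x by rewrite dotC.
have yr : dot y r = dot q y by rewrite dotC.
clearbody r.
rewrite !(dotBl, dotBr, dotZl, dotZr) rr rx ry xx yy xy yx xr yr; lra.
Qed.

(** X' = K X, where K differs from the identity in two rows, so the ratio of the determinants is
    that of a 2 by 2 block M of K. Let G be the Gram matrix of the vectors b_i, b_j dual to the rows
    i, j of X. Bessel's inequality makes G - 1 - M^T M positive semidefinite; det M >= 1 would give
    det (G - 1) >= 1, against det G < tr G from [pairs_gt1_basis]. *)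
Lemma minor_lt n N (a F F' : 'M[R]_(n, N)) i j : i != j -> ortho a -> ortho F ->
  ortho F' ->
  (forall p, p != i -> p != j -> row p F' = row p F) ->
  row i F' *m F^T = 0 -> row j F' *m F^T = 0 ->
  sgood (F *m a^T) -> \det (F' *m a^T) < \det (F *m a^T).
Proof.
move=> ij oa oF oF' hF iF jF [dX pX]; rewrite ltNge; apply/negP => dle.
set X := F *m a^T in dX pX dle; set X' := F' *m a^T in dle.
have uX : X \in unitmx by rewrite unitmxE unitfE gt_eqF.
pose K := X' *m invmx X.
have KX : K *m X = X' by rewrite mulmxKV.
have dK : 1 <= \det K.
  by move: dle; rewrite -KX det_mulmx -{1}(mul1r (\det X)) ler_pM2r.
have Krow p : p != i -> p != j -> row p K = delta_mx 0 p.
  move=> pi pj; rewrite /K row_mul /X' row_mul hF // -row_mul -/X.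
  by rewrite -row_mul mulmxV // row1.
rewrite (det_two_rows ij Krow) in dK.
pose b l := row l (invmx X)^T.
have bX l : b l *m X^T = delta_mx 0 l.
  by rewrite /b -row_mul -trmx_mul mulmxV // trmx1 row1.
have bX' l p : dot (b l *m a) (row p F') = K p l.
  by rewrite dot_mulmx -row_mul dotC -mulmx_trE trmxK.
have xy : orthopair (row i F') (row j F') by apply: orthopair_row.
pose G1 := dot (b i) (b i); pose G2 := dot (b j) (b j); pose G3 := dot (b i) (b j).
have form x y : 0 <= (G1 - 1 - (K i i ^+ 2 + K j i ^+ 2)) * x ^+ 2
    + 2%:R * (G3 - (K i i * K i j + K j i * K j j)) * (x * y)
    + (G2 - 1 - (K i j ^+ 2 + K j j ^+ 2)) * y ^+ 2.
  have := bessel2 ((x *: b i + y *: b j) *m a) oF iF jF xy.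
  rewrite dot_ortho // -mulmxA -[a *m F^T]trmxK trmx_mul trmxK -/X.
  rewrite /sqn !mulmxDl -!scalemxAl !bX !(dotDl, dotDr, dotZl, dotZr) !bX'.
  rewrite !dot_delta !eqxx (negbTE ij) eq_sym (negbTE ij) /= (dotC (b j)) -/G1 -/G2 -/G3.
  nra.
have [h1 h2 h3] := psd2 form.
have det_ge : 1 <= (K i i ^+ 2 + K j i ^+ 2) * (K i j ^+ 2 + K j j ^+ 2)
     - (K i i * K i j + K j i * K j j) ^+ 2.
  have -> : (K i i ^+ 2 + K j i ^+ 2) * (K i j ^+ 2 + K j j ^+ 2)
     - (K i i * K i j + K j i * K j j) ^+ 2 = (K i i * K j j - K i j * K j i) ^+ 2 by ring.
  by rewrite expr_ge1 // (le_trans ler01).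
have := psd_det_add _ _ _ h1 h2 h3.
move=> /(_ (K i i ^+ 2 + K j i ^+ 2) (K i j ^+ 2 + K j j ^+ 2) (K i i * K i j + K j i * K j j)).
rewrite !addr_ge0 ?sqr_ge0 // => /(_ isT isT); rewrite -subr_ge0 (le_trans ler01 det_ge).
move=> /(_ isT) h4.
have := @pairs_gt1_basis _ _ X^T (b i) (b j) (pairs_gt1_tr pX).
rewrite !bX !dot_delta !eqxx (negbTE ij) => /(_ erefl erefl erefl).
rewrite -/G1 -/G2 -/G3; move: det_ge h4; clear.
set p := (K i i ^+ 2 + _); set q := (K i j ^+ 2 + _); set r := (K i i * K i j + _).
have -> : (p + (G1 - 1 - p)) * (q + (G2 - 1 - q)) - (r + (G3 - r)) ^+ 2
  = G1 * G2 - G3 ^+ 2 - (G1 + G2) + 1 by ring.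
lra.
Qed.

End Minor.

(** * Continuity method *)

Section Continuation.
Variable R : realType.

Lemma closed_cgood (T : topologicalType) n (F : T -> 'M[R]_n) : mxcont F ->
  closed [set x | cgood (F x)].
Proof.
move=> cF; apply: closed_and.
  by apply: closed_lef; [apply: cont_cst|apply: mxcont_det].
apply: closed_forall => u; apply: closed_forall => v; apply: closed_imp.
apply: closed_lef; first exact: cont_cst.
by apply: contD; apply: mxcont_dot; apply: mxcont_mul => //; apply: mxcont_cst.
Qed.

(** Failure of [sgood] is a determinant at most 0 or an orthonormal pair of sum at most 1, closed
    conditions on compact sets, whose projections are closed. This is the openness in the continuity
    arguments. *)
Lemma closed_bad (T : topologicalType) n (K Z : set T) (h : T -> R)
  (F : T * R -> 'M[R]_n) : compact K -> closed Z -> continuous h -> mxcont F ->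
  closed [set r | exists x, [/\ (K `&` Z) x, h x = r
                             & exists2 t, 0 <= t <= 1 & ~ sgood (F (x, t))]].
Proof.
move=> cK cZ ch cF.
pose box := [set A : 'rV[R]_n | forall i j, -1 <= A i j <= 1].
have cbox : compact box by apply: mx_compact.
pose S := (T * R)%type; pose V := ('rV[R]_n * 'rV[R]_n)%type.
pose U := (S * V)%type.
pose D := [set r | exists x, [/\ (K `&` Z) x, h x = r
                             & exists2 t, 0 <= t <= 1 & \det (F (x, t)) <= 0]].
pose P := [set r | exists x, [/\ (K `&` Z) x, h x = r
   & exists2 t, 0 <= t <= 1 & exists u v, orthopair u v /\
     sqn (u *m F (x, t)) + sqn (v *m F (x, t)) <= 1]].
rewrite (_ : [set r | _] = D `|` P); last first.
  apply/seteqP; split=> r /=.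
    move=> [x [Kx hx [t t01 bad]]].
    have [d|d] := leP (\det (F (x, t))) 0; first by left; exists x; split=> //; exists t.
    right; exists x; split=> //; exists t => //; apply: contrapT => no; apply: bad.
    split=> // u v uv; rewrite ltNge; apply/negP => le1; apply: no; exists u, v.
    by split.
  case=> -[x [Kx hx [t t01]]]; last move=> [u [v [uv]]]; move=> le1; exists x; split=> //;
    exists t => // -[d p].
    by move: le1; rewrite leNgt d.
  by move: le1; rewrite leNgt p.
have sx : continuous (fun x : S => x.1) by move=> x; apply: cvg_fst.
have st : continuous (fun x : S => x.2) by move=> x; apply: cvg_snd.
have us : continuous (fun x : U => x.1) by move=> x; apply: cvg_fst.
have uv : continuous (fun x : U => x.2) by move=> x; apply: cvg_snd.
have comp (A B C : topologicalType) (p : A -> B) (q : B -> C) :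
  continuous p -> continuous q -> continuous (fun x => q (p x)).
  by move=> cp cq x; apply: (@continuous_comp _ _ _ p q); [exact: cp|exact: cq].
have pre (A B : topologicalType) (p : A -> B) (Q : set B) :
  continuous p -> closed Q -> closed [set x | Q (p x)].
  by move=> cp cQ; apply: preimage_closed => // x _; apply: cp.
apply: closedU.
  rewrite (_ : D = (fun x : S => h x.1) @` ((K `*` `[0, 1]) `&`
     [set x | Z x.1 /\ \det (F x) <= 0])).
    apply: compact_proj_closed.
    - by apply: compact_setX => //; apply: segment_compact.
    - apply: closed_and; first exact: (pre S T _ Z sx).
      by apply: closed_lef; [apply: mxcont_det|apply: cont_cst].
    - exact: (comp S T R _ _ sx ch).
  apply/seteqP; split=> r /=.
    move=> [x [[Kx Zx] hx [t t01 d]]]; exists (x, t) => //; split=> //; split=> //=.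
  move=> [[x t] [[/= Kx t01] [Zx d]] <-]; exists x; split=> //; exists t => //.
rewrite (_ : P = (fun x : U => h x.1.1) @` (((K `*` `[0, 1]) `*` (box `*` box)) `&`
   [set x | Z x.1.1 /\ (orthopair x.2.1 x.2.2 /\
      sqn (x.2.1 *m F x.1) + sqn (x.2.2 *m F x.1) <= 1)])).
  have s1 := comp U S T _ _ us sx.
  have v1 : mxcont (fun x : U => x.2.1).
    by apply: mxcont_of; apply: (comp U V _ _ (fun x : V => x.1) uv) => x; apply: cvg_fst.
  have v2 : mxcont (fun x : U => x.2.2).
    by apply: mxcont_of; apply: (comp U V _ _ (fun x : V => x.2) uv) => x; apply: cvg_snd.
  have cFu : mxcont (fun x : U => F x.1) by apply: (mxcont_comp us cF).
  apply: compact_proj_closed.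
  - apply: compact_setX; last exact: compact_setX.
    by apply: compact_setX => //; apply: segment_compact.
  - apply: closed_and; first exact: (pre U T _ Z s1).
    apply: closed_and; first exact: closed_orthopair.
    apply: closed_lef; last exact: cont_cst.
    by apply: contD; apply: mxcont_dot; apply: mxcont_mul.
  - exact: (comp U T R _ _ s1 ch).
apply/seteqP; split=> r /=.
  move=> [x [[Kx Zx] hx [t t01 [u [v [uv' d]]]]]]; exists ((x, t), (u, v)) => //.
  split=> //; split=> /=; first by split=> //=; rewrite ?in_itv.
  by case: uv' => ? ? _; split; apply: unit_box.
move=> [[[x t] [u v]] [[[/= Kx t01] _] [Zx [uv' d]]] <-]; exists x; split=> //.
exists t; first by [].
by exists u, v.
Qed.

Lemma closed_first_time (B : set R) (L : R) : closed B ->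
  (forall s, 0 <= s <= L -> (forall r, 0 <= r < s -> ~ B r) -> ~ B s) ->
  forall s, 0 <= s <= L -> ~ B s.
Proof.
move=> cB step s s_in Bs.
pose E := B `&` `[0, s]%classic.
have cE : closed E by apply: closedI => //; apply: itv_closed.
have Es : E s by split=> //=; case/andP: s_in => s0 _; rewrite in_itv /= s0 lexx.
have hE : has_inf E.
  split; first by exists s.
  by exists 0 => x [_ /=]; rewrite in_itv /= => /andP[].
have Ei : E (inf E).
  rewrite {1}(closure_id E).1 // => U /nbhs_ballP[e /= e0 eU].
  have [x Ex xe] := inf_adherent e0 hE; exists x; split=> //; apply: eU.
  have : inf E <= x by apply: ge_inf => //; case: hE.
  by rewrite /ball /= distrC => ix; rewrite ger0_norm ?subr_ge0 // ltrBlDl.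
case: Ei => Bi; rewrite /= in_itv /= => /andP[i0 is'].
apply: (step (inf E)) => //.
  by rewrite i0 (le_trans is') //; case/andP: s_in.
move=> r /andP[r0 ri] Br.
have : inf E <= r.
  apply: ge_inf; first by case: hE.
  by split=> //=; rewrite in_itv /= r0 (le_trans (ltW ri)).
by rewrite leNgt ri.
Qed.

Lemma closed_left_limit (I : set R) s : closed I -> 0 < s ->
  (forall r, 0 <= r < s -> I r) -> I s.
Proof.
move=> cI s0 h; rewrite (closure_id I).1 // => U /nbhs_ballP[e /= e0 eU].
pose r := Num.max 0 (s - e / 2%:R).
exists r; split.
  apply: h; rewrite le_max lexx /= gt_max s0 /= ltrBlDr ltrDl divr_gt0 //.
apply: eU; rewrite /ball /= ltr_norml; apply/andP; split.
  have : r < s by rewrite gt_max s0 /= ltrBlDr ltrDl divr_gt0.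
  lra.
have : s - e / 2%:R <= r by rewrite le_max lexx orbT.
lra.
Qed.

End Continuation.

Section Families.
Variables (R : realType) (n N : nat) (a : 'M[R]_(n, N)).
Hypothesis oa : ortho a.

Lemma mxcont_curve_family (T : topologicalType) (e f : T -> 'M[R]_(n, N))
  (th : T -> 'rV[R]_n) (t : T -> R) : mxcont e -> mxcont f -> mxcont th ->
  continuous t -> mxcont (fun x => curve (e x) (f x) (th x) (t x)).
Proof.
move=> ce cf cth ct i j; under eq_fun do rewrite curveE.
have c1 (g : R -> R) : continuous g -> continuous (fun x => g (t x * th x 0 i)).
  move=> cg x; apply: (@continuous_comp _ _ _ (fun x => t x * th x 0 i) g).
    by move: x; apply: contM => //; apply: cth.
  exact: cg.
apply: contD; apply: contM; [|exact: ce| |exact: cf]; apply: c1.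
  exact: continuous_cos.
exact: continuous_sin.
Qed.

Definition all_good e f th := forall t, 0 <= t <= 1 -> sgood (curve e f th t *m a^T).

(** At a first time of failure the curve is a limit of good ones, so it satisfies the weak
    conditions, which [pairs_max_principle] makes strict again. *)
Lemma good_family (L : R) (e f : R -> 'M[R]_(n, N)) (th : 'rV[R]_n) :
  mxcont e -> mxcont f ->
  (forall s, 0 <= s <= L -> geo_data (e s) (f s) th) ->
  (forall s, 0 <= s <= L -> sgood (curve (e s) (f s) th 0 *m a^T)) ->
  (forall s, 0 <= s <= L -> sgood (curve (e s) (f s) th 1 *m a^T)) ->
  all_good (e 0) (f 0) th ->
  forall s, 0 <= s <= L -> all_good (e s) (f s) th.
Proof.
move=> ce cf hg g0 g1 good0.
pose F (x : R * R) := curve (e x.1) (f x.1) th x.2 *m a^T.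
have c1 : continuous (fun x : R * R => x.1) by move=> x; apply: cvg_fst.
have c2 : continuous (fun x : R * R => x.2) by move=> x; apply: cvg_snd.
have cF : mxcont F.
  apply: mxcont_mul; last exact: mxcont_cst.
  apply: (@mxcont_curve_family _ (fun x => e x.1) (fun x => f x.1) (fun=> th) (fun x => x.2)) => //.
  - exact: (mxcont_comp c1 ce).
  - exact: (mxcont_comp c1 cf).
  - exact: mxcont_cst.
have cB := @closed_bad R R n `[0, L] setT id F (@segment_compact _ 0 L) (@closedT _)
  (fun x => @cvg_id _ _) cF.
have := closed_first_time cB (L := L).
move=> H s sL t t01; apply: contrapT => bad; apply: (H _ s sL); last first.
  by exists s; split=> //; exists t.
move=> {s sL t t01 bad} s sL hr [x [_ xs [t t01]]]; apply; rewrite /F {x}xs /=.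
have goodr r : 0 <= r < s -> all_good (e r) (f r) th.
  move=> rs t' t'01; apply: contrapT => bad; apply: (hr r rs).
  exists r; split=> //; last by exists t'.
  split=> //=; rewrite in_itv /=; case/andP: rs => -> rs /=; apply: ltW.
  by apply: lt_le_trans rs _; case/andP: sL.
case/andP: (sL) => s0 _; have [s0'|] := ltP 0 s; last first.
  move=> s0'; have -> : s = 0 by apply/eqP; rewrite eq_le s0 s0'.
  exact: good0.
have cg t' : 0 <= t' <= 1 -> cgood (curve (e s) (f s) th t' *m a^T).
  move=> t'01; apply: (@closed_left_limit R [set r | cgood (curve (e r) (f r) th t' *m a^T)] s _ s0').
    apply: closed_cgood; apply: mxcont_mul; last exact: mxcont_cst.
    apply: (@mxcont_curve_family _ e f (fun=> th) (fun=> t') ce cf).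
      exact: (@mxcont_cst R R 1 n th).
    exact: (@cont_cst R R t').
  by move=> r rs; apply: sgoodW; apply: goodr.
exact: (pairs_max_principle (hg s sL) oa cg (g0 s sL) (g1 s sL) t01).
Qed.

Lemma plane_rot_diagC (d : 'rV[R]_n) i j c s : d 0 i = d 0 j ->
  plane_rot i j c s *m diag_mx d = diag_mx d *m plane_rot i j c s.
Proof.
move=> dij; apply/matrixP => p q; rewrite plane_rotE -[in RHS](mulmx1 (plane_rot _ _ _ _)).
rewrite mul_diag_mx [RHS]mxE plane_rotE !mxE.
have e (x : 'I_n) : d 0 x *+ (x == q) = d 0 x * (x == q)%:R by rewrite mulr_natr.
rewrite !e; have [->|_] := eqVneq p i; first by rewrite dij; ring.
by have [->|_] := eqVneq p j; rewrite ?dij; ring.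
Qed.

(** Rows i and j of [f] are unit vectors since their angles are nonzero, so the diagonal Gram matrix
    of [f] commutes with the rotation. *)
Lemma geo_data_rot (e f : 'M[R]_(n, N)) (th : 'rV[R]_n) i j c s : i != j ->
  geo_data e f th -> th 0 i != 0 -> th 0 j != 0 -> c ^+ 2 + s ^+ 2 = 1 ->
  geo_data (plane_rot i j c s *m e) ((plane_rot i j c s)^T *m f) th.
Proof.
move=> ij [oe ef ff thf] thi thj cs.
have ok := plane_rot_ortho ij cs.
have f1 p : th 0 p != 0 -> dot (row p f) (row p f) = 1.
  move=> tp; have /eqP := thf p; rewrite mulf_eq0 (negbTE tp) subr_eq0 => /eqP //.
have Gram : ((plane_rot i j c s)^T *m f) *m ((plane_rot i j c s)^T *m f)^T = f *m f^T.
  pose d : 'rV[R]_n := \row_p dot (row p f) (row p f).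
  have e1 : f *m f^T = diag_mx d.
    apply/matrixP => p q; rewrite mulmx_trE [RHS]mxE [d _ _]mxE.
    by have [->|pq] := eqVneq p q; [rewrite mulr1n|rewrite mulr0n ff].
  rewrite trmx_mul trmxK mulmxA -(mulmxA _ f) e1.
  rewrite plane_rot_tr // plane_rot_diagC; last by rewrite ![d _ _]mxE !f1.
  by rewrite -plane_rot_tr // -mulmxA orthoC // mulmx1.
split.
- exact: ortho_mul.
- by rewrite trmx_mul trmxK mulmxA -(mulmxA _ e) ef mulmx0 mul0mx.
- by move=> p q pq; rewrite -mulmx_trE Gram mulmx_trE ff.
- by move=> p; rewrite -mulmx_trE Gram mulmx_trE thf.
Qed.

(* The geodesic is at the cut locus: rotating e_i, e_j and, the other way,
   f_i, f_j keeps its ends. By the maximum principle the whole family is good, but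
   the middle planes of two members differ by replacing two vectors by normal
   ones, which contradicts minor_lt. *)
Lemma rot_cut (e f : 'M[R]_(n, N)) (th : 'rV[R]_n) i j : i != j ->
  geo_data e f th -> 0 < th 0 i < pi -> th 0 i + th 0 j = pi ->
  all_good e f th -> False.
Proof.
move=> ij g /andP[thi0 thipi] cut good.
have ji : j != i by rewrite eq_sym.
have thj : th 0 j = pi - th 0 i by rewrite -cut addrC addKr.
have thi : th 0 i != 0 by rewrite gt_eqF.
have thj0 : th 0 j != 0 by rewrite thj gt_eqF // subr_gt0.
pose k s := plane_rot i j (cos s : R) (sin s).
have cs s : cos s ^+ 2 + sin s ^+ 2 = 1 :> R by apply: cos2Dsin2.
have rk s : rotation (k s) by apply: plane_rot_rotation.
have ck : mxcont k.
  move=> p q; pose A : 'M[R]_n := 1%:M.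
  have kE s : k s p q = if p == i then cos s * A i q + sin s * A j q
      else if p == j then - sin s * A i q + cos s * A j q else A p q.
    by rewrite -plane_rotE mulmx1.
  under eq_fun do rewrite kE.
  have cc : continuous (fun s : R => cos s) by apply: continuous_cos.
  have sc : continuous (fun s : R => sin s) by apply: continuous_sin.
  have nsc : continuous (fun s : R => - sin s) by move=> x; apply: continuousN; apply: sc.
  case: (p == i); last case: (p == j); last exact: cont_cst.
    by apply: contD; apply: contM => //; apply: cont_cst.
  by apply: contD; apply: contM => //; apply: cont_cst.
have kT s : (k s)^T = plane_rot i j (cos s) (- sin s) by apply: plane_rot_tr.
have gk s : geo_data (k s *m e) ((k s)^T *m f) th.
  by apply: geo_data_rot => //; apply: cs.
have k0 : k 0 = 1%:M.
  apply/matrixP => p q; rewrite -[LHS]/((k 0) p q) -(mulmx1 (k 0)) plane_rotE cos0 sin0 !mxE.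
  have [->|_] := eqVneq p i; first by rewrite mul0r mul1r addr0.
  by have [->|_] := eqVneq p j; first by rewrite oppr0 mul0r mul1r add0r.
have end0 s : sgood (curve (k s *m e) ((k s)^T *m f) th 0 *m a^T).
  rewrite curve0 -mulmxA; apply: sgood_rot => //.
  by rewrite -(curve0 e f th); apply: good; rewrite lexx ler01.
have end1 s : sgood (curve (k s *m e) ((k s)^T *m f) th 1 *m a^T).
  (* As th_i + th_j = pi, the cosines at time 1 are opposite and the sines equal, which merges the
     two opposite rotations into one of the end frame. *)
  have -> : curve (k s *m e) ((k s)^T *m f) th 1 = (k s)^T *m curve e f th 1.
    apply/matrixP => p q; rewrite curveE kT !plane_rotE !curveE !mul1r.
    have cj : cos (th 0 j) = - cos (th 0 i) by rewrite thj cosB cospi sinpi; ring.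
    have sj : sin (th 0 j) = sin (th 0 i) by rewrite thj sinB cospi sinpi; ring.
    have [->|_] := eqVneq p i; first by rewrite cj sj; ring.
    by have [->|_] := eqVneq p j; rewrite ?cj ?sj; ring.
  rewrite -mulmxA; apply: sgood_rot; first exact: rotation_tr.
  by apply: good; rewrite ler01 lexx.
have fam := good_family (L := pi / 2%:R) (e := fun s => k s *m e)
  (f := fun s => (k s)^T *m f) (th := th).
have cE : mxcont (fun s => k s *m e) by apply: mxcont_mul => //; apply: mxcont_cst.
have cF : mxcont (fun s => (k s)^T *m f).
  by apply: mxcont_mul; [apply: mxcont_tr|apply: mxcont_cst].
have pi0 : 0 <= (pi / 2%:R : R) <= pi / 2%:R by rewrite lexx andbT divr_ge0 // pi_ge0.
have h01 : 0 <= (2^-1 : R) <= 1 by apply/andP; split; lra.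
have start : all_good (k 0 *m e) ((k 0)^T *m f) th by rewrite k0 trmx1 !mul1mx.
(* At time 1/2 the quarter turn has replaced the vectors i and j by vectors normal to the original
   plane, and the relation between the two planes is symmetric. *)
have := fam cE cF (fun s _ => gk s) (fun s _ => end0 s) (fun s _ => end1 s) start _ pi0 _ h01.
have := good _ h01.
set F := curve e f th 2^-1; set F' := curve _ _ th 2^-1 => goodF goodF'.
have oF : ortho F by apply: curve_ortho.
have oF' : ortho F' by apply: curve_ortho.
have [oe ef ff thf] := g.
have f1 p : th 0 p != 0 -> dot (row p f) (row p f) = 1.
  move=> tp; have /eqP := thf p; rewrite mulf_eq0 (negbTE tp) subr_eq0 => /eqP //.
have krow m (A : 'M[R]_(n, m)) p : row p (k (pi / 2%:R) *m A) =
    if p == i then row j A else if p == j then - row i A else row p A.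
  apply/rowP => q; rewrite mxE plane_rotE cos_pihalf sin_pihalf.
  case: ifP => _; first by rewrite mxE; ring.
  by case: ifP => _; rewrite !mxE //; ring.
have kTrow m (A : 'M[R]_(n, m)) p : row p ((k (pi / 2%:R))^T *m A) =
    if p == i then - row j A else if p == j then row i A else row p A.
  apply/rowP => q; rewrite mxE kT plane_rotE cos_pihalf sin_pihalf.
  case: ifP => _; first by rewrite !mxE; ring.
  by case: ifP => _; rewrite !mxE //; ring.
have cj : cos (2^-1 * th 0 j) = sin (2^-1 * th 0 i).
  rewrite thj mulrBr (_ : 2^-1 * pi = pi / 2%:R); last by rewrite mulrC.
  by rewrite cosB cos_pihalf sin_pihalf; ring.
have sj : sin (2^-1 * th 0 j) = cos (2^-1 * th 0 i).
  rewrite thj mulrBr (_ : 2^-1 * pi = pi / 2%:R); last by rewrite mulrC.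
  by rewrite sinB cos_pihalf sin_pihalf; ring.
have rF' p : row p F' = cos (2^-1 * th 0 p) *: row p (k (pi / 2%:R) *m e)
   + sin (2^-1 * th 0 p) *: row p ((k (pi / 2%:R))^T *m f) by rewrite row_curve.
have other p : p != i -> p != j -> row p F' = row p F.
  by move=> pi pj; rewrite rF' krow kTrow (negbTE pi) (negbTE pj) row_curve.
have D := (dotDl, dotDr, dotZl, dotZr, dotNl, dotNr).
have eE p q : dot (row p e) (row q e) = (p == q)%:R by apply: ortho_rowE.
have eF p q : dot (row p e) (row q f) = 0 by apply: (geo_ef g).
have fE p q : dot (row p f) (row q e) = 0 by rewrite dotC eF.
have perpi p : dot (row i F') (row p F) = 0.
  rewrite rF' krow kTrow eqxx row_curve !D eE eF fE.
  have [->|pi] := eqVneq p i; first by rewrite (negbTE ji) ff //=; ring.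
  have [->|pj] := eqVneq p j; first by rewrite ?eqxx f1 // cj sj /=; ring.
  by rewrite ?(eq_sym j) ?(negbTE pj) ff 1?eq_sym //=; ring.
have perpj p : dot (row j F') (row p F) = 0.
  rewrite rF' krow kTrow (negbTE ji) eqxx row_curve !D eE eF fE.
  have [->|pj] := eqVneq p j; first by rewrite (negbTE ij) ff //=; ring.
  have [->|pi] := eqVneq p i; first by rewrite ?eqxx f1 // cj sj /=; ring.
  by rewrite ?(eq_sym i) ?(negbTE pi) ff 1?eq_sym //=; ring.
have mx0 (G : 'M[R]_(n, N)) (r : 'rV[R]_N) : (forall p, dot r (row p G) = 0) -> r *m G^T = 0.
  by move=> h; apply/rowP => p; rewrite dot_sum_row h mxE.
have lt1 : \det (F' *m a^T) < \det (F *m a^T).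
  by apply: (minor_lt ij) => //; apply: mx0.
have lt2 : \det (F *m a^T) < \det (F' *m a^T).
  apply: (minor_lt ij) => //.
  - by move=> p pi pj; rewrite other.
  - apply: mx0 => p; have [->|pi] := eqVneq p i; first by rewrite dotC perpi.
    have [->|pj] := eqVneq p j; first by rewrite dotC perpj.
    by rewrite other // ortho_rowE // eq_sym (negbTE pi).
  - apply: mx0 => p; have [->|pi] := eqVneq p i; first by rewrite dotC perpi.
    have [->|pj] := eqVneq p j; first by rewrite dotC perpj.
    by rewrite other // ortho_rowE // eq_sym (negbTE pj).
by move: (lt_trans lt1 lt2); rewrite ltxx.
Qed.

End Families.

(** * Uniqueness of geodesics off the cut locus *)

Section CosSum.
Variable R : realType.
Implicit Types x y : R.

Lemma cos_add_ge0 x y : 0 <= x -> 0 <= y -> x + y <= pi -> 0 <= cos x + cos y.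
Proof.
move=> x0 y0 xy; have cy : cos x = - cos (pi - x) by rewrite cosB cospi sinpi; ring.
rewrite cy addrC subr_ge0 leNgt ltr_cos ?in_itv /=; last 2 first.
- by apply/andP; split; lra.
- by apply/andP; split; lra.
by rewrite -leNgt lerBrDr addrC.
Qed.

Lemma cos_add_gt0 x y : 0 <= x -> 0 <= y -> x + y < pi -> 0 < cos x + cos y.
Proof.
move=> x0 y0 xy; have cy : cos x = - cos (pi - x) by rewrite cosB cospi sinpi; ring.
rewrite cy addrC subr_gt0 ltr_cos ?in_itv /=; last 2 first.
- by apply/andP; split; lra.
- by apply/andP; split; lra.
by rewrite ltrBrDr addrC.
Qed.

End CosSum.

Section Uniqueness.
Variables (R : realType) (n N : nat).

Lemma geo_curve1_dot (e f : 'M[R]_(n, N)) (th : 'rV[R]_n) : geo_data e f th ->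
  e *m (curve e f th 1)^T = cosd th 1.
Proof.
move=> [oe ef _ _]; rewrite /curve linearD /= !trmx_mul mulmxDr !mulmxA oe ef mul0mx addr0.
by rewrite mul1mx tr_diag_mx.
Qed.

(** Each pairing of the two ends is a diagonal matrix of cosines, and k, k' relate the two. The
    trace inequality in both directions, once with strict pair sums, forces k = k'. Then k mixes
    only rows of equal angles, so it commutes with the motion. *)
Lemma geo_unique (e f e' f' : 'M[R]_(n, N)) (th th' : 'rV[R]_n) (k k' : 'M[R]_n) :
  geo_data e f th -> geo_data e' f' th' ->
  (forall i, 0 <= th 0 i < pi) -> (forall i, 0 <= th' 0 i < pi) ->
  (forall i j, i != j -> th 0 i + th 0 j < pi) ->
  (forall i j, i != j -> th' 0 i + th' 0 j <= pi) ->
  rotation k -> rotation k' ->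
  e' = k *m e -> curve e' f' th' 1 = k' *m curve e f th 1 ->
  forall t, curve e' f' th' t = k *m curve e f th t.
Proof.
move=> g g' th0 th0' th2 th2' rk rk' eE cE.
have [ok dk] := rk; have [ok' dk'] := rk'.
have Ek : cosd th' 1 = k *m cosd th 1 *m k'^T.
  by rewrite -(geo_curve1_dot g') cE eE trmx_mul -(geo_curve1_dot g) !mulmxA.
have trE (h : 'rV[R]_n) (r : 'M[R]_n) : \tr (cosd h 1 *m r) = \sum_i cos (h 0 i) * r i i.
  by apply: eq_bigr => i _; rewrite cosdE mul1r.
have trE1 (h : 'rV[R]_n) : \tr (cosd h 1) = \sum_i cos (h 0 i).
  by rewrite -[cosd h 1]mulmx1 trE; apply: eq_bigr => i _; rewrite mxE eqxx mulr1.
have sum_le : \sum_i cos (th 0 i) <= \sum_i cos (th' 0 i).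
  have [ho hd] := rotation_mul rk' (rotation_tr rk).
  apply: le_trans (sum_diag_rot_le (s := fun i => cos (th' 0 i)) (g := k' *m k^T) _ ho hd).
    rewrite -trE Ek -!mulmxA (mulmxA k'^T) orthoC // mul1mx mxtrace_mulC -mulmxA orthoC //.
    by rewrite mulmx1 trE1.
  move=> i j ij; have /andP[? ?] := th0' i; have /andP[? ?] := th0' j.
  by apply: cos_add_ge0 => //; apply: th2'.
have kk : k'^T *m k = 1%:M.
  have [ho hd] := rotation_mul (rotation_tr rk') rk.
  apply: (sum_diag_rot_eq (s := fun i => cos (th 0 i)) _ ho hd).
    move=> i j ij; have /andP[? ?] := th0 i; have /andP[? ?] := th0 j.
    by apply: cos_add_gt0 => //; apply: th2.
  apply: le_trans sum_le _; rewrite -trE -trE1 Ek -mulmxA mxtrace_mulC -mulmxA //.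
have kE : k' = k by rewrite -[k]mul1mx -(ok' : k' *m k'^T = _) -mulmxA kk mulmx1.
rewrite {k' rk' ok' dk' kk}kE in cE Ek.
have comm i l : k l i * cos (th 0 i) = cos (th' 0 l) * k l i.
  have := congr1 (mulmx^~ k) Ek; rewrite -!mulmxA orthoC // mulmx1.
  move=> /matrixP/(_ l i); rewrite cosdE mul1r => ->.
  by rewrite mul_mx_diag !mxE mul1r.
have thE i l : k l i != 0 -> th 0 i = th' 0 l.
  move=> kn0; have := comm i l; rewrite mulrC => /(mulIf kn0); apply: cos_inj.
    by have /andP[? ?] := th0 i; rewrite in_itv /=; apply/andP; split=> //; apply: ltW.
  by have /andP[? ?] := th0' l; rewrite in_itv /=; apply/andP; split=> //; apply: ltW.
have kth (F : R -> R) i l : k l i * F (th 0 i) = F (th' 0 l) * k l i.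
  by have [->|kn0] := eqVneq (k l i) 0; rewrite ?mul0r ?mulr0 // (thE _ _ kn0) mulrC.
have sf l q : sin (th' 0 l) * f' l q = sin (th' 0 l) * (k *m f) l q.
  have /matrixP/(_ l q) := cE; rewrite curveE !mul1r eE.
  have -> : (k *m curve e f th 1) l q = cos (th' 0 l) * (k *m e) l q + sin (th' 0 l) * (k *m f) l q.
    rewrite !mxE !mulr_sumr -big_split; apply: eq_bigr => i _ /=.
    rewrite curveE !mul1r mulrDr !mulrA (kth cos) (kth sin); ring.
  by move=> /addrI.
move=> t; apply/matrixP => l q; rewrite curveE.
have -> : (k *m curve e f th t) l q = cos (t * th' 0 l) * (k *m e) l q + sin (t * th' 0 l) * (k *m f) l q.
  rewrite !mxE !mulr_sumr -big_split; apply: eq_bigr => i _ /=.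
  rewrite curveE mulrDr !mulrA (kth (fun x => cos (t * x))) (kth (fun x => sin (t * x))); ring.
rewrite -eE; congr (_ + _); have /andP[th'0 th'pi] := th0' l.
have [->|thn0] := eqVneq (th' 0 l) 0; first by rewrite mulr0 sin0 !mul0r.
have s0 : sin (th' 0 l) != 0.
  by rewrite gt_eqF // sin_gt0_pi // lt0r thn0 th'0.
by congr (_ * _); apply: (mulfI s0); apply: sf.
Qed.

(* At s_i = -1, that is th_i = pi, the direction f_i would not be determined by
   e_i and e'_i. *)
Lemma aligned_geo_data (e e' : 'M[R]_(n, N)) (s : 'rV[R]_n) :
  ortho e -> ortho e' -> e *m e'^T = diag_mx s -> (forall i, -1 < s 0 i) ->
  exists2 f, geo_data e f (\row_i acos (s 0 i)) & curve e f (\row_i acos (s 0 i)) 1 = e' /\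
    forall i j, -1 <= f i j <= 1.
Proof.
move=> oe oe' E sN1.
have E' i j : dot (row i e) (row j e') = (i == j)%:R * s 0 i.
  by rewrite -mulmx_trE E mxE mulr_natl; case: eqP.
have s1 i : s 0 i <= 1.
  have := dot_le (ortho_row1 i oe) (ortho_row1 i oe').
  by rewrite E' eqxx mul1r => /andP[].
have sb i : -1 <= s 0 i <= 1 by rewrite ltW // s1.
pose th := \row_i acos (s 0 i).
have cth i : cos (th 0 i) = s 0 i by rewrite mxE acosK // in_itv /= sb.
(* Where the sine is 0 its inverse is 0 by convention and the row of [f] vanishes; there s_i = 1,
   th_i = 0, and the row of [e] does not move. *)
pose f : 'M[R]_(n, N) := \matrix_i ((sin (th 0 i))^-1 *: (row i e' - s 0 i *: row i e)).
have rf i : row i f = (sin (th 0 i))^-1 *: (row i e' - s 0 i *: row i e) by rewrite rowK.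
have D := (dotDl, dotDr, dotZl, dotZr, dotNl, dotNr).
have E2 i j : dot (row i e') (row j e) = (i == j)%:R * s 0 i.
  by rewrite dotC E' eq_sym; have [->|] := eqVneq i j; rewrite ?mul0r.
have s2 i : sin (th 0 i) ^+ 2 = 1 - s 0 i ^+ 2 by rewrite sin2cos2 cth.
have ff i j : dot (row i f) (row j f) = (sin (th 0 i))^-1 * (sin (th 0 j))^-1 *
    ((i == j)%:R * (1 - s 0 i ^+ 2)).
  rewrite !rf !D E' E2 !ortho_rowE //; have [->|ij] := eqVneq i j; rewrite /=; ring.
have f_sin0 i : sin (th 0 i) = 0 -> s 0 i = 1.
  move=> s0; have := s2 i; rewrite s0 expr0n /= => /eqP; rewrite eq_sym subr_eq0 eq_sym.
  rewrite -subr_eq0 subr_sqr_1 mulf_eq0 subr_eq0 addr_eq0 => /orP[/eqP //|/eqP h].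
  by have := sN1 i; rewrite h ltxx.
have f1 i : sin (th 0 i) != 0 -> dot (row i f) (row i f) = 1.
  move=> sn0; rewrite ff eqxx mul1r -s2; field.
  exact: sn0.
exists f; last split.
- split=> //.
  + apply/matrixP => i j; rewrite mulmx_trE [RHS]mxE rf !D E' ortho_rowE //.
    have [->|ij] := eqVneq i j; rewrite /=; ring.
  + by move=> i j ij; rewrite ff (negbTE ij) mul0r mulr0.
  + move=> i; have [s0|sn0] := eqVneq (sin (th 0 i)) 0; last by rewrite f1 // subrr mulr0.
    by rewrite -/th [th 0 i]mxE (f_sin0 _ s0) acos1 mul0r.
- apply/row_matrixP => i; rewrite row_curve mul1r -/th cth rf.
  have [s0|sn0] := eqVneq (sin (th 0 i)) 0.
    rewrite s0 scale0r addr0 (f_sin0 _ s0) scale1r; apply/eqP.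
    rewrite -subr_eq0 -dot_eq0 !D E' E2 !ortho_rowE // eqxx (f_sin0 _ s0).
    by apply/eqP; ring.
  by rewrite scalerA divff // scale1r addrC subrK.
- move=> i j; have [s0|sn0] := eqVneq (sin (th 0 i)) 0.
    have -> : f i j = 0 by rewrite mxE mxE s0 invr0 mul0r.
    by apply/andP; split; lra.
  have := unit_box (f1 i sn0) 0 j; by rewrite [row i f 0 j]mxE.
Qed.

End Uniqueness.

(** * Deformation of the end planes *)

Section Graphs.
Variables (R : realType) (n N : nat) (a : 'M[R]_(n, N)).
Hypothesis oa : ortho a.

Lemma rotation_between (e e' : 'M[R]_(n, N)) (r : 'M[R]_n) :
  ortho e -> ortho e' -> e' = r *m e -> 0 < \det r -> rotation r.
Proof.
move=> oe oe' E dr; have or : ortho r.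
  by have := oe'; rewrite /ortho E trmx_mul mulmxA -(mulmxA r) oe mulmx1.
by split=> //; have [//|d] := ortho_det or; move: dr; rewrite d; lra.
Qed.

Lemma det_graph_neq0 (e M : 'M[R]_(n, N)) (g : 'M[R]_n) :
  ortho e -> e = g *m M -> \det g != 0.
Proof.
move=> oe E; apply/eqP => /unit_kernel[u u1 ug0].
by have := dot_ortho u u oe; rewrite E mulmxA ug0 mul0mx dot0l u1 => /eqP; rewrite eq_sym oner_eq0.
Qed.

(* The mu_i are the squared singular values of L. *)
Definition flat_graph (L : 'M[R]_(n, N)) : Prop :=
  L *m a^T = 0 /\ exists k (mu : 'rV[R]_n),
  [/\ ortho k, k *m (L *m L^T) *m k^T = diag_mx mu, forall i, 0 <= mu 0 i
    & forall i j, i != j -> mu 0 i * mu 0 j <= 1].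

Variable L : 'M[R]_(n, N).
Hypothesis fL : flat_graph L.

Lemma graph_coord s (g : 'M[R]_n) : g *m (a + s *: L) *m a^T = g.
Proof.
have [La _] := fL; rewrite -mulmxA mulmxDl -scalemxAl La scaler0 addr0.
by rewrite (oa : a *m a^T = _) mulmx1.
Qed.

Lemma graph_gram s : (a + s *: L) *m (a + s *: L)^T = 1%:M + s ^+ 2 *: (L *m L^T).
Proof.
have [La _] := fL; rewrite linearD linearZ /= mulmxDl !mulmxDr -!scalemxAl -!scalemxAr La.
have -> : a *m L^T = 0 by rewrite -[a]trmxK -trmx_mul La trmx0.
by rewrite (oa : a *m a^T = _) !scaler0 addr0 add0r scalerA expr2.
Qed.

(** d_i = (1 + s^2 mu_i)^(1/2) is the factor by which a singular vector of Q is stretched on the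
    graph; its inverse is the cosine of the angle to Q. *)
Lemma graph_spectral s : exists k (d : 'rV[R]_n),
  [/\ ortho k, (a + s *: L) *m (a + s *: L)^T = k^T *m diag_mx (\row_i (d 0 i ^+ 2)) *m k,
      forall i, 0 < d 0 i
    & forall i j, i != j -> (0 <= s <= 1 -> 1 <= (d 0 i)^-1 ^+ 2 + (d 0 j)^-1 ^+ 2) /\
                           (0 <= s < 1 -> 1 < (d 0 i)^-1 ^+ 2 + (d 0 j)^-1 ^+ 2)].
Proof.
have [_ [k [mu [ok E mu0 mu1]]]] := fL.
have p0 i : 0 <= s ^+ 2 * mu 0 i by rewrite mulr_ge0 ?sqr_ge0.
have p1 i : 0 < 1 + s ^+ 2 * mu 0 i by rewrite ltr_pwDl.
have sq i : Num.sqrt (1 + s ^+ 2 * mu 0 i) ^+ 2 = 1 + s ^+ 2 * mu 0 i by rewrite sqr_sqrtr // ltW.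
exists k, (\row_i Num.sqrt (1 + s ^+ 2 * mu 0 i)); split=> //.
- rewrite graph_gram (svd_eq ok ok E).
  have -> : \row_i (\row_i Num.sqrt (1 + s ^+ 2 * mu 0 i)) 0 i ^+ 2 = const_mx 1 + s ^+ 2 *: mu.
    by apply/rowP => i; rewrite !mxE sq.
  rewrite linearD linearZ /= diag_const_mx mulmxDr mulmx1 mulmxDl orthoC //.
  by rewrite -scalemxAr -scalemxAl.
- by move=> i; rewrite mxE sqrtr_gt0.
- move=> i j ij; rewrite !mxE !exprVn !sq.
  have := mu1 _ _ ij; move: (p1 i) (p1 j) (p0 i) (p0 j) (mu0 i) (mu0 j).
  set x := mu 0 i; set y := mu 0 j => px py x0 y0 mx0 my0 xy1.
  (* The excess over 1 has the sign of 1 - s^4 mu_i mu_j, positive for s < 1. *)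
  have -> : (1 + s ^+ 2 * x)^-1 + (1 + s ^+ 2 * y)^-1 =
     1 + (1 - s ^+ 4 * (x * y)) / ((1 + s ^+ 2 * x) * (1 + s ^+ 2 * y)).
    by field; rewrite !gt_eqF.
  have xy0 : 0 <= x * y by rewrite mulr_ge0.
  split=> /andP[s0 s1].
    rewrite lerDl; apply: divr_ge0; last by apply/ltW/mulr_gt0.
    by rewrite subr_ge0 mulr_ile1 ?exprn_ge0 // exprn_ile1.
  rewrite ltrDl; apply: divr_gt0; last exact: mulr_gt0.
  rewrite subr_gt0.
  have s4 : s ^+ 4 < 1 by rewrite exprn_ilt1.
  by apply: le_lt_trans s4; rewrite -[leRHS]mulr1 ler_wpM2l // exprn_ge0.
Qed.

(** By orthonormality O = g k^T diag(d) is orthogonal, so g has the singular values 1/d_i. *)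
Lemma graph_pairs s (g : 'M[R]_n) : ortho (g *m (a + s *: L)) ->
  (0 <= s <= 1 -> pairs_ge1 g) /\ (0 <= s < 1 -> pairs_gt1 g).
Proof.
have [k [d [ok E d0 dd]]] := graph_spectral s.
rewrite /ortho trmx_mul mulmxA -(mulmxA g) E => og.
pose O := g *m k^T *m diag_mx d.
have oO : ortho O.
  rewrite /ortho -og /O !trmx_mul tr_diag_mx trmxK !mulmxA; congr (_ *m _ *m _).
  rewrite -(mulmxA _ (diag_mx d)) mulmx_diag; congr (_ *m diag_mx _).
have gE : g = O *m diag_mx (\row_i (d 0 i)^-1) *m k.
  rewrite /O -(mulmxA _ (diag_mx d)) mulmx_diag.
  have -> : (\row_j (d 0 j * (\row_i (d 0 i)^-1) 0 j)) = const_mx 1.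
    by apply/rowP => i; rewrite !mxE divff // gt_eqF.
  by rewrite diag_const_mx mulmx1 -mulmxA orthoC // mulmx1.
have [pd1 pd2] := pairs_diag (\row_i (d 0 i)^-1).
rewrite gE; split=> s01.
  apply: pairs_ge1_mulr => //; apply: pairs_ge1_mull => //; apply: pd1 => i j ij.
  by rewrite !mxE; apply: (dd _ _ ij).1.
apply: pairs_gt1_mulr => //; apply: pairs_gt1_mull => //; apply: pd2 => i j ij.
by rewrite !mxE; apply: (dd _ _ ij).2.
Qed.

Lemma graph_frame s : exists2 g : 'M[R]_n, ortho (g *m (a + s *: L)) & 0 < \det g.
Proof.
have [k [d [ok E d0 dd]]] := graph_spectral s.
exists (k^T *m diag_mx (\row_i (d 0 i)^-1) *m k).
  rewrite /ortho trmx_mul mulmxA -(mulmxA _ (a + s *: L)) E !trmx_mul trmxK tr_diag_mx.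
  rewrite !mulmxA -(mulmxA _ k k^T) (ok : k *m k^T = _) mulmx1.
  rewrite -(mulmxA _ k k^T) (ok : k *m k^T = _) mulmx1.
  rewrite -(mulmxA k^T) mulmx_diag -(mulmxA k^T) mulmx_diag.
  set v := \row_j _; have -> : v = const_mx 1.
    by apply/rowP => i; rewrite !mxE; field; rewrite gt_eqF.
  by rewrite diag_const_mx mulmx1 orthoC.
rewrite !det_mulmx det_tr mulrAC -expr2 ortho_det2 // mul1r det_diag.
by apply: prodr_gt0 => i _; rewrite mxE invr_gt0.
Qed.

End Graphs.

(** * Geodesics between shrunken graphs *)

Section Homotopy.
Variables (R : realType) (n N : nat) (a L0 L1 : 'M[R]_(n, N)).
Hypotheses (oa : ortho a) (fL0 : flat_graph a L0) (fL1 : flat_graph a L1).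

(* The geodesics from the graph of s L0 to that of s L1 that have the angles of a
   minimizing one. *)
Record datum (s : R) (e f : 'M[R]_(n, N)) (th : 'rV[R]_n) : Prop := Datum {
  datum_geo : geo_data e f th;
  datum_ge0 : forall i, 0 <= th 0 i;
  datum_add : forall i j, i != j -> th 0 i + th 0 j <= pi;
  datum_lepi : forall i, th 0 i <= pi;
  datum_sorted : forall i j : 'I_n, (i < j)%N -> th 0 i <= th 0 j;
  datum_box : forall i j, -1 <= f i j <= 1;
  datum_start : e = e *m a^T *m (a + s *: L0);
  datum_end : curve e f th 1 = curve e f th 1 *m a^T *m (a + s *: L1);
  datum_det0 : 0 <= \det (e *m a^T);
  datum_det1 : 0 <= \det (curve e f th 1 *m a^T) }.

Lemma reflected_frame (e e' : 'M[R]_(n, N)) i :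
  row i e' = - row i e -> (forall j, j != i -> row j e' = row j e) ->
  \det (e' *m a^T) = - \det (e *m a^T).
Proof.
move=> ei ej; have -> : e' = diag_mx (\row_j (if j == i then -1 else 1)) *m e.
  apply/row_matrixP => j; rewrite row_mul row_diag_mx -scalemxAl -rowE mxE.
  by have [->|ji] := eqVneq j i; rewrite ?scaleN1r // scale1r; apply: ej.
rewrite -mulmxA det_mulmx det_diag (bigD1 i) //= mxE eqxx big1 ?mulr1 ?mulN1r //.
by move=> j ji; rewrite mxE (negbTE ji).
Qed.

(** [datum] asks for a weak inequality in order to be closed; it is strict because the coordinates
    of a frame of a graph are invertible. *)
Lemma datum_det0_gt s e f th : datum s e f th -> 0 < \det (e *m a^T).
Proof.
move=> d; have [oe _ _ _] := datum_geo d.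
by rewrite lt_def (datum_det0 d) andbT; apply: det_graph_neq0 (datum_start d).
Qed.

Lemma datum_det1_gt s e f th : datum s e f th -> 0 < \det (curve e f th 1 *m a^T).
Proof.
move=> d; rewrite lt_def (datum_det1 d) andbT; apply: det_graph_neq0 (datum_end d).
exact: curve_ortho (datum_geo d) 1.
Qed.

(** If th_i = pi, the pair sums make the other angles 0 and the geodesic ends at its initial plane
    with the opposite orientation, but both ends are positively oriented over Q. *)
Lemma datum_ltpi s e f th i : datum s e f th -> th 0 i < pi.
Proof.
move=> d; rewrite lt_def (datum_lepi d) andbT; apply/eqP => thi.
have th0 j : j != i -> th 0 j = 0.
  move=> ji; apply/eqP; rewrite eq_le (datum_ge0 d) andbT.
  by have := datum_add d ji; rewrite -thi; lra.
have := datum_det1_gt d; rewrite (@reflected_frame e _ i).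
- by have := datum_det0_gt d; lra.
- by rewrite row_curve mul1r -thi cospi sinpi scale0r addr0 scaleN1r.
- by move=> j /th0 tj; rewrite row_curve mul1r tj cos0 sin0 scale0r addr0 scale1r.
Qed.

Lemma datum_ends s e f th : datum s e f th -> 0 <= s < 1 ->
  sgood (curve e f th 0 *m a^T) /\ sgood (curve e f th 1 *m a^T).
Proof.
move=> d s01; have g := datum_geo d; rewrite curve0.
split; split; [exact: datum_det0_gt d| |exact: datum_det1_gt d|].
  apply: (graph_pairs oa fL0 _).2 s01; rewrite -(datum_start d).
  by case: g.
apply: (graph_pairs oa fL1 _).2 s01; rewrite -(datum_end d).
exact: curve_ortho.
Qed.

Lemma datum_exists s : exists e f th, datum s e f th.
Proof.
have [g0 oe dg0] := graph_frame oa fL0 s.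
have [g1 oe' dg1] := graph_frame oa fL1 s.
set e := g0 *m _ in oe; set e' := g1 *m _ in oe'.
have [k [k' [c [[ok dk] [ok' dk'] E cs c2]]]] := svd (e *m e'^T).
have {}E : k *m e *m (k' *m e')^T = diag_mx c by rewrite -E trmx_mul !mulmxA.
have oke : ortho (k *m e) by apply: ortho_mul.
have oke' : ortho (k' *m e') by apply: ortho_mul.
have dke : 0 < \det (k *m e *m a^T) by rewrite -mulmxA graph_coord // det_mulmx dk mul1r.
have dke' : 0 < \det (k' *m e' *m a^T) by rewrite -mulmxA graph_coord // det_mulmx dk' mul1r.
have cb i : -1 <= c 0 i <= 1.
  have -> : c 0 i = (k *m e *m (k' *m e')^T) i i by rewrite E mxE eqxx mulr1n.
  exact: ortho_trmul_le.
have Ec i : dot (row i (k *m e)) (row i (k' *m e')) = c 0 i.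
  by rewrite -mulmx_trE E mxE eqxx mulr1n.
have pm i (x : R) : x ^+ 2 = 1 -> c 0 i = x -> row i (k' *m e') = x *: row i (k *m e).
  move=> x2 cx; apply/eqP; rewrite -subr_eq0 -dot_eq0.
  rewrite !(dotBl, dotBr, dotZl, dotZr) !ortho_row1 // (dotC (row i (k' *m e'))) Ec cx.
  by apply/eqP; ring: x2.
(* c_i = -1 would force c_j = 1 for the others: the two end planes would agree up to orientation,
   while both are positively oriented over Q. *)
have cN1 i : -1 < c 0 i.
  rewrite lt_def (andP (cb i)).1 andbT; apply/eqP => ci.
  have : \det (k' *m e' *m a^T) = - \det (k *m e *m a^T).
    apply: (@reflected_frame _ _ i).
      by rewrite (pm i (-1)) ?scaleN1r // sqrrN expr1n.
    move=> j ji; rewrite (pm j 1) ?scale1r ?expr1n //.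
    by have := c2 _ _ ji; have /andP[_] := cb j; rewrite ci; lra.
  by move: dke dke'; lra.
have [f gf [c1 fb]] := aligned_geo_data oke oke' E cN1.
exists (k *m e), f, (\row_i acos (c 0 i)); split=> //; rewrite ?c1; try exact: ltW.
- by move=> i; rewrite mxE acos_ge0.
- move=> i j ij; rewrite !mxE -lerBrDr leNgt; apply/negP => lt.
  have := c2 _ _ ij; rewrite leNgt => /negP; apply.
  have [ai aj] : (0 <= acos (c 0 i) <= pi) * (0 <= acos (c 0 j) <= pi).
    by split; rewrite acos_ge0 ?acos_lepi.
  have : cos (acos (c 0 i)) < cos (pi - acos (c 0 j)).
    rewrite ltr_cos ?in_itv /= ?ai //.
    by move/andP: aj => [? ?]; apply/andP; split; lra.
  rewrite cosB cospi sinpi !acosK ?in_itv //=; lra.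
- by move=> i; rewrite mxE acos_lepi.
- move=> i j ij; rewrite !mxE leNgt -ltr_cos ?in_itv /= ?acos_ge0 ?acos_lepi //.
  by rewrite !acosK ?in_itv //= -leNgt cs.
- by rewrite /e mulmxA graph_coord // mulmxA.
- by rewrite /e' mulmxA graph_coord // mulmxA.
Qed.

(* Before s = 1 a good geodesic avoids the cut locus, hence is the only one. *)
Lemma datum_good_unique s e f th e' f' th' : 0 <= s < 1 ->
  datum s e f th -> datum s e' f' th' -> all_good a e f th -> all_good a e' f' th'.
Proof.
move=> s01 d d' good.
have th2 i j : i != j -> th 0 i + th 0 j < pi.
  move=> ij; rewrite lt_def (datum_add d ij) andbT; apply/eqP => cut.
  apply: (rot_cut oa ij (datum_geo d) _ (esym cut) good).
  rewrite (datum_ltpi i d) andbT lt_def (datum_ge0 d) andbT; apply/eqP => thi.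
  by have := datum_ltpi j d; rewrite cut thi add0r ltxx.
have rot (x x' : 'M[R]_(n, N)) (L : 'M[R]_(n, N)) : ortho x -> ortho x' ->
    x = x *m a^T *m (a + s *: L) -> x' = x' *m a^T *m (a + s *: L) ->
    0 < \det (x *m a^T) -> 0 < \det (x' *m a^T) ->
    exists2 k, rotation k & x' = k *m x.
  move=> ox ox' xE xE' dx dx'.
  have xU : x *m a^T \in unitmx by rewrite unitmxE unitfE gt_eqF.
  pose k := x' *m a^T *m invmx (x *m a^T).
  have E : x' = k *m x by rewrite xE mulmxA mulmxKV.
  exists k => //; apply: rotation_between ox ox' E _.
  by rewrite det_mulmx det_inv divr_gt0.
have [oe _ _ _] := datum_geo d; have [oe' _ _ _] := datum_geo d'.
have [k rk E0] := rot _ _ _ oe oe' (datum_start d) (datum_start d')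
  (datum_det0_gt d) (datum_det0_gt d').
have [k' rk' E1] := rot _ _ _ (curve_ortho (datum_geo d) 1) (curve_ortho (datum_geo d') 1)
  (datum_end d) (datum_end d') (datum_det1_gt d) (datum_det1_gt d').
move=> t t01; rewrite (geo_unique (datum_geo d) (datum_geo d') _ _ th2 (datum_add d') rk rk' E0 E1).
- by rewrite -mulmxA; apply: sgood_rot (good t t01).
- by move=> i; rewrite (datum_ge0 d) (datum_ltpi i d).
- by move=> i; rewrite (datum_ge0 d') (datum_ltpi i d').
Qed.

(** For s = 0 both ends are Q and the constant geodesic is a good datum; uniqueness carries this
    over to all others. *)
Lemma datum0_good e f th : datum 0 e f th -> all_good a e f th.
Proof.
have s01 : 0 <= (0 : R) < 1 by rewrite lexx ltr01.
have g : geo_data a 0 (0 : 'rV[R]_n).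
  split; rewrite ?trmx0 ?mulmx0 //; first by move=> i j _; rewrite !row0 dot0l.
  by move=> i; rewrite mxE mul0r.
have cE t : curve a 0 (0 : 'rV[R]_n) t = a.
  by apply/matrixP => i j; rewrite curveE [(0 : 'rV_n) _ _]mxE mulr0 cos0 mul1r mxE mulr0 addr0.
have d0 : datum 0 a 0 0.
  split=> //; rewrite ?cE ?scale0r ?addr0 ?(oa : a *m a^T = _) ?mul1mx ?det1 //.
  - by move=> i; rewrite mxE.
  - by move=> i j _; rewrite !mxE addr0 pi_ge0.
  - by move=> i; rewrite mxE pi_ge0.
  - by move=> i j _; rewrite !mxE.
  - by move=> i j; rewrite !mxE; apply/andP; split; lra.
move=> d; apply: (datum_good_unique s01 d0 d) => t t01.
by have [] := datum_ends d0 s01; rewrite curve0 !cE.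
Qed.

Let T := (R * ('M[R]_(n, N) * ('M[R]_(n, N) * 'rV[R]_n)))%type.
Let is_datum (x : T) := datum x.1 x.2.1 x.2.2.1 x.2.2.2.
(** [datum_box] is what bounds [f]: where th_i = 0, the length of the row f_i is free. *)
Let K : set T := `[0, 1] `*` ([set A : 'M[R]_(n, N) | forall i j, -1 <= A i j <= 1] `*`
  ([set A : 'M[R]_(n, N) | forall i j, -1 <= A i j <= 1] `*`
   [set A : 'rV[R]_n | forall i j, - pi <= A i j <= pi])).

Let projections : [/\ continuous (fun x : T => x.1), mxcont (fun x : T => x.2.1),
  mxcont (fun x : T => x.2.2.1) & mxcont (fun x : T => x.2.2.2)].
Proof.
have p1 (S A B : topologicalType) (p : S -> A * B) :
  continuous p -> continuous (fun x => (p x).1).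
  by move=> cp x; apply: continuous_comp; [apply: cp|apply: cvg_fst].
have p2 (S A B : topologicalType) (p : S -> A * B) :
  continuous p -> continuous (fun x => (p x).2).
  by move=> cp x; apply: continuous_comp; [apply: cp|apply: cvg_snd].
have id_cont : continuous (fun x : T => x) by move=> x; apply: cvg_id.
split; first exact: p1; apply: mxcont_of.
- by apply/p1/p2.
- by apply/p1/p2/p2.
- by apply/p2/p2/p2.
Qed.

Let closed_datum : closed [set x | is_datum x].
Proof.
have [cs ce cf ct] := projections.
have cl (c : R) : mxcont (fun x : T => curve x.2.1 x.2.2.1 x.2.2.2 c).
  by apply: mxcont_curve_family => //; apply: cont_cst.
have ca (F : T -> 'M[R]_(n, N)) : mxcont F -> mxcont (fun x => F x *m a^T).
  by move=> cF; apply: mxcont_mul => //; apply: mxcont_cst.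
have cg (L : 'M[R]_(n, N)) : mxcont (fun x : T => a + x.1 *: L).
  by apply: mxcontD; [apply: mxcont_cst|apply: mxcontZ => //; apply: mxcont_cst].
have crow (F : T -> 'M[R]_(n, N)) i : mxcont F -> mxcont (fun x => row i (F x)).
  by move=> cF p q; under eq_fun do rewrite mxE; apply: cF.
pose P (x : T) := geo_data x.2.1 x.2.2.1 x.2.2.2 /\
  ((forall i, 0 <= x.2.2.2 0 i) /\ ((forall i j, i != j -> x.2.2.2 0 i + x.2.2.2 0 j <= pi) /\
  ((forall i, x.2.2.2 0 i <= pi) /\
  ((forall i j : 'I_n, (i < j)%N -> x.2.2.2 0 i <= x.2.2.2 0 j) /\
  ((forall i j, -1 <= x.2.2.1 i j /\ x.2.2.1 i j <= 1) /\
  ((x.2.1 = x.2.1 *m a^T *m (a + x.1 *: L0) /\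
    curve x.2.1 x.2.2.1 x.2.2.2 1 = curve x.2.1 x.2.2.1 x.2.2.2 1 *m a^T *m (a + x.1 *: L1)) /\
  (0 <= \det (x.2.1 *m a^T) /\ 0 <= \det (curve x.2.1 x.2.2.1 x.2.2.2 1 *m a^T)))))))).
rewrite (_ : [set x | _] = [set x | P x]); last first.
  apply/seteqP; split=> x /=.
    case=> ? ? ? ? ? b *; do 5! [split=> //]; split; first by move=> i j; apply/andP.
    by do !split.
  case=> ? [? [? [? [? [b [[? ?] [? ?]]]]]]]; split=> // i j.
  by have [-> ->] := b i j.
apply: closed_and.
  rewrite (_ : [set x | _] = [set x : T | (x.2.1 *m x.2.1^T = 1%:M /\ x.2.1 *m x.2.2.1^T = 0) /\
    ((forall i j, i != j -> dot (row i x.2.2.1) (row j x.2.2.1) = 0) /\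
    forall i, x.2.2.2 0 i * (dot (row i x.2.2.1) (row i x.2.2.1) - 1) = 0)]); last first.
    by apply/seteqP; split=> x /=; [case=> ? ? ? ?|case=> -[? ?] [? ?]].
  apply: closed_and; apply: closed_and.
  - by apply: closed_eqmx; [apply: mxcont_mul => //; apply: mxcont_tr|apply: mxcont_cst].
  - by apply: closed_eqmx; [apply: mxcont_mul => //; apply: mxcont_tr|apply: mxcont_cst].
  - apply: closed_forall => i; apply: closed_forall => j; apply: closed_imp.
    by apply: closed_eqf; [apply: mxcont_dot; apply: crow|apply: cont_cst].
  - apply: closed_forall => i; apply: closed_eqf; last exact: cont_cst.
    by apply: contM; [|apply: contB; [apply: mxcont_dot; apply: crow|apply: cont_cst]].
apply: closed_and; first by apply: closed_forall => i; apply: closed_lef => //; apply: cont_cst.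
apply: closed_and.
  apply: closed_forall => i; apply: closed_forall => j; apply: closed_imp.
  by apply: closed_lef; [apply: contD|apply: cont_cst].
apply: closed_and; first by apply: closed_forall => i; apply: closed_lef => //; apply: cont_cst.
apply: closed_and.
  by apply: closed_forall => i; apply: closed_forall => j; apply: closed_imp; apply: closed_lef.
apply: closed_and.
  apply: closed_forall => i; apply: closed_forall => j.
  by apply: closed_and; apply: closed_lef => //; apply: cont_cst.
apply: closed_and.
  by apply: closed_and; apply: closed_eqmx => //; apply: mxcont_mul => //; apply: ca.
by apply: closed_and; apply: closed_lef; do ?[exact: cont_cst|apply: mxcont_det; apply: ca].
Qed.

Let compactK : compact K.
Proof.
apply: compact_setX; first exact: segment_compact.
by apply: compact_setX; [|apply: compact_setX]; apply: mx_compact.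
Qed.

Let datum_in s e f th : 0 <= s <= 1 -> datum s e f th ->
  (K `&` [set x | is_datum x]) (s, (e, (f, th))).
Proof.
move=> s01 d; split=> //; split; first by rewrite /= in_itv.
have [oe _ _ _] := datum_geo d.
split=> /=; first by move=> i j; apply: ortho_entry_le.
split=> /= i j; first exact: datum_box d _ _.
rewrite (ord1 i) (datum_lepi d) andbT; apply: le_trans (datum_ge0 d j).
by rewrite oppr_le0 pi_ge0.
Qed.

(** [I] holds the s with some weakly good datum, [B] those with some datum that is not strictly
    good; both are closed. If nothing before r lies in [B], the existence of data and the closedness
    of [I] give a weakly good datum at r. By the maximum principle and uniqueness all data at r are
    then good, so r is not in [B]. At s = 1 the closedness of [I] concludes. *)
Lemma good_datum : exists e f th, datum 1 e f th /\
  forall t, 0 <= t <= 1 -> cgood (curve e f th t *m a^T).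
Proof.
have [cs ce cf ct] := projections.
pose I := (fun x : T => x.1) @` (K `&` ([set x | is_datum x] `&`
  [set x | forall t, 0 <= t <= 1 -> cgood (curve x.2.1 x.2.2.1 x.2.2.2 t *m a^T)])).
have cI : closed I.
  apply: compact_proj_closed => //; apply: closedI => //.
  apply: closed_forall => t; apply: closed_imp; apply: closed_cgood.
  apply: mxcont_mul; last exact: mxcont_cst.
  by apply: mxcont_curve_family => //; apply: cont_cst.
have IP s : 0 <= s <= 1 -> I s <-> exists e f th, datum s e f th /\
    forall t, 0 <= t <= 1 -> cgood (curve e f th t *m a^T).
  move=> s01; split.
    by move=> [[s' [e [f th]]] [_ [d good]] /= <-]; exists e, f, th.
  move=> [e [f [th [d good]]]]; exists (s, (e, (f, th))) => //; split; last by split.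
  by have [] := datum_in s01 d.
pose B := [set r | exists x, [/\ (K `&` [set x | is_datum x]) x, x.1 = r
  & exists2 t, 0 <= t <= 1 & ~ sgood (curve x.2.1 x.2.2.1 x.2.2.2 t *m a^T)]].
have cB : closed B.
  apply: (closed_bad (h := fun x : T => x.1)
    (F := fun y => curve y.1.2.1 y.1.2.2.1 y.1.2.2.2 y.2 *m a^T)) => //.
  apply: mxcont_mul; last exact: mxcont_cst.
  have c1 : continuous (fun y : T * R => y.1) by move=> y; apply: cvg_fst.
  apply: mxcont_curve_family; last by move=> y; apply: cvg_snd.
  - exact: (mxcont_comp c1 ce).
  - exact: (mxcont_comp c1 cf).
  - exact: (mxcont_comp c1 ct).
have notB s e f th : 0 <= s <= 1 -> ~ B s -> datum s e f th -> all_good a e f th.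
  move=> s01 nB d t t01; apply: contrapT => bad; apply: nB.
  by exists (s, (e, (f, th))); split=> //; [exact: datum_in|exists t].
have noB s : 0 <= s < 1 -> ~ B s.
  move=> /andP[s0 s1]; apply: (closed_first_time (L := s) cB _ (s := s)); last by rewrite s0 lexx.
  move=> r /andP[r0 rs] before [[r' [e [f th]]] [[_ /= d] /= rE [t t01]]]; apply.
  move: d t01; rewrite rE => d t01; have r01 : 0 <= r < 1 by rewrite r0 (le_lt_trans rs).
  have [r_eq0|rn0] := eqVneq r 0; first by rewrite r_eq0 in d; apply: datum0_good d t t01.
  have [e' [f' [th' [d' good]]]] : exists e f th, datum r e f th /\
      forall t, 0 <= t <= 1 -> cgood (curve e f th t *m a^T).
    apply/IP; first by rewrite r0 ltW // (le_lt_trans rs).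
    apply: closed_left_limit => //; first by rewrite lt_def rn0.
    move=> q /andP[q0 qr]; have q01 : 0 <= q <= 1 by rewrite q0 ltW // (lt_trans qr); case/andP: r01.
    have [e1 [f1 [th1 d1]]] := datum_exists q.
    apply/IP => //; exists e1, f1, th1; split=> // t' t'01.
    apply: sgoodW; apply: (notB q) => //; apply: before; by rewrite q0.
  have [g0 g1] := datum_ends d' r01.
  apply: (datum_good_unique r01 d' d) t01 => t' t'01.
  exact: (pairs_max_principle (datum_geo d') oa good g0 g1 t'01).
apply/IP; first by rewrite ler01 lexx.
apply: closed_left_limit => // q /andP[q0 q1].
have q01 : 0 <= q <= 1 by rewrite q0 ltW.
have [e [f [th d]]] := datum_exists q.
apply/IP => //; exists e, f, th; split=> // t t01.
by apply: sgoodW; apply: (notB q) => //; apply: noB; rewrite q0.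
Qed.

End Homotopy.

(** * A distance of oriented subspaces *)

Section Angles.
Variable R : realType.
Implicit Types x y : R.

Lemma ler_acos x y : -1 <= x -> x <= y -> y <= 1 -> acos y <= acos x.
Proof.
move=> x1 xy y1; have xb : -1 <= x <= 1 by rewrite x1 (le_trans xy).
have yb : -1 <= y <= 1 by rewrite y1 (le_trans x1).
rewrite leNgt -ltr_cos ?in_itv /= ?acos_ge0 ?acos_lepi //.
by rewrite !acosK ?in_itv //= -leNgt.
Qed.

Lemma mulr_cos_le_sin y : 0 <= y -> y <= pi -> y * cos y <= sin y.
Proof.
rewrite le_eqVlt => /predU1P[<- _|y0 ypi]; first by rewrite mul0r sin0.
have cs : {within `[0, y], continuous (sin : R -> R)}.
  by apply: continuous_subspaceT => x; apply: continuous_sin.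
have [c] := MVT y0 (fun x _ => is_derive_sin x) cs.
rewrite in_itv /= => /andP[c0 cy].
rewrite sin0 !subr0 => ->; rewrite mulrC ler_wpM2r ?(ltW y0) //.
rewrite leNgt ltr_cos ?in_itv /= -?leNgt; last 2 first.
- by rewrite (ltW y0).
- by rewrite (ltW c0) (le_trans _ ypi) // ltW.
exact: ltW.
Qed.

(** For the half angle y, (1 - x)/(1 + x) = tan^2 y, and y cos y <= sin y. *)
Lemma acos_sqr_le x : -1 < x -> x <= 1 -> acos x ^+ 2 <= 4%:R * (1 - x) / (1 + x).
Proof.
move=> x0 x1; have xb : -1 <= x <= 1 by rewrite ltW.
have p0 := acos_ge0 xb; have pi1 := acos_lepi xb.
pose y := acos x / 2%:R.
have xE : x = cos y ^+ 2 - sin y ^+ 2.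
  have <- : cos (y + y) = cos y ^+ 2 - sin y ^+ 2 by rewrite cosD !expr2.
  by have -> : y + y = acos x; [rewrite /y; lra|rewrite acosK // in_itv].
have cs := cos2Dsin2 y.
have le : y * cos y <= sin y by apply: mulr_cos_le_sin; rewrite /y; lra.
have cy : 0 <= cos y by apply: cos_ge0_pihalf; rewrite /y; apply/andP; split; lra.
have -> : acos x = 2%:R * y by rewrite /y; field.
have Dx : 1 - x = 2%:R * sin y ^+ 2 by rewrite xE; lra.
have Sx : 1 + x = 2%:R * cos y ^+ 2 by rewrite xE; lra.
rewrite ler_pdivlMr; last by lra.
rewrite Dx Sx; have : (y * cos y) ^+ 2 <= sin y ^+ 2.
  by rewrite lerXn2r ?nnegrE ?(le_trans _ le) // mulr_ge0 // /y; lra.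
rewrite exprMn; nra.
Qed.

(** Spherical triangle inequality: Cauchy-Schwarz for the components of u and w orthogonal to v
    bounds [dot u w] below by the cosine of the sum of the angles. *)
Lemma acos_triangle n (u v w : 'rV[R]_n) : dot u u = 1 -> dot v v = 1 -> dot w w = 1 ->
  acos (dot u w) <= acos (dot u v) + acos (dot v w).
Proof.
move=> u1 v1 w1; have uv := dot_le u1 v1; have vw := dot_le v1 w1; have uw := dot_le u1 w1.
have [big|small] := leP pi (acos (dot u v) + acos (dot v w)).
  exact: le_trans (acos_lepi uw) big.
have ge0 := addr_ge0 (acos_ge0 uv) (acos_ge0 vw).
rewrite leNgt -ltr_cos ?in_itv /= ?acos_ge0 ?acos_lepi ?ge0 ?(ltW small) //.
rewrite acosK ?in_itv //= -leNgt cosD !acosK ?in_itv //=.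
set a := dot u v; set b := dot v w; rewrite lerBlDr -lerBlDl.
have s2 x : -1 <= x <= 1 -> sin (acos x) ^+ 2 = 1 - x ^+ 2.
  by move=> xb; rewrite sin2cos2 acosK // in_itv.
have s0 x : -1 <= x <= 1 -> 0 <= sin (acos x).
  by move=> xb; rewrite sin_ge0_pi // acos_ge0 // acos_lepi.
have := dot_CS (u - a *: v) (w - b *: v).
rewrite !(dotBl, dotBr, dotZl, dotZr) u1 v1 w1 (dotC v u) (dotC w v) -/a -/b.
move=> CS; apply: le_trans (ler_norm _) _; rewrite -ler_sqr ?nnegrE ?mulr_ge0 ?s0 //.
rewrite real_normK ?num_real // exprMn !s2 //; apply: le_trans (le_trans _ CS) _.
  by rewrite le_eqVlt; apply/orP; left; apply/eqP; ring.
by rewrite le_eqVlt; apply/orP; left; apply/eqP; ring.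
Qed.

End Angles.

Section FrameDistance.
Variables (R : realType) (n N : nat).
Implicit Types (f : 'M[R]_(n, N)) (g k : 'M[R]_n) (r : R).

(* The quantifier on k makes this bound on a distance of frames invariant under a
   common orthogonal transformation of both; the infimum over the rotations of one
   frame is then a distance of oriented subspaces. *)
Definition frame_close f f' r : Prop := forall k, ortho k ->
  \sum_i acos ((k *m f *m (k *m f')^T) i i) ^+ 2 <= r ^+ 2.

Lemma frame_close_refl f : ortho f -> frame_close f f 0.
Proof.
move=> of_ k ok; rewrite big1 ?expr0n //= => i _; rewrite mulmx_trE ortho_row1 ?acos1 ?expr0n //.
exact: ortho_mul.
Qed.

Lemma frame_close_sym f f' r : frame_close f f' r -> frame_close f' f r.
Proof.
move=> c k ok; apply: le_trans (c k ok); apply: ler_sum => i _.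
by rewrite !mulmx_trE dotC.
Qed.

Lemma frame_close_mul f f' r g : ortho g -> frame_close f f' r ->
  frame_close (g *m f) (g *m f') r.
Proof. by move=> og c k ok; rewrite !mulmxA; apply: c; apply: ortho_mul. Qed.

Lemma frame_close_trans f f' f'' r r' : ortho f -> ortho f' -> ortho f'' ->
  0 <= r -> 0 <= r' -> frame_close f f' r -> frame_close f' f'' r' ->
  frame_close f f'' (r + r').
Proof.
move=> o0 o1 o2 r0 r'0 c c' k ok.
pose x := \row_i acos ((k *m f *m (k *m f')^T) i i).
pose y := \row_i acos ((k *m f' *m (k *m f'')^T) i i).
have E (z : 'rV[R]_n) : dot z z = \sum_i z 0 i ^+ 2 by rewrite dotE; apply: eq_bigr => i _; rewrite expr2.
have xr : dot x x <= r ^+ 2.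
  by rewrite E; under eq_bigr do rewrite mxE; apply: c.
have yr : dot y y <= r' ^+ 2.
  by rewrite E; under eq_bigr do rewrite mxE; apply: c'.
have xy : dot x y <= r * r'.
  apply: le_trans (ler_norm _) _; rewrite -ler_sqr ?nnegrE ?mulr_ge0 // real_normK ?num_real // exprMn.
  apply: le_trans (dot_CS x y) _; apply: ler_pM => //; exact: dot_ge0.
apply: (@le_trans _ _ (dot (x + y) (x + y))); last first.
  rewrite !(dotDl, dotDr) (dotC y x) sqrrD; lra.
rewrite E; apply: ler_sum => i _; rewrite [(x + y) _ _]mxE [x _ _]mxE [y _ _]mxE !mulmx_trE.
have o3 : ortho (k *m f) by apply: ortho_mul.
have o4 : ortho (k *m f') by apply: ortho_mul.
have o5 : ortho (k *m f'') by apply: ortho_mul.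
have t := acos_triangle (ortho_row1 i o3) (ortho_row1 i o4) (ortho_row1 i o5).
rewrite lerXn2r ?nnegrE ?(le_trans _ t) ?acos_ge0 //;
  by apply: dot_le; apply: ortho_row1.
Qed.

(** [g] is the polar rotation that makes f (g f')^T symmetric positive. In any orthonormal basis its
    diagonal entries x_i are averages of the s_j with the same sum. By [acos_sqr_le] the squared
    angles add up to at most 4/(2 - c) times the sum of 1 - s_i, and 1 - s_i <= (1 - s_i^2)/(2 - c),
    where the 1 - s_i^2 add up to c. To first order the radius is the norm of the part of f' normal
    to f. *)
Lemma frame_close_local f f' (w := f' *m (1%:M - f^T *m f))
    (c := \sum_i dot (row i w) (row i w)) :
  ortho f -> ortho f' -> 0 < \det (f *m f'^T) -> c < 1 ->
  exists2 g, rotation g & frame_close f (g *m f') (Num.sqrt c / (1 - c / 2%:R)).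
Proof.
move=> of_ of' dp c1.
have [k [k' [s [[ok dk] [ok' dk'] E cs s2]]]] := svd (f *m f'^T).
have Es : f *m f'^T = k^T *m diag_mx s *m k' by apply: svd_eq.
have cE : c = \sum_i (1 - s 0 i ^+ 2).
  have tr (A : 'M[R]_(n, N)) : \sum_i dot (row i A) (row i A) = \tr (A *m A^T).
    by apply: eq_bigr => i _; rewrite mulmx_trE.
  rewrite /c tr trmx_mul [in X in _ *m (X *m _)]linearB /= trmx1 trmx_mul trmxK.
  have pp : (1%:M - f^T *m f) *m (1%:M - f^T *m f) = 1%:M - f^T *m f.
    rewrite mulmxBr mulmx1 mulmxBl mul1mx.
    by rewrite -mulmxA (mulmxA f) (of_ : f *m f^T = _) mul1mx subrr subr0.
  rewrite mulmxA -(mulmxA f') pp mulmxBr mulmx1 mulmxBl (of' : f' *m f'^T = _).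
  have -> : f' *m (f^T *m f) *m f'^T = (f *m f'^T)^T *m (f *m f'^T) by rewrite trmx_mul trmxK !mulmxA.
  rewrite Es !trmx_mul trmxK tr_diag_mx -!mulmxA (mulmxA k k^T) (ok : k *m k^T = _) mul1mx.
  rewrite linearB /= mxtrace_mulC mulmxA -(mulmxA _ k' _) (ok' : k' *m k'^T = _) mulmx1.
  rewrite mulmx_diag mxtrace1 mxtrace_diag sumrB sumr_const card_ord; congr (_ - _).
  by apply: eq_bigr => i _; rewrite mxE expr2.
have sb i : -1 <= s 0 i <= 1.
  have -> : s 0 i = (k *m f *m (k' *m f')^T) i i.
    by rewrite trmx_mul !mulmxA -(mulmxA k) E mxE eqxx mulr1n.
  by apply: ortho_trmul_le; apply: ortho_mul.
have ds : 0 < \prod_i s 0 i.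
  by move: dp; rewrite Es !det_mulmx det_tr dk dk' mulr1 mul1r det_diag.
have s0 i : 0 <= s 0 i.
  rewrite leNgt; apply/negP => si; move: ds; rewrite (bigD1 i) //= ltNge; apply/negP.
  rewrite negbK; apply: mulr_le0_ge0; first exact: ltW.
  by apply: prodr_ge0 => j ji; have := s2 _ _ ji; lra.
have c0 : 0 <= c by apply: sumr_ge0 => i _; apply: dot_ge0.
have s1 i : 0 <= 1 - s 0 i ^+ 2 by rewrite subr_ge0 expr_le1 //; case/andP: (sb i).
have sc i : 1 - c <= s 0 i.
  have : 1 - s 0 i ^+ 2 <= c.
    by rewrite cE (bigD1 i) //= lerDl sumr_ge0 // => j _; apply: s1.
  have := s0 i; have /andP[_] := sb i; nra.
exists (k^T *m k'); first by apply: rotation_mul => //; apply: rotation_tr.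
move=> q oq; pose p := q *m k^T.
have op : ortho p by apply: ortho_mul => //; apply: ortho_tr.
have -> : q *m f *m (q *m (k^T *m k' *m f'))^T = p *m diag_mx s *m p^T.
  rewrite /p !trmx_mul !trmxK -!mulmxA (mulmxA f) Es -!mulmxA (mulmxA k' k'^T).
  by rewrite (ok' : k' *m k'^T = _) mul1mx.
have dE i : (p *m diag_mx s *m p^T) i i = \sum_j p i j ^+ 2 * s 0 j.
  rewrite mul_mx_diag mxE; apply: eq_bigr => j _; rewrite !mxE expr2; ring.
have p1 i : \sum_j p i j ^+ 2 = 1.
  have := ortho_row1 i op; rewrite dotE => <-; apply: eq_bigr => j _.
  by rewrite !mxE expr2.
pose x i := (p *m diag_mx s *m p^T) i i.
have x1 i : 1 - c <= x i <= 1.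
  rewrite /x dE; apply/andP; split.
    rewrite -[leLHS]mulr1 -[X in _ * X <= _](p1 i) mulr_sumr; apply: ler_sum => j _.
    by rewrite mulrC ler_wpM2l ?sqr_ge0.
  rewrite -[leRHS](p1 i); apply: ler_sum => j _; rewrite -[leRHS]mulr1 ler_wpM2l ?sqr_ge0 //.
  by case/andP: (sb j).
have sumx : \sum_i (1 - x i) = \sum_i (1 - s 0 i).
  rewrite !sumrB; congr (_ - _).
  by rewrite -[LHS]/(\tr _) mxtrace_mulC mulmxA orthoC // mul1mx mxtrace_diag.
have c2 : 0 < 2%:R - c by lra.
have -> : (Num.sqrt c / (1 - c / 2%:R)) ^+ 2 = 4%:R / (2%:R - c) * (c / (2%:R - c)).
  rewrite expr_div_n sqr_sqrtr //; field.
  by rewrite !gt_eqF //; lra.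
apply: (@le_trans _ _ (4%:R / (2%:R - c) * \sum_i (1 - x i))).
  rewrite mulr_sumr; apply: ler_sum => i _; have /andP[xc xle] := x1 i.
  apply: le_trans (acos_sqr_le _ xle) _; first by apply: lt_le_trans xc; lra.
  rewrite mulrAC ler_wpM2r ?subr_ge0 // ler_wpM2l // lef_pV2 ?posrE; lra.
rewrite ler_wpM2l ?divr_ge0 ?(ltW c2) // sumx cE mulr_suml; apply: ler_sum => i _.
rewrite -cE ler_pdivlMr //; have := sc i; have /andP[_] := sb i; nra.
Qed.

End FrameDistance.

(** * Angles under rotation of one frame *)

Section Interlacing.
Variable R : realType.

(** A row i other than the last is supported on indices j >= i, so for decreasing s it meets only
    entries up to s_i. In the induction the normalized tail of y is completed in one dimension less,
    and a rotation of the first and last rows puts the first coordinate back. *)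
Lemma hessenberg_completion n (y : 'rV[R]_n.+1) : dot y y = 1 ->
  exists2 k : 'M[R]_n.+1, ortho k & row ord_max k = y /\
    forall i j : 'I_n.+1, (j < i)%N -> (i < n)%N -> k i j = 0.
Proof.
elim: n y => [|n IH] y y1.
  exists y; first by apply/matrixP => i j; rewrite !ord1 mulmx_trE !row_id y1 mxE.
  by split=> [|i j _ //]; apply/rowP => j; rewrite mxE ord1.
pose y' := rsubmx (y : 'rV_(1 + n.+1)); pose r := Num.sqrt (dot y' y').
have [z z1 yz] : exists2 z, dot z z = 1 & y' = r *: z.
  have [y0|yn0] := eqVneq y' 0; last exact: normalize.
  by exists (delta_mx 0 0); rewrite ?dot_delta // /r y0 dot0l sqrtr0 scale0r.
have [k ok [kz ku]] := IH z z1.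
pose K : 'M[R]_(1 + n.+1) := block_mx 1%:M 0 0 k.
have oK : ortho K.
  rewrite /ortho tr_block_mx mulmx_block !trmx0 trmx1 !mulmx0 !mul0mx !mulmx1 !addr0 add0r.
  by rewrite (ok : k *m k^T = _) -scalar_mx_block.
have r2 : y 0 0 ^+ 2 + r ^+ 2 = 1.
  rewrite -y1 /r sqr_sqrtr ?dot_ge0 // !dotE [RHS]big_ord_recl -expr2; congr (_ + _).
  by apply: eq_bigr => j _; rewrite !mxE; congr (y 0 _ * y 0 _); apply/val_inj.
have m0 : (0 : 'I_n.+2) != ord_max by [].
exists (plane_rot 0 ord_max r (- y 0 0) *m K).
  by apply: ortho_mul => //; apply: plane_rot_ortho; rewrite // sqrrN addrC.
have K00 : K 0 0 = 1.
  by rewrite -(lshift0 n.+1 0) block_mxEul mxE eqxx.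
have K0l j : K 0 (lift 0 j) = 0 by rewrite -rshift1 -(lshift0 n.+1 0) block_mxEur mxE.
have Kl0 i : K (lift 0 i) 0 = 0 by rewrite -rshift1 -(lshift0 n.+1 0) block_mxEdl mxE.
have Kll i j : K (lift 0 i) (lift 0 j) = k i j by rewrite -!rshift1 block_mxEdr.
have maxE : ord_max = lift 0 (ord_max : 'I_n.+1) by apply/val_inj.
split.
  apply/rowP => j; rewrite mxE plane_rotE [ord_max == 0]eq_sym (negbTE m0) eqxx opprK maxE.
  have [j' ->|->] := unliftP 0 j.
    rewrite K0l Kll mulr0 add0r; have /rowP/(_ j') := yz; rewrite !mxE => yj.
    have /rowP/(_ j') := kz; rewrite mxE => ->; rewrite -yj; congr (y 0 _).
    by rewrite -rshift1.
  by rewrite K00 Kl0 mulr1 mulr0 addr0.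
move=> i j ji im; rewrite plane_rotE.
have [i0|i0] := eqVneq i 0; first by move: ji; rewrite i0.
have [iM|_] := eqVneq i ord_max; first by move: im; rewrite iM /= ltnn.
move: ji im i0; have [i' ->|->] := unliftP 0 i; last by rewrite eqxx.
have [j' ->|->] := unliftP 0 j; last by rewrite Kl0.
by rewrite !lift0 ltnS => ji im _; rewrite Kll ku.
Qed.

(* If s has a negative entry, it is the last one, and J g has determinant -1 for
   the reflection J that changes its sign: an eigenvector of J g for -1 is taken
   as the last row of k. *)
Lemma acos_rotation_ge n (s : 'rV[R]_n) (g : 'M[R]_n) : rotation g ->
  (forall i j : 'I_n, (i < j)%N -> s 0 j <= s 0 i) ->
  (forall i j, i != j -> 0 <= s 0 i + s 0 j) -> (forall i, -1 <= s 0 i <= 1) ->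
  exists2 k : 'M[R]_n, ortho k &
    \sum_i acos (s 0 i) ^+ 2 <= \sum_i acos ((k *m (diag_mx s *m g) *m k^T) i i) ^+ 2.
Proof.
case: n s g => [|n] s g [og dg] ss s2 sb.
  by exists 1%:M; rewrite ?big_ord0 //; apply: ortho1.
suff [k ok kle] : exists2 k : 'M[R]_n.+1, ortho k & forall i, (k *m (diag_mx s *m g) *m k^T) i i <= s 0 i.
  have osg w : dot w w = 1 -> dot (w *m diag_mx s) (w *m diag_mx s) <= 1.
    move=> <-; rewrite -/(sqn _) sqn_diag dotE; apply: ler_sum => i _.
    by rewrite -expr2 -[leRHS]mul1r ler_wpM2r ?sqr_ge0 // -(real_normK (num_real _)) expr_le1 ?normr_ge0 // ler_norml.
  exists k => //; apply: ler_sum => i _.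
  have b : -1 <= (k *m (diag_mx s *m g) *m k^T) i i <= 1.
    rewrite mulmx_trE row_mul mulmxA; set u := row i k *m _.
    have ki := ortho_row1 i ok.
    have ug : dot (u *m g) (u *m g) <= 1 by rewrite dot_ortho //; apply: osg.
    have := dot_CS (u *m g) (row i k); rewrite ki mulr1 => /le_trans/(_ ug).
    by rewrite -(real_normK (num_real _)) expr_le1 ?normr_ge0 // ler_norml.
  have /andP[b1 b2] := b; have /andP[_ si] := sb i.
  rewrite lerXn2r ?nnegrE ?acos_ge0 ?sb //; exact: ler_acos.
have [pos|/existsNP[m /negP]] := pselect (forall i, 0 <= s 0 i).
  exists 1%:M => [|i]; first exact: ortho1.
  rewrite trmx1 mulmx1 mul1mx mul_diag_mx mxE -[leRHS]mulr1 ler_wpM2l //.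
  by case/andP: (ortho_entry_le i i og).
rewrite -ltNge => sm.
have mE : m = ord_max.
  apply/val_inj/eqP; rewrite eqn_leq leq_ord /= leqNgt; apply/negP => lt.
  have := ss m ord_max lt; have := s2 m ord_max _; rewrite -val_eqE /= ltn_eqF // => /(_ isT); lra.
rewrite {m}mE in sm.
have sp i : i != ord_max -> - s 0 ord_max <= s 0 i by move=> /s2; lra.
pose t : 'rV[R]_n.+1 := \row_i `|s 0 i|.
pose J : 'M[R]_n.+1 := diag_mx (\row_i (if i == ord_max then -1 else 1)).
have tJ : diag_mx s = diag_mx t *m J.
  rewrite mulmx_diag; congr diag_mx; apply/rowP => i; rewrite !mxE.
  have [->|im] := eqVneq i ord_max; first by rewrite ltr0_norm // mulrN1 opprK.
  by rewrite mulr1 ger0_norm //; have := sp _ im; lra.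
have oJ : ortho J.
  rewrite /ortho tr_diag_mx mulmx_diag -diag_const_mx; congr diag_mx; apply/rowP => i.
  by rewrite !mxE; case: eqP; rewrite ?mulN1r ?opprK ?mulr1.
have dJ : \det J = -1.
  rewrite det_diag (bigD1 ord_max) //= mxE eqxx big1 ?mulr1 // => i im.
  by rewrite mxE (negbTE im).
have oJg : ortho (J *m g) by apply: ortho_mul.
have [y y1 yg] : exists2 y : 'rV[R]_n.+1, dot y y = 1 & y *m (J *m g) = - y.
  by apply: ortho_reflection_eigen => //; rewrite det_mulmx dJ dg mulr1.
have [k ok [ky ku]] := hessenberg_completion y1.
exists k => // i; rewrite tJ -(mulmxA (diag_mx t)) mulmx_trE row_mul (mulmxA (row i k)) dot_mulmx.
have yg' : y *m (J *m g)^T = - y.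
  apply: oppr_inj; rewrite opprK -mulNmx -yg -mulmxA.
  by rewrite (oJg : J *m g *m (J *m g)^T = _) mulmx1.
have t2 j : t 0 j ^+ 2 = s 0 j ^+ 2 by rewrite mxE real_normK ?num_real.
(* J g acts on y as -1, so this entry is minus an average of the |s_j|, the least of which is - s at
   the last index. *)
have [iM|im] := eqVneq i ord_max.
  rewrite iM ky yg' dotNr lerNl dotE -[leLHS]mulr1 -y1 dotE mulr_sumr.
  apply: ler_sum => j _; rewrite mul_mx_diag mxE -mulrA [leRHS]mulrC -mulrA mulrC.
  rewrite [leRHS]mulrC ler_wpM2r -?expr2 ?sqr_ge0 // mxE.
  have [->|/sp] := eqVneq j ord_max; first by rewrite ltr0_norm.
  by move/le_trans; apply; apply: ler_norm.
have si : 0 <= s 0 i by have := sp _ im; lra.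
have il : (i < n)%N by move: im; rewrite -val_eqE /= ltn_neqAle -ltnS ltn_ord andbT.
(* The other rows meet only |s_j| <= s_i, and Cauchy-Schwarz suffices. *)
apply: le_trans (ler_norm _) _; rewrite -ler_sqr ?nnegrE // real_normK ?num_real //.
apply: le_trans (dot_CS _ _) _; rewrite dot_ortho ?(ortho_row1 _ ok) ?mulr1; last exact: ortho_tr.
rewrite -/(sqn _) sqn_diag -[leRHS]mulr1 -(ortho_row1 i ok) dotE mulr_sumr.
apply: ler_sum => j _; rewrite t2 -expr2.
have [ji|ij] := ltnP j i; first by rewrite mxE ku // expr0n !mulr0.
rewrite ler_wpM2r ?sqr_ge0 // -t2 lerXn2r ?nnegrE //; first by rewrite mxE.
have [->|jm] := eqVneq j ord_max; first by rewrite mxE ltr0_norm //; apply: sp.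
rewrite mxE ger0_norm; last by have := sp _ jm; lra.
by move: ij; rewrite leq_eqVlt => /predU1P[/val_inj ->|/ss].
Qed.

End Interlacing.

(** * Length of competitors *)

Lemma real_induction (R : realType) (P : R -> Prop) : P 0 ->
  (forall c, 0 <= c <= 1 -> exists2 d, 0 < d &
     forall t, 0 <= t <= 1 -> `|t - c| < d -> (t <= c -> P t -> P c) /\ (c <= t -> P c -> P t)) ->
  P 1.
Proof.
move=> P0 step.
pose A := [set t | 0 <= t <= 1 /\ P t].
have A0 : A 0 by split; rewrite // lexx ler01.
have sA : has_sup A by split; [exists 0|exists 1 => x [/andP[]]].
have s0 : 0 <= sup A by apply: ub_le_sup => //; case: sA.
have s1 : sup A <= 1 by apply: ge_sup; [exists 0|move=> x [/andP[]]].
have [d d0 dP] := step (sup A) (introT andP (conj s0 s1)).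
have Ps : P (sup A).
  have [x [x01 Px] xs] := sup_adherent d0 sA.
  have xle : x <= sup A by apply: ub_le_sup => //; case: sA.
  apply: (dP x x01 _).1 => //; rewrite ltr_norml; apply/andP; split; lra.
have [s1'|] := ltP (sup A) 1; last by move=> s1'; have -> : 1 = sup A by lra.
pose t := Num.min 1 (sup A + d / 2%:R).
have ts : sup A < t by rewrite lt_min s1' ltrDl divr_gt0.
have t1 : t <= 1 by rewrite ge_min lexx.
have td : t <= sup A + d / 2%:R by rewrite ge_min lexx orbT.
have t01 : 0 <= t <= 1 by rewrite t1 andbT; lra.
have Pt : P t.
  apply: (dP t t01 _).2 => //; last exact: ltW.
  by rewrite ger0_norm ?subr_ge0 ?ltW //; lra.
have : t <= sup A by apply: ub_le_sup; [case: sA|split].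
by rewrite leNgt ts.
Qed.

Lemma der_quotient_cvg (R : realType) (f : R -> R) (c df : R) : is_derive c 1 f df ->
  h^-1 * (f (h + c) - f c) @[h --> 0^'] --> df.
Proof.
move=> [fd <-]; have E : (fun h : R => h^-1 *: ((f \o shift c) (h *: (1 : R)) - f c)) =
    (fun h => h^-1 * (f (h + c) - f c)).
  by apply/funext => h; rewrite /= [h *: 1]mulr1.
by move: fd; rewrite /derivable /derive E.
Qed.

Lemma der_near (R : realType) (f : R -> R) (c df eps : R) : is_derive c 1 f df -> 0 < eps ->
  exists2 d, 0 < d & forall t, `|t - c| < d -> `|f t - f c - (t - c) * df| <= `|t - c| * eps.
Proof.
move=> fd e0; have FF : Filter (0 : R)^' by apply: dnbhs_filter.
have H : nbhs (0 : R) (fun h => h != 0 -> `|df - h^-1 * (f (h + c) - f c)| < eps).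
  exact: (@cvgr_dist_lt _ _ _ _ FF _ _ (der_quotient_cvg fd) eps e0).
have /= [d d0 dH] := (nbhs_ballP (0 : R) _).1 H.
exists d => // t td; have [->|tc] := eqVneq t c; first by rewrite !subrr mul0r subr0 normr0 mul0r.
have h0 : t - c != 0 by rewrite subr_eq0.
have := dH (t - c) _ h0; rewrite /ball /= sub0r normrN subrK => /(_ td) lt.
have -> : f t - f c - (t - c) * df = - ((t - c) * (df - (t - c)^-1 * (f t - f c))) by field.
by rewrite normrN normrM ler_wpM2l // ltW.
Qed.

Section PathLength.
Variables (R : realType) (n m : nat) (F : R -> 'M[R]_(n, n + m)).
Hypothesis hF : mx_C1 F.

Let mxD (t : R) i j : is_derive t 1 (fun s => F s i j) (mx_derive F t i j).
Proof.
have [d _] := hF i j; rewrite mxE derive1E; exact: derivableP (d t).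
Qed.

Lemma C1_mxcont : mxcont F.
Proof. by move=> i j t; apply: is_derive_continuous (mxD t i j). Qed.

Lemma C1_mxcont_derive : mxcont (mx_derive F).
Proof.
by move=> i j; have [_ c] := hF i j; under eq_fun do rewrite mxE.
Qed.

Lemma speed_continuous : continuous (speed F).
Proof.
have cF := C1_mxcont; have cD := C1_mxcont_derive.
have cv : mxcont (velocity F).
  apply: mxcont_mul => //; apply: mxcontD; first exact: mxcont_cst.
  move=> i j; under eq_fun do rewrite mxE; move=> t; apply: cvgN.
  exact: (mxcont_mul (mxcont_tr cF) cF).
move=> t; apply: continuous_comp; last exact: sqrt_continuous.
apply: cont_sum => i; apply: cont_sum => j; under eq_fun do rewrite expr2.
by apply: contM; apply: cv.
Qed.

(** [phi] is the part of F(t) normal to the plane at c. Divided by the time increment its norm tends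
    to the speed, and [frame_close_local] turns it into a radius. *)
Lemma frame_close_speed c eps : 0 < eps -> ortho (F c) -> exists2 d, 0 < d &
  forall t, ortho (F t) -> `|t - c| < d -> exists g r, [/\ rotation g,
    0 <= r, r <= `|t - c| * (speed F c + eps) & frame_close (F c) (g *m F t) r].
Proof.
move=> e0 oc; pose P0 := perp_proj (F c).
have FP0 : F c *m P0 = 0 by rewrite mulmxBr mulmx1 mulmxA (oc : _ = 1%:M) mul1mx subrr.
pose phi i j t := (F t *m P0) i j.
have dphi i j : is_derive c 1 (phi i j) (velocity F c i j).
  rewrite /phi; under eq_fun do rewrite mxE; rewrite [velocity _ _ _ _]mxE.
  apply: (@der_sum R _ _ (fun k t => F t i k * P0 k j)
    (fun k t => mx_derive F t i k * P0 k j)) => k.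
  apply: der_eq (derM (mxD c i k) (der_cst _ _)) _; rewrite mulr0 addr0 //.
pose q h := \sum_i \sum_j (h^-1 * phi i j (h + c)) ^+ 2.
have cq : q h @[h --> 0^'] --> \sum_i \sum_j velocity F c i j ^+ 2.
  apply: cvg_big => [|i _]; first exact: add_continuous.
  apply: cvg_big => [|j _]; first exact: add_continuous.
  have : (fun h => h^-1 * phi i j (h + c)) @ 0^' --> velocity F c i j.
    have := der_quotient_cvg (dphi i j).
    have -> : phi i j c = 0 by rewrite /phi FP0 mxE.
    by under eq_fun do rewrite subr0.
  by move=> h1; under eq_fun do rewrite expr2; rewrite expr2; apply: cvgM.
have idc : (fun h : R => h) @ 0^' --> (0 : R) by apply: cvg_within.
have ch : h * h * q h @[h --> 0^'] --> 0.
  have := cvgM (cvgM idc idc) cq; rewrite !mul0r; exact.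
have cr : Num.sqrt (q h) / (1 - h * h * q h / 2%:R) @[h --> 0^'] --> speed F c.
  rewrite -[speed F c]divr1 -[X in _ / X](subr0 1) -[X in _ / (_ - X)](mul0r (2%:R^-1)).
  apply: cvgM; first by apply: continuous_cvg => //; apply: sqrt_continuous.
  apply: cvgV; first by rewrite mul0r subr0 oner_neq0.
  by apply: cvgB; [apply: cvg_cst|apply: cvgM => //; apply: cvg_cst].
have cd : \det (F c *m (F (h + c))^T) @[h --> 0^'] --> (1 : R).
  have cdet : continuous (fun h => \det (F c *m (F (h + c))^T)).
    apply: mxcont_det; apply: mxcont_mul; first exact: mxcont_cst.
    apply: mxcont_tr; apply: (mxcont_comp (f := fun h => h + c)); last exact: C1_mxcont.
    by move=> h; apply: cvgD; [apply: cvg_id|apply: cvg_cst].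
  have := cdet 0; rewrite /continuous_at add0r (oc : _ = 1%:M) det1 => cd0.
  by apply: cvg_trans cd0; apply: cvg_app; apply: cvg_within.
have FF : Filter (0 : R)^' by apply: dnbhs_filter.
have n1 := @cvgr_lt _ _ _ FF _ _ cr (speed F c + eps) (ltr_pwDr e0 (lexx _)).
have n2 := @cvgr_lt _ _ _ FF _ _ ch 1 ltr01.
have n3 := @cvgr_gt _ _ _ FF _ _ cd 0 ltr01.
have H : nbhs (0 : R) (fun h => h != 0 ->
  Num.sqrt (q h) / (1 - h * h * q h / 2%:R) < speed F c + eps /\
  (h * h * q h < 1 /\ 0 < \det (F c *m (F (h + c))^T))) .
  exact: (filterI n1 (filterI n2 n3)).
have /= [d d0 dH] := (nbhs_ballP (0 : R) _).1 H.
exists d => // t ot td.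
have [->|tc] := eqVneq t c.
  exists 1%:M, 0; split=> //; first exact: rotation1.
    by rewrite subrr normr0 mul0r.
  by rewrite mul1mx; apply: frame_close_refl.
have h0 : t - c != 0 by rewrite subr_eq0.
have [] := dH (t - c) _ h0; first by rewrite /ball /= sub0r normrN.
rewrite subrK => rle [q1 dpos].
have sE : \sum_i dot (row i (F t *m P0)) (row i (F t *m P0)) = (t - c) * (t - c) * q (t - c).
  rewrite /q mulr_sumr; apply: eq_bigr => i _; rewrite dotE mulr_sumr; apply: eq_bigr => j _.
  by rewrite subrK mxE -[(F t *m P0) i j]/(phi i j t); field.
have := frame_close_local oc ot dpos; rewrite sE => /(_ q1) [g rg close].
have sqE : Num.sqrt ((t - c) * (t - c) * q (t - c)) = `|t - c| * Num.sqrt (q (t - c)).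
  by rewrite -expr2 sqrtrM ?sqr_ge0 // sqrtr_sqr.
rewrite sqE in close; exists g, (`|t - c| * Num.sqrt (q (t - c)) / (1 - (t - c) * (t - c) * q (t - c) / 2%:R)).
split=> //; first by rewrite divr_ge0 ?mulr_ge0 ?sqrtr_ge0 // subr_ge0; lra.
by rewrite -(mulrA `|_|) ler_wpM2l // ltW.
Qed.

Lemma path_close : (forall t, 0 <= t <= 1 -> ortho (F t)) -> forall eps, 0 < eps ->
  exists g r, [/\ rotation g, 0 <= r, r <= curve_length F + eps & frame_close (F 0) (g *m F 1) r].
Proof.
move=> oF eps e0.
have int (u : R) : lebesgue_measure.-integrable `[-1, u] (EFin \o speed F).
  apply: continuous_compact_integrable; first exact: segment_compact.
  exact: continuous_subspaceT speed_continuous.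
(* Integrating from -1 makes S differentiable around the whole of [0, 1], ends included. *)
pose S (t : R) := \int[lebesgue_measure]_(x in `[-1, t]) speed F x.
have dS (t : R) : -1 < t -> is_derive t 1 S (speed F t).
  move=> t1; have tt : t < t + 1 by rewrite ltrDl.
  have [dt <-] := continuous_FTC1_closed tt (int _) t1 (@speed_continuous t).
  by rewrite derive1E; apply: derivableP.
have cS (t : R) : -1 < t -> {for t, continuous S}.
  by move=> /dS; apply: is_derive_continuous.
have LE : curve_length F = S 1 - S 0.
  rewrite /curve_length /Rintegral (@continuous_FTC2 _ _ S 0 1) //.
  - exact: continuous_subspaceT speed_continuous.
  - split.
    + by move=> t; rewrite in_itv /= => /andP[t0 _]; have [] := dS t (lt_trans (ltrN10 _) t0).
    + by apply: cvg_at_right_filter; apply: cS; rewrite ltrN10.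
    + by apply: cvg_at_left_filter; apply: cS; lra.
  - move=> t; rewrite in_itv /= => /andP[t0 _]; rewrite derive1E.
    by have [] := dS t (lt_trans (ltrN10 _) t0).
(* The slack eps t pays for two errors of rate eps/2, from [frame_close_speed] and from the
   derivative of S. *)
pose P t := exists g r, [/\ rotation g, 0 <= r, r <= S t - S 0 + eps * t & frame_close (F 0) (g *m F t) r].
have o0 : ortho (F 0) by apply: oF; rewrite lexx ler01.
suff : P 1 by rewrite LE /P mulr1.
apply: real_induction.
  exists 1%:M, 0; split; rewrite ?subrr ?mulr0 ?addr0 //; first exact: rotation1.
  by rewrite mul1mx; apply: frame_close_refl.
move=> c c01; have oc := oF c c01.
have e2 : 0 < eps / 2%:R by rewrite divr_gt0.
have [d1 d10 close] := frame_close_speed e2 oc.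
have c1 : -1 < c by case/andP: c01 => c0 _; lra.
have [d2 d20 Sd] := der_near (dS c c1) e2.
exists (Num.min d1 d2); first by rewrite lt_min d10.
move=> t t01; rewrite lt_min => /andP[td1 td2].
have [h [r [rh r0 rle hc]]] := close t (oF t t01) td1.
have := Sd t td2; rewrite ler_norml => /andP[Sl Su].
have oh : ortho h by case: rh.
split=> tc [g [r' [rg r'0 r'le gc]]].
(* The estimate is centred at c, so the step from t up to c uses it backwards, with the inverse
   rotation. *)
- have og : ortho g by case: rg.
  have rS : r <= S c - S t + eps * (c - t).
    by move: rle Sl Su; rewrite ler0_norm ?subr_le0 // opprB; lra.
  exists (g *m h^T), (r' + r); split; rewrite ?addr_ge0 //; last 2 first.
  + lra.
  + apply: (@frame_close_trans _ _ _ _ (g *m F t)) => //; try apply: ortho_mul => //.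
      exact: oF.
      by apply: ortho_mul => //; apply: ortho_tr.
    rewrite -mulmxA; apply: frame_close_mul => //.
    have -> : F t = h^T *m (h *m F t) by rewrite mulmxA orthoC // mul1mx.
    by apply: frame_close_mul; [apply: ortho_tr|apply: frame_close_sym].
  + by apply: rotation_mul => //; apply: rotation_tr.
- have og : ortho g by case: rg.
  have rS : r <= S t - S c + eps * (t - c).
    by move: rle Sl Su; rewrite ger0_norm ?subr_ge0 //; lra.
  exists (g *m h), (r' + r); split; rewrite ?addr_ge0 //; last 2 first.
  + lra.
  + apply: (@frame_close_trans _ _ _ _ (g *m F c)) => //; try apply: ortho_mul => //.
      by apply: ortho_mul.
      exact: oF.
    by rewrite -mulmxA; apply: frame_close_mul.
  + exact: rotation_mul.
Qed.

(** Carried over to the frames [e] and [curve e f th 1], closeness holds after any common orthogonal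
    transformation; [acos_rotation_ge] supplies one whose squared angles add up to at least those of
    th. *)
Lemma path_length_ge (e f : 'M[R]_(n, n + m)) (th : 'rV[R]_n) (k k' : 'M[R]_n) :
  (forall t, 0 <= t <= 1 -> ortho (F t)) ->
  geo_data e f th -> (forall i, 0 <= th 0 i <= pi) ->
  (forall i j, i != j -> th 0 i + th 0 j <= pi) ->
  (forall i j : 'I_n, (i < j)%N -> th 0 i <= th 0 j) ->
  rotation k -> rotation k' -> F 0 = k *m e -> F 1 = k' *m curve e f th 1 ->
  Num.sqrt (\sum_i th 0 i ^+ 2) <= curve_length F.
Proof.
move=> oF ge th0 th2 ths rk rk' E0 E1; apply/ler_addgt0Pr => eps e0.
have [g [r [rg r0 rle close]]] := path_close oF e0.
apply: le_trans _ rle; rewrite -[r]ger0_norm // -sqrtr_sqr ler_wsqrtr //.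
have [ok _] := rk; have [oe _ _ _] := ge.
pose h := k^T *m g *m k'.
have rh : rotation h by apply: rotation_mul => //; apply: rotation_mul => //; apply: rotation_tr.
pose s : 'rV[R]_n := \row_i cos (th 0 i).
have sb i : -1 <= s 0 i <= 1 by rewrite mxE cos_geN1 cos_le1.
have sth i : acos (s 0 i) = th 0 i by rewrite mxE cosK // in_itv /= th0.
have close' : frame_close e (h *m curve e f th 1) r.
  have -> : h *m curve e f th 1 = k^T *m (g *m F 1) by rewrite E1 /h !mulmxA.
  have -> : e = k^T *m F 0 by rewrite E0 mulmxA orthoC // mul1mx.
  by apply: frame_close_mul => //; apply: ortho_tr.
have [q oq qle] : exists2 q : 'M[R]_n, ortho q &
  \sum_i acos (s 0 i) ^+ 2 <= \sum_i acos ((q *m (diag_mx s *m h^T) *m q^T) i i) ^+ 2.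
  apply: acos_rotation_ge => //; first exact: rotation_tr.
  - move=> i j /ths le; rewrite !mxE leNgt ltr_cos ?in_itv ?th0 //= -leNgt //.
  - move=> i j ij; rewrite !mxE cos_add_ge0 ?th2 //.
      by case/andP: (th0 i).
    by case/andP: (th0 j).
under eq_bigr do rewrite -sth.
apply: le_trans qle _; apply: le_trans (close' q oq).
rewrite le_eqVlt; apply/orP; left; apply/eqP; apply: eq_bigr => i _; congr (acos (_ i i) ^+ 2).
rewrite !trmx_mul -!mulmxA; congr (_ *m _); rewrite !mulmxA; congr (_ *m _ *m _).
rewrite (geo_curve1_dot ge); rewrite /cosd; congr (diag_mx _ *m _ *m _); apply/rowP => j; by rewrite !mxE mul1r.
Qed.

End PathLength.

(** * The Grassmannian and Xi *)

Lemma horner_char_poly (R : comNzRingType) n (A : 'M[R]_n) (x : R) :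
  (char_poly A).[x] = \det (x%:M - A).
Proof.
rewrite /char_poly -[LHS]/(horner_eval x _) -det_map_mx; congr (\det _).
apply/matrixP => i j; rewrite /char_poly_mx !mxE /= /horner_eval.
by rewrite hornerD hornerN hornerMn hornerX hornerC.
Qed.

Lemma poly_eq_nonneg (R : realDomainType) (p q : {poly R}) :
  (forall x, 0 <= x -> p.[x] = q.[x]) -> p = q.
Proof.
move=> pq; apply/eqP; rewrite -subr_eq0; apply/eqP.
apply: (@roots_geq_poly_eq0 _ _ [seq i%:R | i <- iota 0 (size (p - q))]).
- by apply/allP => _ /mapP[i _ ->]; rewrite rootE hornerD hornerN pq ?subrr ?ler0n.
- by rewrite map_inj_uniq ?iota_uniq // => i j /eqP; rewrite eqr_nat => /eqP.
- by rewrite size_map size_iota.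
Qed.

(* Squaring makes the sign and orthogonality ambiguities of the singular values
   of S disappear. *)
Lemma sqr_eigen_perm (R : rcfType) n (S k : 'M[R]_n) (s : 'rV[R]_n) (lam : 'I_n -> R) :
  ortho k -> S *m S = k^T *m diag_mx (\row_i (s 0 i ^+ 2)) *m k ->
  char_poly S = \prod_(i < n) ('X - (lam i)%:P) ->
  exists p : 'S_n, forall i, s 0 i ^+ 2 = lam (p i) ^+ 2.
Proof.
move=> ok SS cS.
have det_sub x : \det (x%:M - S) = \prod_(i < n) (x - lam i).
  rewrite -horner_char_poly cS horner_prod; apply: eq_bigr => i _.
  by rewrite hornerXsubC.
have det_add x : \det (x%:M + S) = \prod_(i < n) (x + lam i).
  have -> : x%:M + S = - ((- x)%:M - S) by rewrite opprB addrC raddfN /= opprK.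
  rewrite -scaleN1r detZ det_sub -[n in _ ^+ n]card_ord -prodr_const -big_split /=.
  by apply: eq_bigr => i _; rewrite mulN1r opprB opprK addrC.
(* At y = x^2 both sides are det (x^2 - S^2): one by the diagonalization of S^2, the other as det (x
   - S) det (x + S). *)
have E : \prod_(i < n) ('X - (s 0 i ^+ 2)%:P) = \prod_(i < n) ('X - (lam i ^+ 2)%:P).
  apply: poly_eq_nonneg => y y0; rewrite !horner_prod.
  pose x := Num.sqrt y; have xE : y = x ^+ 2 by rewrite sqr_sqrtr.
  have -> : \prod_(i < n) ('X - (lam i ^+ 2)%:P).[y] = \det (x%:M - S) * \det (x%:M + S).
    rewrite det_sub det_add -big_split; apply: eq_bigr => i _.
    by rewrite hornerXsubC xE subr_sqr.
  have -> : \prod_(i < n) ('X - (s 0 i ^+ 2)%:P).[y] = \det (diag_mx (\row_i (y - s 0 i ^+ 2))).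
    by rewrite det_diag; apply: eq_bigr => i _; rewrite hornerXsubC mxE.
  have k1 : \det k^T * \det k = 1 by rewrite det_tr -expr2 ortho_det2.
  have F1 : k^T *m diag_mx (\row_i (y - s 0 i ^+ 2)) *m k = y%:M - S *m S.
    have -> : \row_i (y - s 0 i ^+ 2) = const_mx y - \row_i (s 0 i ^+ 2).
      by apply/rowP => i; rewrite !mxE.
    rewrite linearB /= diag_const_mx mulmxBr mulmxBl -SS mul_mx_scalar -scalemxAl orthoC //.
    by rewrite scalemx1.
  have F2 : (x%:M - S) *m (x%:M + S) = y%:M - S *m S.
    rewrite mulmxBl !mulmxDr -scalar_mxM -expr2 -xE scalar_mxC.
    by rewrite opprD addrA addrK.
  by rewrite -[LHS]mul1r -k1 mulrAC -!det_mulmx F1 F2.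
have /tuple_permP[p pE] : perm_eq [seq s 0 i ^+ 2 | i <- enum 'I_n] [tuple lam i ^+ 2 | i < n].
  by apply: prod_XsubC_eq; rewrite /= !big_map -!enumT !big_enum; exact: E.
exists p => i; have : nth 0 [seq s 0 i ^+ 2 | i <- enum 'I_n] i = s 0 i ^+ 2.
  by rewrite (nth_map i) ?size_enum_ord // nth_ord_enum.
by rewrite pE -tnth_nth !tnth_mktuple => ->.
Qed.

Section Quotient.
Variables (R : realType) (n m : nat).

Definition frame_of (V : 'M[R]_(n, n + m)) (oV : ortho V) : orthonormal_frame R n (n + m) :=
  exist (fun E : 'M[R]_(n, n + m) => E *m E^T == 1%:M) V (introT eqP oV).

Lemma oriented_span_eqP (x y : orthonormal_frame R n (n + m)) :
  oriented_span x = oriented_span y <-> exists2 k, rotation k & val y = k *m val x.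
Proof.
have ox (z : orthonormal_frame R n (n + m)) : ortho (val z) by apply/eqP; apply: (valP z).
split.
  move=> /eqmodP /asboolP[k dk E].
  by exists k => //; apply: rotation_between (ox x) (ox y) E dk.
move=> [k [ok dk] E]; apply/eqmodP/asboolP; exists k => //; by rewrite dk.
Qed.

Lemma ortho_val (x : orthonormal_frame R n (n + m)) : ortho (val x).
Proof. by apply/eqP; apply: (valP x). Qed.

(** [Xi] provides some frame b of Q; the rotation from a to b transports the graph map.
    Diagonalizing S^2 = L L^T gives the squared singular values up to order. *)
Lemma Xi_flat_graph (a : orthonormal_frame R n (n + m)) (P : grassmannian R n m) :
  Xi (oriented_span a) P -> exists L, flat_graph (val a) L /\
    exists2 g : 'M[R]_n, 0 < \det g & val (repr P) = g *m (val a + L).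
Proof.
move=> [b [L [lam [/oriented_span_eqP[k [ok dk] bE] [Lb [g dg gE]] [S [Ssym Spsd SS] cS] lam1]]]].
have aE : val a = k^T *m val b by rewrite bE mulmxA orthoC // mul1mx.
exists (k^T *m L); split; last first.
  exists (g *m k); first by rewrite det_mulmx dk mulr1.
  by rewrite gE -mulmxA [in RHS]mulmxDr (mulmxA k) (ok : k *m k^T = _) mul1mx -bE.
split; first by rewrite aE trmx_mul trmxK mulmxA -(mulmxA _ L) Lb mulmx0 mul0mx.
have [q [q' [s [[oq _] [oq' _] E _ _]]]] := svd S.
have {}SS : S *m S = q^T *m diag_mx (\row_i (s 0 i ^+ 2)) *m q /\ S *m S = L *m L^T.
  split=> //; rewrite -{2}Ssym (svd_eq oq oq' E) !trmx_mul trmxK tr_diag_mx -!mulmxA.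
  rewrite (mulmxA q' q'^T) (oq' : q' *m q'^T = _) mul1mx (mulmxA (diag_mx s)) mulmx_diag.
  by congr (_ *m (diag_mx _ *m _)); apply/rowP => i; rewrite !mxE.
have [p pE] := sqr_eigen_perm oq SS.1 cS.
exists (q *m k), (\row_i (s 0 i ^+ 2)); split.
- exact: ortho_mul.
- rewrite !trmx_mul trmxK -!mulmxA (mulmxA k k^T) (ok : k *m k^T = _) mul1mx.
  rewrite (mulmxA k k^T) (ok : k *m k^T = _) mul1mx (mulmxA L) -SS.2 SS.1 -!mulmxA.
  by rewrite (oq : q *m q^T = _) mulmx1 mulmxA (oq : q *m q^T = _) mul1mx.
- by move=> i; rewrite mxE sqr_ge0.
- move=> i j ij; rewrite !mxE !pE -exprMn -(real_normK (num_real _)) expr_le1 //.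
  by apply: lam1; rewrite (inj_eq perm_inj).
Qed.

(** In principal frames k F and k' a the pairing is diag(c) with 0 < c_i <= 1. Dividing the rows of
    k F by c_i gives k' a + L, where the rows of L are orthogonal with the tangents lam_i as
    lengths. *)
Lemma cgood_Xi (a F : orthonormal_frame R n (n + m)) :
  0 < \det (val F *m (val a)^T) -> pairs_ge1 (val F *m (val a)^T) ->
  Xi (oriented_span a) (oriented_span F).
Proof.
move=> dX pX; have oa := ortho_val a; have oF := ortho_val F.
have [k [k' [c [[ok dk] [ok' dk'] E cs c2]]]] := svd (val F *m (val a)^T).
have dc : 0 < \prod_i c 0 i.
  by move: dX; rewrite (svd_eq ok ok' E) !det_mulmx det_tr dk dk' mulr1 mul1r det_diag.
have cn0 i : c 0 i != 0.
  by apply/eqP => ci; move: dc; rewrite (bigD1 i) //= ci mul0r ltxx.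
have c0 i : 0 < c 0 i.
  rewrite lt_def cn0 leNgt; apply/negP => ci; move: dc; rewrite (bigD1 i) //= ltNge; apply/negP.
  rewrite negbK; apply: mulr_le0_ge0; first exact: ltW.
  by apply: prodr_ge0 => j ji; have := c2 _ _ ji; lra.
have kE : k *m val F *m (k' *m val a)^T = diag_mx c.
  by rewrite trmx_mul !mulmxA -(mulmxA k) E.
have c1 i : c 0 i <= 1.
  have -> : c 0 i = (k *m val F *m (k' *m val a)^T) i i by rewrite kE mxE eqxx mulr1n.
  by have /andP[] := ortho_trmul_le i (ortho_mul ok oF) (ortho_mul ok' oa).
have cc i j : i != j -> 1 <= c 0 i ^+ 2 + c 0 j ^+ 2.
  by apply: diag_pairs_ge1; rewrite -E; apply: pairs_ge1_mulr; [apply: ortho_tr|apply: pairs_ge1_mull].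
have oka : ortho (k' *m val a) by apply: ortho_mul.
pose D := diag_mx (\row_i (c 0 i)^-1); pose L := D *m (k *m val F) - k' *m val a.
pose lam i := Num.sqrt ((c 0 i)^-1 ^+ 2 - 1).
have lam0 i : 0 <= (c 0 i)^-1 ^+ 2 - 1.
  by rewrite subr_ge0 exprVn invf_ge1 ?exprn_gt0 // expr_le1 // ltW.
have lam2 i : lam i ^+ 2 = (c 0 i)^-1 ^+ 2 - 1 by rewrite sqr_sqrtr.
have DE : D *m (k *m val F) *m (k' *m val a)^T = 1%:M.
  rewrite -mulmxA kE mulmx_diag -diag_const_mx.
  by congr diag_mx; apply/rowP => i; rewrite !mxE mulVf.
have LL : L *m L^T = diag_mx (\row_i (lam i ^+ 2)).
  have oFk : ortho (k *m val F) by apply: ortho_mul.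
  have tDE : k' *m val a *m (D *m (k *m val F))^T = 1%:M by rewrite -[LHS]trmxK trmx_mul trmxK DE trmx1.
  have -> : L^T = (D *m (k *m val F))^T - (k' *m val a)^T by apply/matrixP => i j; rewrite !mxE.
  rewrite mulmxBl !mulmxBr DE tDE (oka : _ = 1%:M) subrr subr0.
  rewrite trmx_mul mulmxA -(mulmxA D) (oFk : _ = 1%:M) mulmx1 tr_diag_mx mulmx_diag -diag_const_mx -linearB.
  by congr diag_mx; apply/rowP => i; rewrite !mxE lam2 expr2.
exists (frame_of oka), L, lam; split.
- apply/oriented_span_eqP; exists k' => //; by split.
- split; first by rewrite mulmxBl DE (oka : _ = 1%:M) subrr.
  have : oriented_span F = oriented_span (repr (oriented_span F)).
    by rewrite /oriented_span reprK.
  move=> /oriented_span_eqP[r [orr dr] ->].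
  exists (r *m k^T *m diag_mx c).
    by rewrite !det_mulmx det_tr dr dk !mul1r det_diag.
  rewrite /= addrC subrK mulmxA -(mulmxA _ (diag_mx c)) mulmx_diag.
  have -> : \row_j (c 0 j * (\row_i (c 0 i)^-1) 0 j) = const_mx 1.
    by apply/rowP => i; rewrite !mxE mulfV.
  by rewrite diag_const_mx mulmx1 mulmxA -(mulmxA r) orthoC // mulmx1.
- exists (diag_mx (\row_i lam i)).
    split; first by rewrite tr_diag_mx.
      move=> u; rewrite mul_mx_diag mxE; apply: sumr_ge0 => i _; rewrite !mxE mulrAC.
      by rewrite -expr2 mulr_ge0 ?sqr_ge0 // sqrtr_ge0.
    by rewrite LL mulmx_diag; congr diag_mx; apply/rowP => i; rewrite !mxE expr2.
  rewrite char_poly_trig ?diag_mx_is_trig //; apply: eq_bigr => i _.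
  by rewrite !mxE eqxx mulr1n.
(* For the cosines x, y this is (1 - x^2) (1 - y^2) <= x^2 y^2, that is x^2 + y^2 >= 1. *)
- move=> i j ij; rewrite ger0_norm ?mulr_ge0 ?sqrtr_ge0 //.
  rewrite -[leRHS](expr1n _ 2) -ler_sqr ?nnegrE ?mulr_ge0 ?sqrtr_ge0 // expr1n exprMn !lam2.
  have := cc _ _ ij; have := c0 i; have := c0 j; rewrite !exprVn.
  set x := c 0 i; set y := c 0 j => y0 x0 xy.
  have -> : (x ^+ 2)^-1 - 1 = (1 - x ^+ 2) / x ^+ 2 by field; rewrite gt_eqF.
  have -> : (y ^+ 2)^-1 - 1 = (1 - y ^+ 2) / y ^+ 2 by field; rewrite gt_eqF.
  rewrite expr1n mulrACA -invfM ler_pdivrMr ?mulr_gt0 ?exprn_gt0 // mul1r; lra.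
Qed.

End Quotient.

(** * The curves as minimizing geodesics of the Grassmannian *)

Section GeodesicCurve.
Variables (R : realType) (n m : nat) (e f : 'M[R]_(n, n + m)) (th : 'rV[R]_n).
Hypothesis g : geo_data e f th.
Local Notation E := (curve e f th).
Local Notation Y := (normal e f th).

Lemma der_curve_entry (t : R) i j :
  is_derive t 1 (fun s => E s i j) ((diag_mx th *m Y t) i j).
Proof.
have := der_curve e f th (delta_mx 0 i) j t; rewrite -mulmxA -rowE mxE.
by under eq_fun do rewrite -rowE mxE.
Qed.

Lemma der_velocity_entry (t : R) i j :
  is_derive t 1 (fun s => (diag_mx th *m Y s) i j) (- (diag_mx th *m (diag_mx th *m E t)) i j).
Proof.
have := der_normal e f th (row i (diag_mx th)) j t; rewrite -mulmxA -row_mul mxE.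
by under eq_fun do rewrite -row_mul mxE.
Qed.

Lemma curve_derive t : mx_derive E t = diag_mx th *m Y t.
Proof.
by apply/matrixP => i j; rewrite mxE derive1E; have [] := der_curve_entry t i j.
Qed.

Lemma velocity_derive t : mx_derive (fun s => diag_mx th *m Y s) t = - (diag_mx th *m (diag_mx th *m E t)).
Proof.
by apply/matrixP => i j; rewrite mxE derive1E [RHS]mxE; have [] := der_velocity_entry t i j.
Qed.

Lemma curve_velocity t : velocity E t = diag_mx th *m Y t.
Proof.
rewrite /velocity curve_derive mulmxBr mulmx1 !mulmxA -(mulmxA _ (Y t)) (normalmx_perp g).
by rewrite mulmx0 mul0mx subr0.
Qed.

Lemma curve_C2 : mx_C2 E.
Proof.
have dE : mx_derive E = fun t => diag_mx th *m Y t by apply/funext => t; apply: curve_derive.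
have cY i j : continuous (fun t => (diag_mx th *m Y t) i j).
  by move=> t; apply: is_derive_continuous (der_velocity_entry t i j).
split; [|rewrite dE] => i j; split.
- by move=> t; have [] := der_curve_entry t i j.
- rewrite (_ : derive1 _ = fun t => (diag_mx th *m Y t) i j); first exact: cY.
  by apply/funext => t; rewrite derive1E; have [] := der_curve_entry t i j.
- by move=> t; have [] := der_velocity_entry t i j.
- rewrite (_ : derive1 _ = fun t => - (diag_mx th *m (diag_mx th *m E t)) i j).
    move=> t; apply: cvgN; move: t.
    by apply: mxcont_mul; [apply: mxcont_cst|apply: mxcont_mul; [apply: mxcont_cst|apply: mxcont_curve]].
  by apply/funext => t; rewrite derive1E; have [] := der_velocity_entry t i j.
Qed.

(** The frame is horizontal, so the correction term vanishes, and the derivative of the velocity, -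
    th^2 times the frame, lies in the plane itself. *)
Lemma curve_acceleration t : acceleration E t = 0.
Proof.
have vE : velocity E = fun s => diag_mx th *m Y s by apply/funext => s; apply: curve_velocity.
rewrite /acceleration vE velocity_derive curve_derive.
have oE : E t *m (E t)^T = 1%:M by apply: curve_ortho.
have perpE : E t *m perp_proj (E t) = 0 by rewrite mulmxBr mulmx1 mulmxA oE mul1mx subrr.
rewrite mulNmx -!mulmxA perpE !mulmx0 oppr0 sub0r.
by rewrite (mulmxA (Y t)) (normalmx_perp g) mul0mx mulmx0 oppr0.
Qed.

Lemma curve_lengthE : curve_length E = Num.sqrt (\sum_i th 0 i ^+ 2).
Proof.
have -> : curve_length E = \int[lebesgue_measure]_(t in `[0, 1]) Num.sqrt (\sum_i th 0 i ^+ 2).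
  apply: eq_Rintegral => t _; rewrite /speed curve_velocity; congr Num.sqrt.
  apply: eq_bigr => i _; have := thnormal_dot g t i i; rewrite eqxx mul1r => <-.
  rewrite dotE mulr_suml; apply: eq_bigr => j _; rewrite mul_diag_mx !mxE; ring.
rewrite Rintegral_cst //= lebesgue_measure_itv /= lte_fin ltr01 -EFinD /= subr0.
by rewrite mulr1.
Qed.

Lemma curve_minimizing : (forall i, 0 <= th 0 i <= pi) ->
  (forall i j, i != j -> th 0 i + th 0 j <= pi) ->
  (forall i j : 'I_n, (i < j)%N -> th 0 i <= th 0 j) ->
  minimizing_geodesic (fun t => oriented_span (frame_of (curve_ortho g t))).
Proof.
move=> th0 th2 ths; exists E; split.
- by move=> t _; exists (frame_of (curve_ortho g t)).
- exact: curve_C2.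
- by move=> t _; apply: curve_acceleration.
- move=> del F lF cF d0 d1; rewrite curve_lengthE.
  have oF t : 0 <= t <= 1 -> ortho (F t).
    by move=> /lF[x <- _]; apply: ortho_val.
  have fr t : 0 <= t <= 1 -> del t = oriented_span (frame_of (curve_ortho g t)) ->
      exists2 k, rotation k & F t = k *m E t.
    move=> /lF[x <- ->] /esym /oriented_span_eqP[k rk xE].
    by exists k.
  have [k rk F0] := fr 0 (introT andP (conj (lexx _) ler01)) d0.
  have [k' rk' F1] := fr 1 (introT andP (conj ler01 (lexx _))) d1.
  by apply: (path_length_ge cF oF g th0 th2 ths rk rk') => //; rewrite F0 curve0.
Qed.

End GeodesicCurve.

Theorem theorem4p1 (R : realType) (n m : nat)
  (Omega : 'M[R]_(n, n + m) -> R) (Q : grassmannian R n m)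
  (hOmega : simple_unit_form Omega) (hQ : dual_subspace Omega Q) :
  geodesically_convex (Xi Q).
Proof.
case: hQ => a _ ->{Q} P P' XP XP'; have oa := ortho_val a.
have [L0 [fL0 [g0 dg0 E0]]] := Xi_flat_graph XP.
have [L1 [fL1 [g1 dg1 E1]]] := Xi_flat_graph XP'.
have [e [f [th [d good]]]] := good_datum oa fL0 fL1.
have g := datum_geo d.
have dets := curve_det_gt0 g oa good.
have dpos t : 0 <= t <= 1 -> 0 < \det (curve e f th t *m (val a)^T).
  by apply: dets; [rewrite curve0; apply: datum_det0_gt d|apply: datum_det1_gt d].
(* Two frames of the same graph whose coordinates over Q have positive determinants differ by a
   rotation, so the ends of the geodesic are the given planes with their orientations. *)
have ends (x : grassmannian R n m) L (q : 'M[R]_n) (F : 'M[R]_(n, n + m)) (oF : ortho F) :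
    0 < \det q -> val (repr x) = q *m (val a + L) -> F = F *m (val a)^T *m (val a + 1 *: L) ->
    0 < \det (F *m (val a)^T) -> oriented_span (frame_of oF) = x.
  move=> dq xE FE dF; rewrite -[RHS]reprK; apply/oriented_span_eqP => /=.
  have FU : F *m (val a)^T \in unitmx by rewrite unitmxE unitfE gt_eqF.
  have E : val (repr x) = q *m invmx (F *m (val a)^T) *m F.
    by rewrite {2}FE scale1r mulmxA mulmxKV.
  exists (q *m invmx (F *m (val a)^T)) => //; apply: rotation_between oF (ortho_val _) E _.
  by rewrite det_mulmx det_inv divr_gt0.
exists (fun t => oriented_span (frame_of (curve_ortho g t))); split.
- apply: curve_minimizing.
  + by move=> i; rewrite (datum_ge0 d) (datum_lepi d).
  + exact: datum_add d.
  + exact: datum_sorted d.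
- apply: ends dg0 E0 _ _; rewrite curve0; [exact: datum_start d|exact: datum_det0_gt d].
- exact: ends dg1 E1 (datum_end d) (datum_det1_gt d).
- by move=> t t01; apply: cgood_Xi; [exact: dpos|exact: (good t t01).2].
Qed.
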